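(* Fix an integer $n\ge1$ and action counts $d_1,\ldots,d_n\ge1$. There exist constants $\eta_\star>0$ and $C_\star<\infty$, depending only on $(n,d_1,\ldots,d_n)$, such that for every $n$-player game with action counts $d_1,\ldots,d_n$ and loss table $\ell:\prod_{j=1}^nA_j\to[0,1]^n$, and every common constant step size $0<\eta\le\eta_\star$, the Optimistic Hedge iterates satisfy $\mathrm{Reg}_i(T)\le\frac{\log d_i}{\eta}+C_\star\eta$ for every $i\in[n]$ and $T\ge1$, and, with the same constants $\eta_\star,C_\star$, the time-averaged joint distribution $\widehat\mu_T=\frac1T\sum_{t=1}^T\bigotimes_{j=1}^n x_j^t$ satisfies, for every $T\ge1$, $$\mathrm{Gap}_{\rm CCE}(\widehat\mu_T)\le\frac1T\max_{i\in[n]}\left\{\frac{\log d_i}{\eta}+C_\star\eta\right\}.$$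
   Context: Notation: $[q]=\{1,\ldots,q\}$, $\Delta_q=\{x\in\mathbb R_{\ge0}^q:\sum_a x_a=1\}$, logarithms are natural. Games: there are $n$ players; player $i$ has action set $A_i=[d_i]$ and mixed strategies $x_i\in\Delta_{d_i}$. A game is given by a loss table $\ell:\prod_{j=1}^nA_j\to[0,1]^n$, where $[\ell(a)]_i$ is player $i$'s loss at the joint action $a$. For a strategy profile $x=(x_1,\ldots,x_n)$ with $x_{-i}=(x_j)_{j\ne i}$, the expected loss vector of player $i$ is $\ell_i(x_{-i})\in[0,1]^{d_i}$, $$[\ell_i(x_{-i})]_{a_i}=\sum_{a_{-i}\in\prod_{j\ne i}A_j}[\ell(a_i,a_{-i})]_i\prod_{j\ne i}x_{j,a_j}.$$ Optimistic Hedge with common constant step size $\eta>0$: set $\ell_i^0=0\in\mathbb R^{d_i}$ and $x_i^1=(1/d_i,\ldots,1/d_i)$ for every $i$. For $t\ge1$ let $\ell_i^t=\ell_i(x_{-i}^t)$, and for all players simultaneously $$x_{i,a}^{t+1}=\frac{x_{i,a}^t\exp\{-\eta(2\ell_{i,a}^t-\ell_{i,a}^{t-1})\}}{\sum_{b\in A_i}x_{i,b}^t\exp\{-\eta(2\ell_{i,b}^t-\ell_{i,b}^{t-1})\}},\qquad a\in A_i.$$ Individual external regret: $\mathrm{Reg}_i(T)=\sum_{t=1}^T\langle x_i^t,\ell_i^t\rangle-\min_{a\in A_i}\sum_{t=1}^T\ell_{i,a}^t$. Coarse correlated equilibrium (CCE) gap of a probability distribution $\mu$ on $\prod_jA_j$: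 $$\mathrm{Gap}_{\rm CCE}(\mu)=\max_{i\in[n]}\max_{a_i'\in A_i}\mathbb E_{a\sim\mu}\bigl[[\ell(a)]_i-[\ell(a_i',a_{-i})]_i\bigr].$$ *)

(* Defs.v *)
From mathcomp Require Import all_boot all_order all_algebra.
From mathcomp Require Import all_classical all_reals all_analysis.
Import Order.TTheory GRing.Theory Num.Theory.
Local Open Scope ring_scope.

(* Maximum and minimum of a real function on a nonempty finite type; [t0] only
   witnesses nonemptiness, the value does not depend on it. *)
Definition fin_max {R : realType} {T : finType} (t0 : T) (F : T -> R) : R :=
  \big[Num.max/F t0]_(t : T) F t.

Definition fin_min {R : realType} {T : finType} (t0 : T) (F : T -> R) : R :=
  \big[Num.min/F t0]_(t : T) F t.

(* Joint actions: player [i] has the action set ['I_(d i)], numbered from 0. *)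
Notation joint_action d := {dffun forall i, 'I_(d i)}.

(* One vector of R^(d i) for each player [i]. *)
Definition vectors (R : realType) {n : nat} (d : 'I_n -> nat) : Type :=
  forall i : 'I_n, 'I_(d i) -> R.

Section Game.
Context {R : realType} {n : nat} {d : 'I_n -> nat}.

(* [l a i] is the loss of player [i] at the joint action [a]. *)
Variable l : joint_action d -> 'I_n -> R.

(* The joint action (b, a_{-i}). *)
Definition deviate (a : joint_action d) {i : 'I_n} (b : 'I_(d i)) :
    joint_action d :=
  [ffun j => dfwith a i b j].

(* A tuple a_{-i} of opponents' actions is encoded by the joint action a with
   a_i = b, so that (b, a_{-i}) is a itself. *)
Definition expected_loss (x : vectors R d) : vectors R d :=
  fun i b => \sum_(a : joint_action d | a i == b)
               l a i * \prod_(j < n | j != i) x j (a j).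

Definition uniform_profile : vectors R d := fun i _ => (d i)%:R^-1.

Definition hedge_step (eta : R) (x lcur lprev : vectors R d) : vectors R d :=
  fun i a =>
    x i a * expR (- (eta * (2 * lcur i a - lprev i a))) /
    (\sum_(b < d i) x i b * expR (- (eta * (2 * lcur i b - lprev i b)))).

(* [hedge_state eta t] is the pair (x^{t+1}, l^t). *)
Fixpoint hedge_state (eta : R) (t : nat) : vectors R d * vectors R d :=
  match t with
  | 0 => (uniform_profile, fun _ _ => 0)
  | t'.+1 =>
      let: (x, lprev) := hedge_state eta t' in
      let lcur := expected_loss x in
      (hedge_step eta x lcur lprev, lcur)
  end.

(* x^t, meaningful for t >= 1. *)
Definition hedge_strategy (eta : R) (t : nat) : vectors R d :=
  (hedge_state eta t.-1).1.

(* l^t, with l^0 = 0. *)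
Definition hedge_loss (eta : R) (t : nat) : vectors R d :=
  (hedge_state eta t).2.

Definition regret (hd : forall i, (0 < d i)%N) (eta : R) (i : 'I_n) (T : nat) :
    R :=
  (\sum_(1 <= t < T.+1)
     \sum_(a < d i) hedge_strategy eta t i a * hedge_loss eta t i a)
  - fin_min (Ordinal (hd i))
      (fun a => \sum_(1 <= t < T.+1) hedge_loss eta t i a).

(* Distributions on joint actions are given by their mass functions. *)
Definition average_play (eta : R) (T : nat) (a : joint_action d) : R :=
  T%:R^-1 * \sum_(1 <= t < T.+1) \prod_(j < n) hedge_strategy eta t j (a j).

Definition cce_gap (hn : (0 < n)%N) (hd : forall i, (0 < d i)%N)
    (mu : joint_action d -> R) : R :=
  fin_max (Ordinal hn) (fun i =>
    fin_max (Ordinal (hd i)) (fun b =>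
      \sum_(a : joint_action d) mu a * (l a i - l (deviate a b) i))).

End Game.

(* Main.v *)
(** The regret of each player is at most [log d / eta] plus
[eta * sum_t (2 Var_(x^t) (l^t - l^(t-1)) - Var_(x^t) (l^(t-1)) / 8)], by the usual
potential argument. So it suffices to show, for each pair of actions [a], [b], that the
loss gap [f_t = l^t_a - l^t_b] has first differences which are [O(eta)] times [f] in
weighted square mean, up to a constant.

From a state (strategies, preceding losses, loss table), the [k]-th difference of [f]
taken [k] rounds later and divided by [eta ^ k] is a function [g_k] of the state and of
[eta], analytic up to [eta = 0]: a convergent power series in [eta] with polynomial
coefficients. A Hilbert basis theorem with control of norms yields [N] and [C] such that
[|g_N| <= C * sum_(k < N) |g_k|] for all states, tables and small [eta]. Hence [f]
satisfies a linear difference inequality of order [N] with bounded coefficients, and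
interpolation between the successive differences of [f] bounds the first one. *)

Require Import Defs.
From mathcomp Require Import all_boot all_order all_algebra.
From mathcomp Require Import all_classical all_reals all_analysis.
From mathcomp Require Import ring lra.
Import Order.TTheory GRing.Theory Num.Theory.
Local Open Scope ring_scope.
Set Implicit Arguments.
Unset Strict Implicit.
Unset Printing Implicit Defensive.

(** * Normed rings with bounded ideal membership *)

Section Norms.
Variable R : realType.

(** The constants must serve all rounds, all games and all small [eta] at once. A recurrence between
    undivided differences would lack the powers of [eta] on which interpolation relies. Dividing by
    [eta ^ k] is legitimate because strategies move by [O(eta)] per round: a [k]-th difference is
    [O(eta ^ k)] and its quotient stays analytic at 0. Finite generation alone gives no common
    radius and no bound on the coefficients. Elimination is therefore done in weighted l1-norms:
    cancelling a leading coefficient removes its norm and puts back at most half, at a cost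
    proportional to the norm removed. The norm is a budget, so even infinitely many cancellations
    have bounded total cost. In the end, let [S] be the sum over rounds of the squared loss gap of a
    pair of actions, weighted by the product of their probabilities. The positive variance terms
    contribute at most [O(eta ^ 3) * S + O(eta)], and the negative ones, of order [eta * S], absorb
    the first part. Summation by parts is available because the weights change by a factor
    [1 + O(eta)] per round. *)

Definition cube (y : nat -> R) : Prop := forall i, 0 <= y i <= 1.

(** Domination of evaluation on the unit cube turns every estimate on coefficients into one that is
    uniform over states and games. *)
Record is_norm (A : comNzRingType) (ev : (nat -> R) -> A -> R) (cst : R -> A)
    (nu : A -> R) : Prop := IsNorm {
  nrm_ge0 : forall a, 0 <= nu a;
  nrm0 : nu 0 = 0;
  nrmN : forall a, nu (- a) = nu a;
  nrmD : forall a b, nu (a + b) <= nu a + nu b;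
  nrmM : forall a b, nu (a * b) <= nu a * nu b;
  nrm_cst : forall c, nu (cst c) <= `|c|;
  nrm_ev : forall y a, cube y -> `|ev y a| <= nu a }.

(* [p] is a combination of elements of [G] with coefficients of total norm at most [b]. *)
Inductive comb (A : comNzRingType) (nu : A -> R) (G : A -> Prop) : A -> R -> Prop :=
| comb0 b : 0 <= b -> comb nu G 0 b
| combS p b q g : G g -> comb nu G p b -> comb nu G (p + q * g) (b + nu q).

Definition is_ideal (A : comNzRingType) (I : A -> Prop) : Prop :=
  [/\ I 0, forall a b, I a -> I b -> I (a + b) & forall a b, I b -> I (a * b)].

Lemma comb_weaken (A : comNzRingType) (nu : A -> R) G p b b' :
  comb nu G p b -> b <= b' -> comb nu G p b'.
Proof.
move=> h; elim: h b' => [{}b b0 b' bb'|{}p {}b q g Gg _ IH b' bb'].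
  by apply: comb0; apply: le_trans bb'.
rewrite -[b'](subrK (nu q)); apply: combS => //; apply: IH.
by rewrite lerBrDr.
Qed.

Lemma comb_add (A : comNzRingType) (nu : A -> R) G p b p' b' :
  comb nu G p b -> comb nu G p' b' -> comb nu G (p + p') (b + b').
Proof.
move=> h h'; elim: h' => [c c0|{}p' {}b' q g Gg _ IH].
  by rewrite addr0; apply: comb_weaken h _; rewrite lerDl.
by rewrite !addrA; apply: combS.
Qed.

Lemma comb_gen (A : comNzRingType) (nu : A -> R) (G : A -> Prop) q g :
  G g -> comb nu G (q * g) (nu q).
Proof. by move=> Gg; rewrite -[q * g]add0r -[nu q]add0r; apply: combS => //; apply: comb0. Qed.

Lemma comb_sub (A : comNzRingType) (nu : A -> R) (G G' : A -> Prop) p b :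
  (forall g, G g -> G' g) -> comb nu G p b -> comb nu G' p b.
Proof.
by move=> GG'; elim=> [c c0|{}p {}b q g Gg _ IH]; [exact: comb0|apply: combS; auto].
Qed.

Lemma ideal_lift (A : comNzRingType) (nu : A -> R) (I : A -> Prop) p b :
  is_ideal I -> comb nu I p b -> I p.
Proof.
move=> [I0 ID IM]; elim=> // {}p {}b q g Gg _ Ip.
by apply: ID => //; apply: IM.
Qed.

(* The property [gnoeth] is the Hilbert basis theorem with control of the coefficients.
   [gfilt Q] says that [Q] holds for the weighted l1-norms with large radii, the radius
   of each variable being chosen after those of the preceding ones. *)
Record noeth_ring (D : nat) : Type := NoethRing {
  gA : comNzRingType;
  gev : (nat -> R) -> {rmorphism gA -> R};
  gcst : R -> gA;
  gvar : nat -> gA;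
  gfilt : ((gA -> R) -> Prop) -> Prop;
  gfilt_mono : forall Q Q' : (gA -> R) -> Prop, (forall nu, Q nu -> Q' nu) -> gfilt Q -> gfilt Q';
  gfilt_and : forall Q Q' : (gA -> R) -> Prop, gfilt Q -> gfilt Q' ->
    gfilt (fun nu => Q nu /\ Q' nu);
  gfilt_ex : forall Q, gfilt Q -> exists nu, Q nu;
  gfilt_norm : gfilt (is_norm gev gcst);
  gev_cst : forall y c, gev y (gcst c) = c;
  gev_var : forall y i, (i < D)%N -> gev y (gvar i) = y i;
  gev_local : forall y y' a, (forall i, (i < D)%N -> y i = y' i) -> gev y a = gev y' a;
  gev_inj : forall a, (forall y, cube y -> gev y a = 0) -> a = 0;
  gnoeth : forall I : gA -> Prop, is_ideal I ->
    exists G : seq gA, (forall g, g \in G -> I g) /\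
      gfilt (fun nu => exists K, 0 <= K /\
        forall p, I p -> comb nu (fun g => g \in G) p (K * nu p)) }.

(** Without variables the ring is the field [R] with its absolute value. A nonzero ideal is
    generated by any nonzero element [g] of it, at cost [|g^-1|]. *)
Lemma noeth_ring0 : noeth_ring 0.
Proof.
refine (@NoethRing 0 R (fun _ => idfun) id (fun _ => 0) (fun Q => Q Num.norm)
   _ _ _ _ _ _ _ _ _) => //.
- by move=> Q Q' h; apply: h.
- by move=> Q h; exists Num.norm.
- split=> //=; first exact: normr0.
  + exact: normrN.
  + exact: ler_normD.
  + by move=> a b; rewrite normrM.
- by move=> a h; apply: (h (fun _ => 0)) => i; rewrite lexx ler01.
- move=> I [I0 ID IM].
  have [[g [Ig gn0]]|nog] := pselect (exists g, I g /\ g != 0).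
    exists [:: g]; split=> [h|]; first by rewrite inE => /eqP->.
    exists `|g^-1|; split=> // p Ip.
    have -> : p = (g^-1 * p) * g by rewrite mulrAC mulVf ?mul1r.
    have -> : `|g^-1| * `|g^-1 * p * g| = `|g^-1 * p|.
      by rewrite mulrAC mulVf // mul1r normrM.
    by apply: comb_gen; rewrite inE.
  exists [::]; split=> //; exists 0; split=> // p Ip.
  have -> : p = 0.
    by apply/eqP/negPn/negP => p0; apply: nog; exists p.
  by rewrite mul0r; apply: comb0.
Qed.

End Norms.

(** * Polynomials over a normed ring *)

Section PolyNorm.
Variable R : realType.
Variables (A : comNzRingType) (ev : (nat -> R) -> {rmorphism A -> R}) (cst : R -> A).

Definition pnorm (nu : A -> R) (B : R) (p : {poly A}) : R :=
  \sum_(i < size p) nu p`_i * B ^+ i.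

(** Serves twice: with [t = y D] to adjoin the variable of index [D], and later with [t] the step
    size, kept apart from the state [y]. *)
Definition evp (y : nat -> R) (t : R) : {rmorphism {poly A} -> R} :=
  (horner_eval t \o map_poly (ev y))%FUN.

Lemma evpE y t (p : {poly A}) n : (size p <= n)%N ->
  evp y t p = \sum_(i < n) ev y p`_i * t ^+ i.
Proof.
move=> sp; rewrite /evp /= /horner_eval (@horner_coef_wide _ n) ?(leq_trans (size_poly _ _)) //.
by apply: eq_bigr => i _; rewrite coef_map.
Qed.

Lemma evpC y t c : evp y t c%:P = ev y c.
Proof. by rewrite /evp /= /horner_eval map_polyC hornerC. Qed.

Lemma evpX y t : evp y t 'X = t.
Proof. by rewrite /evp /= /horner_eval map_polyX hornerX. Qed.

Variable nu : A -> R.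
Hypothesis nuP : is_norm ev cst nu.

Lemma pnormE B n (p : {poly A}) : (size p <= n)%N ->
  pnorm nu B p = \sum_(i < n) nu p`_i * B ^+ i.
Proof.
move=> sp; rewrite /pnorm (big_ord_widen n (fun i => nu p`_i * B ^+ i)) //.
rewrite big_mkcond; apply: eq_bigr => i _; case: ltnP => // sz.
by rewrite nth_default // (nrm0 nuP) mul0r.
Qed.

Lemma pnorm0 B : pnorm nu B 0 = 0.
Proof. by rewrite /pnorm size_poly0 big_ord0. Qed.

Lemma pnormN B p : pnorm nu B (- p) = pnorm nu B p.
Proof.
by rewrite /pnorm size_polyN; apply: eq_bigr => i _; rewrite coefN (nrmN nuP).
Qed.

Lemma pnorm_MXaddC B p c : pnorm nu B (p * 'X + c%:P) = pnorm nu B p * B + nu c.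
Proof.
rewrite (@pnormE B (size p).+1); last first.
  by rewrite -cons_poly_def size_cons_poly; case: ifP.
rewrite big_ord_recl /= !coefD coefMX coefC /= add0r mulr1 addrC; congr (_ + _).
rewrite /pnorm mulr_suml; apply: eq_bigr => i _.
by rewrite coefD coefMX coefC /= addr0 exprSr mulrA.
Qed.

Lemma pnormC B c : pnorm nu B c%:P = nu c.
Proof. by have := pnorm_MXaddC B 0 c; rewrite mul0r add0r pnorm0 mul0r add0r. Qed.

Lemma pnormMX B p : pnorm nu B (p * 'X) = pnorm nu B p * B.
Proof.
by have := pnorm_MXaddC B p 0; rewrite addr0 (nrm0 nuP) addr0.
Qed.

Lemma pnormMXn B p n : pnorm nu B (p * 'X^n) = pnorm nu B p * B ^+ n.
Proof.
elim: n => [|n IH]; first by rewrite !mulr1.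
by rewrite !exprSr !mulrA pnormMX IH.
Qed.

Variable B : R.
Hypothesis B0 : 0 <= B.

Lemma pnorm_ge0 p : 0 <= pnorm nu B p.
Proof.
by apply: sumr_ge0 => i _; rewrite mulr_ge0 ?exprn_ge0 // (nrm_ge0 nuP).
Qed.

Lemma pnormD p q : pnorm nu B (p + q) <= pnorm nu B p + pnorm nu B q.
Proof.
set n := maxn (size p) (size q).
rewrite (@pnormE B n) ?size_polyD // (@pnormE B n p) ?leq_maxl //.
rewrite (@pnormE B n q) ?leq_maxr // -big_split /=; apply: ler_sum => i _.
by rewrite coefD -mulrDl ler_wpM2r ?exprn_ge0 // (nrmD nuP).
Qed.

Lemma pnormCM c p : pnorm nu B (c%:P * p) <= nu c * pnorm nu B p.
Proof.
rewrite (@pnormE B (size p)); last by rewrite mul_polyC size_scale_leq.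
rewrite /pnorm mulr_sumr; apply: ler_sum => i _.
by rewrite coefCM mulrA ler_wpM2r ?exprn_ge0 // (nrmM nuP).
Qed.

Lemma pnormM p q : pnorm nu B (p * q) <= pnorm nu B p * pnorm nu B q.
Proof.
elim/poly_ind: p => [|p c IH]; first by rewrite mul0r pnorm0 mul0r.
rewrite pnorm_MXaddC mulrDl (mulrAC p) mulrDl (le_trans (pnormD _ _)) //.
apply: lerD; last exact: pnormCM.
by rewrite pnormMX mulrAC ler_wpM2r.
Qed.

Lemma pnorm_evp y t p : cube y -> `|t| <= B -> `|evp y t p| <= pnorm nu B p.
Proof.
move=> cy tB; rewrite (@evpE _ _ _ (size p)) // (le_trans (ler_norm_sum _ _ _)) //.
apply: ler_sum => i _; rewrite normrM normrX ler_pM ?exprn_ge0 //.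
  exact: (nrm_ev nuP).
by apply: lerXn2r => //; rewrite nnegrE.
Qed.

End PolyNorm.

Lemma pnorm_norm (R : realType) (A : comNzRingType) (ev : (nat -> R) -> {rmorphism A -> R})
    (cst : R -> A) (nu : A -> R) (D : nat) B : is_norm ev cst nu -> 1 <= B ->
  is_norm (fun y => evp ev y (y D)) (fun c => (cst c)%:P) (pnorm nu B).
Proof.
move=> nuP B1; have B0 : 0 <= B by rewrite (le_trans _ B1).
split.
- exact: pnorm_ge0 nuP B B0.
- exact: pnorm0.
- exact: pnormN nuP B.
- exact: pnormD nuP B B0.
- exact: pnormM nuP B B0.
- by move=> c; rewrite (pnormC nuP) (nrm_cst nuP).
- move=> y a cy; apply: (pnorm_evp nuP) => //.
  by apply: le_trans B1; have /andP[? ?] := cy D; rewrite ger0_norm.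
Qed.

(** The inverses of [1, ..., size p] are distinct roots in the interval, one more than the degree
    allows. *)
Lemma poly_eq0_interval (R : realType) (p : {poly R}) :
  (forall t, 0 <= t <= 1 -> p.[t] = 0) -> p = 0.
Proof.
move=> h; apply/eqP/negPn/negP => p0.
pose s := [seq (i.+1%:R^-1 : R) | i <- iota 0 (size p)].
have := @max_poly_roots _ p s p0.
rewrite size_map size_iota ltnn => H.
suff : false by []; apply: H.
  apply/allP => x /mapP[i _ ->]; rewrite /root h ?eqxx // invr_ge0 ler0n /=.
  by rewrite invf_le1 ?ltr0n // ler1n.
rewrite map_inj_uniq ?iota_uniq // => i j /invr_inj /eqP.
by rewrite eqr_nat eqSS => /eqP.
Qed.

Lemma seq_bounded (R : realType) (T : eqType) (f : T -> R) (s : seq T) :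
  exists S, 0 <= S /\ forall x, x \in s -> f x <= S.
Proof.
elim: s => [|x s [S [S0 hS]]]; first by exists 0.
exists (Num.max (f x) S); split; first by rewrite le_max S0 orbT.
by move=> z; rewrite inE le_max => /orP[/eqP->|/hS ->]; rewrite ?lexx ?orbT.
Qed.

Lemma chain_mono (A : Type) (L : nat -> A -> Prop) :
  (forall k c, L k c -> L k.+1 c) -> forall k k' c, (k <= k')%N -> L k c -> L k' c.
Proof.
move=> LS k k' c /subnK <-; elim: (k' - k)%N => // j IH /IH h.
by rewrite addSn; apply: LS.
Qed.

(** The union of the chain is an ideal, and its finitely many generators already lie in one [L k0].
    The form with [minn] treats the levels below and above [k0] together. *)
Lemma chain_stable (R : realType) (D : nat) (g : noeth_ring R D) (L : nat -> gA g -> Prop) :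
  (forall k, is_ideal (L k)) -> (forall k c, L k c -> L k.+1 c) ->
  exists k0, forall k c, L k c -> L (minn k k0) c.
Proof.
move=> Li LS; have Lmono := chain_mono LS.
have Ui : is_ideal (fun c => exists k, L k c).
  split; first by exists 0%N; have [] := Li 0%N.
    move=> a b [k Lk] [k' Lk']; exists (maxn k k').
    have [_ LD _] := Li (maxn k k'); apply: LD.
      by apply: Lmono Lk; apply: leq_maxl.
    by apply: Lmono Lk'; apply: leq_maxr.
  by move=> a b [k Lk]; exists k; have [_ _] := Li k; apply.
have [G [GU /(@gfilt_ex _ _ _) [nu [K [_ hK]]]]] := gnoeth Ui.
have [k0 hk0] : exists k0, forall c, c \in G -> L k0 c.
  elim: G GU {hK} => [|c G IH] GU; first by exists 0%N.
  have [|k1 h1] := IH; first by move=> d dG; apply: GU; rewrite inE dG orbT.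
  have [k Lk] := GU c (mem_head _ _).
  exists (maxn k k1) => d; rewrite inE => /orP[/eqP->|dG].
    by apply: Lmono Lk; apply: leq_maxl.
  by apply: Lmono (h1 _ dG); apply: leq_maxr.
exists k0 => k c Lk; case: (leqP k k0) => // _.
by apply: (ideal_lift (Li k0)); apply: comb_sub hk0 (hK _ _); exists k.
Qed.

(** * The Hilbert basis step: adjoining one variable *)

Section PolyStep.
Variables (R : realType) (D : nat) (g : noeth_ring R D).
Notation A := (gA g).
Notation nrm nu := (is_norm (@gev _ _ g) (@gcst _ _ g) nu).

Lemma comb_mulXn (nu : A -> R) (nuP : nrm nu) B (G : {poly A} -> Prop) p b n : 
  0 <= B -> comb (pnorm nu B) G p b -> comb (pnorm nu B) G (p * 'X^n) (b * B ^+ n).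
Proof.
move=> B0; elim=> [{}b b0|{}p {}b q h Gh _ IH].
  by rewrite mul0r; apply: comb0; rewrite mulr_ge0 ?exprn_ge0.
rewrite !mulrDl mulrAC -(pnormMXn nuP).
exact: combS.
Qed.

Section Ideal.
Variable I : {poly A} -> Prop.
Hypothesis Ii : is_ideal I.

(** The inequality on the size admits [c = 0], so that this is an ideal. *)
Definition lead_ideal k (c : A) : Prop := exists p : {poly A}, [/\ I p, (size p <= k.+1)%N & p`_k = c].

Lemma lead_ideal_ideal k : is_ideal (lead_ideal k).
Proof.
have [I0 ID IM] := Ii; split.
- by exists 0; rewrite size_poly0 coef0.
- move=> a b [p [Ip sp <-]] [q [Iq sq <-]]; exists (p + q); split; first exact: ID.
    by rewrite (leq_trans (size_polyD _ _)) // geq_max sp.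
  by rewrite coefD.
- move=> a b [p [Ip sp <-]]; exists (a%:P * p); split; first exact: IM.
    by rewrite mul_polyC (leq_trans (size_scale_leq _ _)).
  by rewrite coefCM.
Qed.

Lemma lead_idealS k c : lead_ideal k c -> lead_ideal k.+1 c.
Proof.
have [_ _ IM] := Ii; move=> [p [Ip sp <-]]; exists (p * 'X); split; first by rewrite mulrC; apply: IM.
  by rewrite (leq_trans (size_polyMleq _ _)) // size_polyX addn2 /= ltnS.
by rewrite coefMX.
Qed.

(* For large [B], subtracting [P] cancels the leading coefficient [c] and adds only a
   small multiple of its norm in lower degrees. *)
Definition divides_at (nu : A -> R) (Gp : seq {poly A}) k K S : Prop :=
  forall B c, 1 <= B -> lead_ideal k c -> exists P : {poly A},
    [/\ comb (pnorm nu B) (fun q => q \in Gp) P (K * nu c), (size P <= k.+1)%N, P`_k = c &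
        pnorm nu B (P - c *: 'X^k) * B <= S * (K * nu c) * B ^+ k].

(** A combination of leading coefficients lifts to the same combination of polynomials. The lower
    coefficients of the lifts sit in degree at most [k - 1], which pays for the extra factor [B] in
    the last clause of [divides_at]; [K] and [S] do not depend on [B]. *)
Lemma level_generators k : exists Gp : seq {poly A}, (forall P, P \in Gp -> I P) /\
  gfilt (fun nu : A -> R => exists K S, [/\ 0 <= K, 0 <= S & divides_at nu Gp k K S]).
Proof.
have [G [GL hG]] := gnoeth (lead_ideal_ideal k).
(* The lifts are fixed before any norm is given, since the generators must not depend on it. *)
have [c|ch hch] := @boolp.choice A {poly A}
    (fun c P => c \in G -> [/\ I P, (size P <= k.+1)%N & P`_k = c]).
  have [cG|] := boolP (c \in G); last by exists 0.
  by have [P hP] := GL c cG; exists P.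
exists (map ch G); split; first by move=> P /mapP[c /hch [? _ _] ->].
apply: gfilt_mono (gfilt_and (gfilt_norm g) hG) => nu [nuP [K [K0 hK]]].
have [S [S0 hS]] := seq_bounded (fun c => \sum_(i < k) nu (ch c)`_i) G.
exists K, S; split=> // B c B1 Lc; have B0 : 0 <= B by lra.
elim: (hK c Lc) => [b b0|p b q h Gh _ [P [lP sP eP nP]]].
  exists 0; rewrite size_poly0 coef0 scale0r subr0 (pnorm0 nu) mul0r; split=> //.
    exact: comb0.
  by rewrite !mulr_ge0 ?exprn_ge0.
have [Ih sh eh] := hch h Gh.
exists (P + q%:P * ch h); split.
- rewrite -(pnormC nuP B q); apply: combS => //; exact: map_f.
- rewrite (leq_trans (size_polyD _ _)) // geq_max sP mul_polyC.
  by rewrite (leq_trans (size_scale_leq _ _)).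
- by rewrite coefD coefCM eP eh.
have -> : P + q%:P * ch h - (p + q * h) *: 'X^k =
    (P - p *: 'X^k) + q%:P * (ch h - h *: 'X^k).
  by rewrite !mul_polyC scalerBr scalerA scalerDl opprD addrACA.
have hh : pnorm nu B (ch h - h *: 'X^k) * B <= S * B ^+ k.
  rewrite (@pnormE _ _ _ _ _ nuP _ k); last first.
    apply/leq_sizeP => j; rewrite leq_eqVlt coefB coefZ coefXn => /orP[/eqP<-|kj].
      by rewrite eqxx mulr1 eh subrr.
    by rewrite gtn_eqF // mulr0 subr0 nth_default // (leq_trans sh).
  rewrite mulr_suml; apply: le_trans (_ : (\sum_(i < k) nu (ch h)`_i) * B ^+ k <= _); last first.
    by rewrite ler_wpM2r ?exprn_ge0 // hS.
  rewrite mulr_suml; apply: ler_sum => i _.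
  rewrite coefB coefZ coefXn ltn_eqF // mulr0 subr0 -mulrA -exprSr.
  by rewrite ler_wpM2l ?(nrm_ge0 nuP) // ler_weXn2l.
apply: le_trans (_ : (pnorm nu B (P - p *: 'X^k) + nu q * pnorm nu B (ch h - h *: 'X^k)) * B <= _).
  rewrite ler_wpM2r //; apply: le_trans (pnormD nuP B0 _ _) _.
  by rewrite lerD2l; apply: (pnormCM nuP B0).
rewrite mulrDl mulrDr mulrDl lerD //.
by rewrite -mulrA mulrCA (mulrC S) -mulrA mulrCA ler_wpM2l ?(nrm_ge0 nuP) //.
Qed.

Lemma levels_generators n : exists Gp : seq {poly A}, (forall P, P \in Gp -> I P) /\
  gfilt (fun nu : A -> R => exists K S,
    [/\ 0 <= K, 0 <= S & forall k, (k < n)%N -> divides_at nu Gp k K S]).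
Proof.
elim: n => [|n [Gp [GI hG]]].
  exists [::]; split=> //; apply: gfilt_mono (gfilt_norm g) => nu _.
  by exists 0, 0.
have [Gp' [GI' hG']] := level_generators n.
exists (Gp ++ Gp'); split.
  by move=> P; rewrite mem_cat => /orP[]; [apply: GI|apply: GI'].
apply: gfilt_mono (gfilt_and (gfilt_norm g) (gfilt_and hG hG')).
move=> nu [nuP [[K [S [K0 S0 h]]] [K' [S' [K0' S0' h']]]]].
exists (Num.max K K'), (Num.max S S'); split; rewrite ?le_max ?K0 ?S0 //.
have mono k G1 G2 K1 S1 K2 S2 : {subset G1 <= G2} -> 0 <= K1 -> 0 <= S1 -> K1 <= K2 -> S1 <= S2 ->
    divides_at nu G1 k K1 S1 -> divides_at nu G2 k K2 S2.
  move=> GG K10 S10 KK SS hh B c B1 Lc; have B0 : 0 <= B by lra.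
  have [P [lP sP eP nP]] := hh B c B1 Lc; exists P; split=> //.
    apply: comb_sub GG _; apply: comb_weaken lP _.
    by rewrite ler_wpM2r // (nrm_ge0 nuP).
  apply: le_trans nP _; rewrite ler_wpM2r ?exprn_ge0 // ler_pM //.
    by rewrite mulr_ge0 // (nrm_ge0 nuP).
  by rewrite ler_wpM2r // (nrm_ge0 nuP).
move=> k; rewrite ltnS leq_eqVlt => /orP[/eqP->|kn].
  apply: mono h' => //; rewrite ?le_max ?lexx ?orbT //.
  by move=> P PG; rewrite mem_cat PG orbT.
apply: mono (h k kn) => //; rewrite ?le_max ?lexx ?orbT //.
by move=> P PG; rewrite mem_cat PG.
Qed.

(** Division by leading coefficients, with the norm as a budget. Subtracting [P * 'X^(n - k)]
    removes [nu c * B ^+ n] and puts back at most half of it, because [B >= 2 * (S * K)]. The cost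
    is at most [K * (nu c * B ^+ n)], that is [2 * K] times the guaranteed drop of the norm, so the
    total cost is at most [2 * K * pnorm nu B p]. Levels above [k0] reuse the divisors of level
    [k0], shifted. *)
Lemma poly_noeth : exists Gp : seq {poly A}, (forall P, P \in Gp -> I P) /\
  gfilt (fun nu : A -> R => exists beta, forall B, beta <= B -> 1 <= B ->
    exists K, 0 <= K /\ forall p, I p -> comb (pnorm nu B) (fun q => q \in Gp) p (K * pnorm nu B p)).
Proof.
have [k0 hk0] := chain_stable lead_ideal_ideal lead_idealS.
have [Gp [GI hG]] := levels_generators k0.+1.
exists Gp; split=> //.
apply: gfilt_mono (gfilt_and (gfilt_norm g) hG) => nu [nuP [K [S [K0 S0 h]]]].
exists (2 * (S * K)) => B hB B1; have B0 : 0 <= B by lra.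
exists (2 * K); split=> [|p]; first by lra.
have [n] := ubnP (size p); elim: n p => // n IH p; rewrite ltnS => sp Ip.
have [p0|pn0] := eqVneq p 0; first by rewrite p0 (pnorm0 nu) mulr0; apply: comb0.
case: n IH sp => [|n] IH sp; first by move: pn0; rewrite -size_poly_gt0; case: (size p) sp.
set c := p`_n; set k := minn n k0.
have Lc : lead_ideal k c by apply: hk0; exists p.
have kk0 : (k < k0.+1)%N by rewrite ltnS geq_minr.
have kn : (k <= n)%N by rewrite geq_minl.
have [P [lP sP eP nP]] := h k kk0 B c B1 Lc.
set p' := p - P * 'X^(n - k).
have ePn : (P * 'X^(n - k))`_n = c.
  by rewrite coefMXn ltnNge leq_subr /= subKn.
have Ip' : I p'.
  have [_ ID IM] := Ii; apply: (ID) => //; rewrite -mulN1r; apply: (IM).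
  rewrite mulrC; apply: (IM).
  by apply: (ideal_lift Ii); apply: comb_sub GI lP.
have sp' : (size p' < n.+1)%N.
  rewrite ltnS; apply/leq_sizeP => j; rewrite leq_eqVlt => /orP[/eqP<-|nj].
    by rewrite coefB ePn subrr.
  rewrite coefB nth_default ?(leq_trans sp) // coefMXn ltnNge (leq_trans (leq_subr _ _)) ?(ltnW nj) //=.
  by rewrite nth_default ?subrr // (leq_trans sP) // ltn_subRL subnK //.
have nu0 : 0 <= nu c * B ^+ n by rewrite mulr_ge0 ?exprn_ge0 // (nrm_ge0 nuP).
have np' : pnorm nu B p' <= pnorm nu B p - (nu c * B ^+ n) / 2.
  have -> : p' = (p - c *: 'X^n) - (P - c *: 'X^k) * 'X^(n - k).
    by rewrite /p' mulrBl -scalerAl -exprD subnKC // opprB addrA subrK //.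
  apply: le_trans (pnormD nuP B0 _ _) _; rewrite (pnormN nuP) (pnormMXn nuP).
  have -> : pnorm nu B (p - c *: 'X^n) = pnorm nu B p - nu c * B ^+ n.
    rewrite !(@pnormE _ _ _ _ _ nuP _ n.+1) //; last first.
      rewrite (leq_trans (size_polyD _ _)) // geq_max sp size_polyN.
      by rewrite (leq_trans (size_scale_leq _ _)) // size_polyXn.
    rewrite !big_ord_recr /= addrK coefB coefZ coefXn eqxx mulr1 subrr (nrm0 nuP) mul0r addr0.
    by apply: eq_bigr => i _; rewrite coefB coefZ coefXn ltn_eqF // mulr0 subr0.
  have : pnorm nu B (P - c *: 'X^k) * B ^+ (n - k) <= (nu c * B ^+ n) / 2.
    have Bp : 0 < B by lra.
    rewrite -(ler_pM2r Bp) mulrAC.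
    apply: le_trans (ler_wpM2r (exprn_ge0 _ B0) nP) _.
    rewrite -[X in X <= _]mulrA -exprD subnKC //.
    have -> : S * (K * nu c) * B ^+ n = (S * K) * (nu c * B ^+ n) by ring.
    have : 2 * (S * K) * (nu c * B ^+ n) <= B * (nu c * B ^+ n) by rewrite ler_wpM2r.
    lra.
  lra.
have := comb_add (IH p' sp' Ip') (comb_mulXn nuP (n - k) B0 lP).
rewrite subrK => /comb_weaken; apply.
have Kn : K * (nu c) * B ^+ (n - k) <= K * (nu c * B ^+ n).
  by rewrite -mulrA ler_wpM2l // ler_wpM2l ?(nrm_ge0 nuP) // ler_weXn2l // leq_subr.
have : 2 * K * pnorm nu B p' <= 2 * K * (pnorm nu B p - (nu c * B ^+ n) / 2).
  by rewrite ler_wpM2l //; lra.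
lra.
Qed.

End Ideal.

Lemma noeth_ringS : noeth_ring R D.+1.
Proof.
refine (@NoethRing R D.+1 (poly_polynomial__canonical__GRing_ComNzRing A) (fun y => evp (@gev _ _ g) y (y D))
  (fun c => (gcst g c)%:P) (fun i => if i == D then 'X else (gvar g i)%:P)
  (fun Q => gfilt (fun nu : A -> R => exists beta, forall B, beta <= B -> 1 <= B -> Q (pnorm nu B)))
  _ _ _ _ _ _ _ _ _).
- move=> Q Q' QQ'; apply: gfilt_mono => nu [beta h]; exists beta => B hB B1.
  by apply: QQ'; apply: h.
- move=> Q Q' h h'; apply: gfilt_mono (gfilt_and h h') => nu [[b hb] [b' hb']].
  exists (Num.max b b') => B; rewrite ge_max => /andP[? ?] B1.
  by split; [apply: hb|apply: hb'].
- move=> Q /(@gfilt_ex _ _ _) [nu [beta h]]; exists (pnorm nu (Num.max beta 1)).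
  by apply: h; rewrite le_max lexx ?orbT.
- apply: gfilt_mono (gfilt_norm g) => nu nuP; exists 0 => B _ B1.
  exact: pnorm_norm.
- by move=> y c; apply: etrans (evpC (@gev _ _ g) _ _ _) _; exact: gev_cst.
- move=> y i; rewrite ltnS leq_eqVlt; case: eqP => [-> _|_ /= iD]; first exact: evpX (@gev _ _ g) _ _.
  by apply: etrans (evpC (@gev _ _ g) _ _ _) _; exact: gev_var.
- move=> y y' a yy'; apply: etrans (@evpE _ _ (@gev _ _ g) _ _ a _ (leqnn _)) _.
  apply: etrans _ (esym (@evpE _ _ (@gev _ _ g) _ _ a _ (leqnn _))); apply: eq_bigr => i _.
  rewrite (yy' D) //; congr (_ * _); apply: gev_local => j jD; apply: yy'.
  by rewrite ltnS ltnW.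
- move=> a ha; apply/polyP => i; rewrite coef0; apply: gev_inj => y cy.
  have : map_poly (gev g y) a = 0.
    apply: poly_eq0_interval => t t01.
    (* By [gev_local] the coefficients ignore coordinate [D], which can therefore run through the
       whole interval. *)
    pose y' j := if j == D then t else y j.
    have cy' : cube y' by move=> j; rewrite /y'; case: ifP.
    rewrite -(ha y' cy') /evp /= /horner_eval /y' eqxx; congr (_.[_]).
    apply: eq_map_poly => b; apply: gev_local => j jD.
    by rewrite ltn_eqF.
  by move/polyP/(_ i); rewrite coef_map coef0.
- by move=> I Ii; exact: poly_noeth.
Qed.

End PolyStep.

Lemma noeth_ring_ex (R : realType) D : noeth_ring R D.
Proof. by elim: D => [|D g]; [exact: noeth_ring0|exact: noeth_ringS]. Qed.

(** * Real-variable preliminaries *)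

Section Small.
Variable R : realType.
Implicit Types (x r : R).

Lemma le0_of_linear x (K : R) r : 0 < r ->
  (forall t, 0 < t <= r -> x <= t * K) -> x <= 0.
Proof.
move=> r0 h; rewrite leNgt; apply/negP => x0.
have K0 : 0 < K.
  have := h r; rewrite r0 lexx => /(_ isT) xr.
  by rewrite -(pmulr_rgt0 _ r0) (lt_le_trans x0).
pose t := Num.min r (x / (2 * K)).
have t0 : 0 < t by rewrite lt_min r0 divr_gt0 // mulr_gt0.
have tr : t <= r by rewrite /t ge_min lexx.
have := h t; rewrite t0 tr => /(_ isT) xt.
have : t * K <= x / 2.
  have -> : x / 2 = x / (2 * K) * K by field; rewrite gt_eqF.
  by rewrite ler_wpM2r ?(ltW K0) // /t ge_min lexx orbT.
lra.
Qed.

Lemma le_of_geometric x (a C : R) : (forall M, x <= a + C * (2^-1) ^+ M) -> x <= a.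
Proof.
move=> h; rewrite leNgt; apply/negP => ax.
have C0 : 0 < C by have := h 0%N; rewrite expr0; lra.
have e0 : 0 < x - a by rewrite subr_gt0.
have q0 : 0 <= C / (x - a) by rewrite divr_ge0 // ltW.
have := archi_boundP q0; set M := Num.bound _ => hM.
have := h M; rewrite leNgt => /negP; apply.
rewrite -ltrBrDl exprVn ltr_pdivrMr ?exprn_gt0 // mulrC -ltr_pdivrMr //.
apply: lt_le_trans hM _; rewrite -natrX ler_nat ltnW //.
exact: ltn_expl.
Qed.

(** The constant coefficient vanishes on letting [t] tend to 0; dividing by [t] then lowers [M]. *)
Lemma poly_coef_vanish (Q : {poly R}) M (C : R) r : 0 < r ->
  (forall t, 0 < t <= r -> `|Q.[t]| <= C * t ^+ M) ->
  forall i, (i < M)%N -> Q`_i = 0.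
Proof.
move=> r0; elim: M Q => // M IH Q.
elim/poly_ind: Q => [|Q c _] h i; first by rewrite coef0.
have hB t : 0 < t <= r -> `|Q.[t]| <= \sum_(j < size Q) `|Q`_j| * r ^+ j.
  move=> /andP[t0 tr]; rewrite horner_coef (le_trans (ler_norm_sum _ _ _)) //.
  apply: ler_sum => j _; rewrite normrM normrX ler_wpM2l // lerXn2r ?nnegrE //.
    by rewrite ltW.
  by rewrite gtr0_norm.
set B := \sum_(j < _) _ in hB.
have c0 : c = 0.
  apply/normr0_eq0/eqP; rewrite eq_le normr_ge0 andbT.
  apply: (@le0_of_linear _ (`|C| * r ^+ M + B) r) => // t /andP[t0 tr].
  have ht : 0 < t <= r by rewrite t0.
  have := h t ht; rewrite hornerMXaddC => h1.
  have -> : c = (Q.[t] * t + c) - Q.[t] * t by rewrite addrC addKr.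
  rewrite (le_trans (ler_normB _ _)) // mulrDr lerD //.
    rewrite (le_trans h1) // exprS mulrCA ler_wpM2l ?(ltW t0) //.
    apply: le_trans (_ : `|C| * t ^+ M <= _).
      by rewrite ler_wpM2r ?exprn_ge0 ?(ltW t0) ?ler_norm.
    by rewrite ler_wpM2l // lerXn2r ?nnegrE ?(ltW t0) ?(ltW r0).
  by rewrite normrM mulrC gtr0_norm // ler_wpM2l ?(ltW t0) // hB // t0.
rewrite c0 addr0 in h *; rewrite coefMX; case: i => // i; rewrite ltnS.
apply: IH => t ht; have t0 : 0 < t by case/andP: ht.
have := h t ht; rewrite hornerMX normrM (gtr0_norm t0) exprSr mulrA.
by rewrite ler_pM2r.
Qed.

End Small.

(** * Functions analytic in the step size *)

Section BigO.
Variable R : realType.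

Lemma min_lel (a b : R) : Num.min a b <= a.
Proof. by rewrite ge_min lexx. Qed.

Lemma min_ler (a b : R) : Num.min a b <= b.
Proof. by rewrite ge_min lexx orbT. Qed.

Notation fn := ((nat -> R) -> R -> R).

(** The bound is uniform over the cube, and [t = 0] is excluded so that quotients by powers of [t]
    can be handled as functions of the same kind. *)
Definition bigO (m : nat) (F : fn) : Prop := exists C r, [/\ 0 <= C, 0 < r &
  forall y t, cube y -> 0 < t <= r -> `|F y t| <= C * t ^+ m].

Lemma bigO_ext m (F G : fn) : (forall y t, F y t = G y t) -> bigO m F -> bigO m G.
Proof. by move=> FG [C [r [C0 r0 h]]]; exists C, r; split=> // y t; rewrite -FG; apply: h. Qed.

Lemma bigOD m (F G : fn) : bigO m F -> bigO m G -> bigO m (fun y t => F y t + G y t).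
Proof.
move=> [C [r [C0 r0 h]]] [C' [r' [C'0 r'0 h']]]; exists (C + C'), (Num.min r r').
split; [exact: addr_ge0|by rewrite lt_min r0|].
move=> y t cy /andP[t0]; rewrite le_min => /andP[tr tr'].
by rewrite (le_trans (ler_normD _ _)) // mulrDl lerD // ?h ?h' // t0.
Qed.

Lemma bigON m (F : fn) : bigO m F -> bigO m (fun y t => - F y t).
Proof. by move=> [C [r [C0 r0 h]]]; exists C, r; split=> // y t; rewrite normrN; apply: h. Qed.

Lemma bigOM m m' (F G : fn) : bigO m F -> bigO m' G ->
  bigO (m + m') (fun y t => F y t * G y t).
Proof.
move=> [C [r [C0 r0 h]]] [C' [r' [C'0 r'0 h']]]; exists (C * C'), (Num.min r r').
split; [exact: mulr_ge0|by rewrite lt_min r0|].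
move=> y t cy /andP[t0]; rewrite le_min => /andP[tr tr'].
by rewrite normrM exprD mulrACA ler_pM // ?h ?h' // t0.
Qed.

Lemma bigO_le m m' (F : fn) : (m <= m')%N -> bigO m' F -> bigO m F.
Proof.
move=> mm [C [r [C0 r0 h]]]; exists C, (Num.min r 1); split; rewrite ?lt_min ?r0 ?ltr01 //.
move=> y t cy /andP[t0]; rewrite le_min => /andP[tr t1].
have ht : 0 < t <= r by rewrite t0.
apply: le_trans (h y t cy ht) _; rewrite ler_wpM2l //.
by rewrite ler_wiXn2l // ltW.
Qed.

Lemma bigO_div m (F : fn) : bigO m.+1 F -> bigO m (fun y t => F y t / t).
Proof.
move=> [C [r [C0 r0 h]]]; exists C, r; split=> // y t cy ht; have t0 : 0 < t by case/andP: ht.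
rewrite normrM normfV (gtr0_norm t0) ler_pdivrMr // -mulrA -exprSr.
exact: h.
Qed.

Lemma bigO_const m (c : R) : c = 0 \/ m = 0%N -> bigO m (fun _ _ => c).
Proof.
move=> h; exists `|c|, 1; split=> // y t _ _; case: h => ->; rewrite ?normr0 ?mul0r //.
by rewrite mulr1.
Qed.

Lemma bigO_param : bigO 1 (fun _ t => t).
Proof. by exists 1, 1; split=> // y t _ /andP[t0 _]; rewrite mul1r gtr0_norm. Qed.

End BigO.

Section Analytic.
Variables (R : realType) (D : nat) (g : noeth_ring R D).
Notation A := (gA g).
Notation fn := ((nat -> R) -> R -> R).
Notation ept y t := (evp (@gev _ _ g) y t).
Notation nrm nu := (is_norm (@gev _ _ g) (@gcst _ _ g) nu).

(** A convergent power series in [t], given by polynomial approximants with norms bounded at radius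
    [r] and an error geometric in [t / r]. In this form products and compositions need no Cauchy
    products. *)
Definition approx (nu : A -> R) (r C : R) (F : fn) (q : nat -> {poly A}) : Prop :=
  [/\ 0 < r, 0 <= C & forall M, pnorm nu r (q M) <= C /\
    forall y t, cube y -> 0 < t <= r -> `|F y t - ept y t (q M)| <= C * (t / r) ^+ M].

(* The approximants at different orders are not required to be truncations of one
   another, and they may not depend on the norm; only [r] and [C] may. *)
Definition analytic (F : fn) : Prop := exists q : nat -> {poly A},
  gfilt (fun nu : A -> R => exists r C, approx nu r C F q).

Lemma pnorm_le (nu : A -> R) (nuP : nrm nu) r r' p : 0 <= r' -> r' <= r -> pnorm nu r' p <= pnorm nu r p.
Proof.
move=> r0 rr; apply: ler_sum => i _; rewrite ler_wpM2l ?(nrm_ge0 nuP) //.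
by rewrite lerXn2r ?nnegrE // (le_trans r0).
Qed.

Lemma approx_le nu (nuP : nrm nu) r C F q r' C' :
  approx nu r C F q -> 0 < r' -> r' <= r -> C <= C' -> approx nu r' C' F q.
Proof.
move=> [r0 C0 h] r'0 rr CC; split=> //; first exact: le_trans CC.
move=> M; have [h1 h2] := h M; split.
  by apply: le_trans (pnorm_le nuP _ (ltW r'0) rr) _; apply: le_trans CC.
move=> y t cy /andP[t0 tr]; apply: le_trans (h2 y t cy _) _.
  by rewrite t0 (le_trans tr).
apply: ler_pM => //; first by rewrite exprn_ge0 // divr_ge0 // ltW.
rewrite lerXn2r ?nnegrE ?divr_ge0 ?(ltW t0) ?(ltW r0) ?(ltW r'0) //.
by rewrite ler_pM2l // lef_pV2 ?posrE.
Qed.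

Lemma approx_bound nu (nuP : nrm nu) r C F q : approx nu r C F q ->
  forall M y t, cube y -> 0 < t <= r -> `|F y t| <= 2 * C /\ `|ept y t (q M)| <= C.
Proof.
move=> [r0 C0 h] M y t cy /andP[t0 tr].
have hq N : `|ept y t (q N)| <= C.
  have [h1 _] := h N; apply: le_trans h1; apply: (pnorm_evp nuP (ltW r0)) => //.
  by rewrite gtr0_norm.
split=> //; have [_ /(_ y t cy)] := h 0%N; rewrite t0 tr expr0 mulr1 => /(_ isT) h2.
have -> : F y t = (F y t - ept y t (q 0%N)) + ept y t (q 0%N) by rewrite subrK.
by rewrite (le_trans (ler_normD _ _)) //; have := hq 0%N; lra.
Qed.

Lemma analytic_bigO0 F : analytic F -> bigO 0 F.
Proof.
move=> [q hq]; have [nu [nuP [r [C hC]]]] := gfilt_ex (gfilt_and (gfilt_norm g) hq).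
have [r0 C0 _] := hC.
exists (2 * C), r; split=> //; first by rewrite mulr_ge0.
by move=> y t cy ht; rewrite expr0 mulr1; have [] := approx_bound nuP hC 0 cy ht.
Qed.

Lemma analytic_ext (F G : fn) : (exists2 r, 0 < r &
    forall y t, cube y -> 0 < t <= r -> F y t = G y t) -> analytic F -> analytic G.
Proof.
move=> [r0 r00 FG] [q hq]; exists q.
apply: gfilt_mono (gfilt_and (gfilt_norm g) hq) => nu [nuP [r [C hC]]].
have [rp Cp _] := hC.
exists (Num.min r r0), C; have hr : 0 < Num.min r r0 by rewrite lt_min rp.
have [_ _ h] := approx_le nuP hC hr (min_lel _ _) (lexx _).
split=> // M; have [h1 h2] := h M; split=> // y t cy ht; rewrite -FG ?h2 //.
by case/andP: ht => -> /=; rewrite le_min => /andP[].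
Qed.

Lemma analytic_exact (F : fn) (q : {poly A}) :
  (forall y t, F y t = ept y t q) -> analytic F.
Proof.
move=> h; exists (fun _ => q); apply: gfilt_mono (gfilt_norm g) => nu nuP.
have C0 : 0 <= pnorm nu 1 q by apply: (pnorm_ge0 nuP).
exists 1, (pnorm nu 1 q); split=> // M; split=> // y t cy /andP[t0 _].
by rewrite h subrr normr0 mulr_ge0 // exprn_ge0 // divr_ge0 // ltW.
Qed.

Lemma analytic_const (c : R) : analytic (fun _ _ => c).
Proof.
by apply: (analytic_exact (q := (gcst g c)%:P)) => y t; rewrite evpC gev_cst.
Qed.

Lemma analytic_var i : (i < D)%N -> analytic (fun y _ => y i).
Proof.
by move=> iD; apply: (analytic_exact (q := (gvar g i)%:P)) => y t; rewrite evpC gev_var.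
Qed.

Lemma analytic_param : analytic (fun _ t => t).
Proof. by apply: (analytic_exact (q := 'X)) => y t; rewrite evpX. Qed.

Lemma analyticD F G : analytic F -> analytic G -> analytic (fun y t => F y t + G y t).
Proof.
move=> [q hq] [q' hq']; exists (fun M => q M + q' M).
apply: gfilt_mono (gfilt_and (gfilt_norm g) (gfilt_and hq hq')).
move=> nu [nuP [[r [C h]] [r' [C' h']]]]; have [r0 C0 _] := h; have [r'0 C'0 _] := h'.
have hr : 0 < Num.min r r' by rewrite lt_min r0.
have [_ _ {}h] := approx_le nuP h hr (min_lel _ _) (lexx _).
have [_ _ {}h'] := approx_le nuP h' hr (min_ler _ _) (lexx _).
exists (Num.min r r'), (C + C'); split=> //; first exact: addr_ge0.
move=> M; have [h1 h2] := h M; have [h1' h2'] := h' M; split.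
  by apply: le_trans (pnormD nuP (ltW hr) _ _) _; apply: lerD.
move=> y t cy ht; rewrite rmorphD /= opprD addrACA mulrDl.
by apply: le_trans (ler_normD _ _) _; apply: lerD; [apply: h2|apply: h2'].
Qed.

Lemma analyticM F G : analytic F -> analytic G -> analytic (fun y t => F y t * G y t).
Proof.
move=> [q hq] [q' hq']; exists (fun M => q M * q' M).
apply: gfilt_mono (gfilt_and (gfilt_norm g) (gfilt_and hq hq')).
move=> nu [nuP [[r [C h]] [r' [C' h']]]]; have [r0 C0 _] := h; have [r'0 C'0 _] := h'.
have hr : 0 < Num.min r r' by rewrite lt_min r0.
have {}h := approx_le nuP h hr (min_lel _ _) (lexx _).
have {}h' := approx_le nuP h' hr (min_ler _ _) (lexx _).
have CC : 0 <= C * C' by rewrite mulr_ge0.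
(* The factor 3 is 2 + 1: functions are bounded by twice their constant, approximants by the
   constant itself. *)
exists (Num.min r r'), (3 * (C * C')); split=> //; first by rewrite mulr_ge0.
have [_ _ k] := h; have [_ _ k'] := h'.
move=> M; have [h1 h2] := k M; have [h1' h2'] := k' M; split.
  apply: le_trans (pnormM nuP (ltW hr) _ _) _.
  apply: le_trans (_ : C * C' <= _); last by lra.
  by apply: ler_pM => //; apply: (pnorm_ge0 nuP (ltW hr)).
move=> y t cy ht; rewrite rmorphM /=.
have [bF bq] := approx_bound nuP h M cy ht; have [bG bq'] := approx_bound nuP h' M cy ht.
set f := F y t; set f' := G y t; set e := ept y t (q M); set e' := ept y t (q' M).
have -> : f * f' - e * e' = (f - e) * f' + e * (f' - e') by ring.
apply: le_trans (ler_normD _ _) _; rewrite !normrM.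
set T := (t / _) ^+ M.
have -> : 3 * (C * C') * T = (C * T) * (2 * C') + C * (C' * T) by ring.
apply: lerD; apply: ler_pM => //; [exact: h2|exact: h2'].
Qed.

Lemma analyticN F : analytic F -> analytic (fun y t => - F y t).
Proof.
move=> hF; have := analyticM (analytic_const (-1)) hF.
by apply: analytic_ext; exists 1 => // y t _ _; rewrite mulN1r.
Qed.

Lemma analyticB F G : analytic F -> analytic G -> analytic (fun y t => F y t - G y t).
Proof. by move=> hF hG; apply: analyticD => //; apply: analyticN. Qed.

Lemma analytic_sum (I : Type) (s : seq I) (P : pred I) (F : I -> fn) :
  (forall i, P i -> analytic (F i)) -> analytic (fun y t => \sum_(i <- s | P i) F i y t).
Proof.
move=> h; elim: s => [|i s IH].
  by apply: analytic_ext (analytic_const 0); exists 1 => // y t _ _; rewrite big_nil.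
case Pi: (P i); last by apply: analytic_ext IH; exists 1 => // y t _ _; rewrite big_cons Pi.
apply: analytic_ext (analyticD (h i Pi) IH).
by exists 1 => // y t _ _; rewrite big_cons Pi.
Qed.

Lemma analytic_prod (I : Type) (s : seq I) (P : pred I) (F : I -> fn) :
  (forall i, P i -> analytic (F i)) -> analytic (fun y t => \prod_(i <- s | P i) F i y t).
Proof.
move=> h; elim: s => [|i s IH].
  by apply: analytic_ext (analytic_const 1); exists 1 => // y t _ _; rewrite big_nil.
case Pi: (P i); last by apply: analytic_ext IH; exists 1 => // y t _ _; rewrite big_cons Pi.
apply: analytic_ext (analyticM (h i Pi) IH).
by exists 1 => // y t _ _; rewrite big_cons Pi.
Qed.

Lemma coef_vanish M (q : {poly A}) : bigO M (fun y t => ept y t q) ->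
  forall i, (i < M)%N -> q`_i = 0.
Proof.
move=> [C [r [C0 r0 h]]] i iM; apply: gev_inj => y cy.
rewrite -coef_map; apply: (@poly_coef_vanish R _ M C r) => // t ht.
exact: h.
Qed.

Lemma approx_bigO F q M : gfilt (fun nu : A -> R => exists r C, approx nu r C F q) ->
  bigO M (fun y t => F y t - ept y t (q M)).
Proof.
move=> hq; have [nu [r [C [r0 C0 h]]]] := gfilt_ex hq.
exists (C / r ^+ M), r; split=> //; first by rewrite divr_ge0 // exprn_ge0 // ltW.
move=> y t cy ht; have [_ /(_ y t cy ht)] := h M.
by rewrite expr_div_n mulrCA mulrC -mulrA (mulrC _^-1).
Qed.

Lemma approx_coef_vanish F q m M : gfilt (fun nu : A -> R => exists r C, approx nu r C F q) ->
  bigO m F -> forall i, (i < minn m M)%N -> (q M)`_i = 0.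
Proof.
move=> hq Fm; apply: coef_vanish.
apply: (@bigO_ext _ _ (fun y t => F y t + - (F y t - ept y t (q M)))).
  by move=> y t; rewrite opprB addrC subrK.
apply: bigOD; first by apply: bigO_le Fm; apply: geq_minl.
by apply: bigON; apply: bigO_le (approx_bigO M hq); apply: geq_minr.
Qed.

(** That [F] is [O(t)] forces the constant coefficient of each [q M.+1] to vanish, so ['X] divides
    it. Passing to [M.+1] makes up for the order lost, and the constant becomes [C / r] at the same
    radius. *)
Lemma analytic_div F : analytic F -> bigO 1 F -> analytic (fun y t => F y t / t).
Proof.
move=> [q hq] F1; pose q' M := \poly_(i < size (q M.+1)) (q M.+1)`_i.+1.
have hq' M : q M.+1 = q' M * 'X.
  apply/polyP => i; rewrite coefMX; case: i => [|i] /=.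
    by apply: (@approx_coef_vanish F q 1 M.+1) => //; rewrite leq_min.
  rewrite coef_poly; case: ltnP => // h.
  by rewrite nth_default // (leq_trans h).
exists q'; apply: gfilt_mono (gfilt_and (gfilt_norm g) hq) => nu [nuP [r [C [r0 C0 h]]]].
exists r, (C / r); split=> //; first by rewrite divr_ge0 // ltW.
move=> M; have [h1 h2] := h M.+1; split.
  by rewrite ler_pdivlMr // -(pnormMX nuP) -hq'.
move=> y t cy ht; have t0 : 0 < t by case/andP: ht.
have := h2 y t cy ht; rewrite hq' [evp _ _ _ _]rmorphM [evp _ _ _ 'X]evpX => h3.
have -> : F y t / t - ept y t (q' M) = (F y t - ept y t (q' M) * t) / t.
  by rewrite mulrBl mulfK ?gt_eqF.
rewrite normrM normfV (gtr0_norm t0) ler_pdivrMr //.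
apply: le_trans h3 _; rewrite exprSr.
by rewrite le_eqVlt; apply/orP; left; apply/eqP; ring.
Qed.

Lemma analytic_divn k F : analytic F -> bigO k F -> analytic (fun y t => F y t / t ^+ k).
Proof.
elim: k F => [|k IH] F aF Fk.
  by apply: analytic_ext aF; exists 1 => // y t _ _; rewrite expr0 divr1.
have := IH (fun y t => F y t / t) (analytic_div aF (bigO_le (ltn0Sn k) Fk)) (bigO_div Fk).
apply: analytic_ext; exists 1 => // y t _ _.
by rewrite exprS invfM mulrA.
Qed.

End Analytic.

(** * Power series expansions *)

Section Series.
Variables (R : realType) (D : nat) (g : noeth_ring R D).
Notation A := (gA g).
Notation fn := ((nat -> R) -> R -> R).
Notation ept y t := (evp (@gev _ _ g) y t).
Notation nrm nu := (is_norm (@gev _ _ g) (@gcst _ _ g) nu).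

(** In contrast to [approx], one fixed sequence of coefficients serves all orders, so that leading
    coefficients make sense. *)
Definition expands (nu : A -> R) (r C : R) (F : fn) (p : nat -> A) : Prop :=
  [/\ 0 < r, 0 <= C & forall M, \sum_(i < M) nu (p i) * r ^+ i <= C /\
    forall y t, cube y -> 0 < t <= r ->
      `|F y t - \sum_(i < M) gev g y (p i) * t ^+ i| <= C * (t / r) ^+ M].

Definition has_series (F : fn) (p : nat -> A) : Prop :=
  gfilt (fun nu : A -> R => exists r C, expands nu r C F p).

Definition series_shift (p : nat -> A) (i : nat) : A := if i is i'.+1 then p i' else 0.

Lemma expands_le nu (nuP : nrm nu) r C F p r' :
  expands nu r C F p -> 0 < r' -> r' <= r -> expands nu r' C F p.
Proof.
move=> [r0 C0 h] r'0 rr; split=> // M; have [h1 h2] := h M; split.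
  apply: le_trans h1; apply: ler_sum => i _; rewrite ler_wpM2l ?(nrm_ge0 nuP) //.
  by rewrite lerXn2r ?nnegrE ?(ltW r0) ?(ltW r'0).
move=> y t cy /andP[t0 tr]; apply: le_trans (h2 y t cy _) _.
  by rewrite t0 (le_trans tr).
rewrite ler_wpM2l // lerXn2r ?nnegrE ?divr_ge0 ?(ltW t0) ?(ltW r0) ?(ltW r'0) //.
by rewrite ler_pM2l // lef_pV2 ?posrE.
Qed.

Lemma expands0 nu (nuP : nrm nu) r : 0 < r -> expands nu r 0 (fun _ _ => 0) (fun _ => 0).
Proof.
move=> r0; split=> // M; split.
  by rewrite big1 // => i _; rewrite (nrm0 nuP) mul0r.
move=> y t _ _; rewrite mul0r big1 ?subrr ?normr0 // => i _.
by rewrite rmorph0 mul0r.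
Qed.

Lemma expandsD nu (nuP : nrm nu) r C F p C' F' p' :
  expands nu r C F p -> expands nu r C' F' p' ->
  expands nu r (C + C') (fun y t => F y t + F' y t) (fun i => p i + p' i).
Proof.
move=> [r0 C0 h] [_ C'0 h']; split=> //; first exact: addr_ge0.
move=> M; have [h1 h2] := h M; have [h1' h2'] := h' M; split.
  apply: le_trans (lerD h1 h1'); rewrite -big_split /=; apply: ler_sum => i _.
  by rewrite -mulrDl ler_wpM2r ?exprn_ge0 ?(ltW r0) // (nrmD nuP).
move=> y t cy ht.
under eq_bigr => i _ do rewrite rmorphD mulrDl.
rewrite big_split /= opprD addrACA mulrDl.
by apply: le_trans (ler_normD _ _) _; apply: lerD; [apply: h2|apply: h2'].
Qed.

Lemma expandsZ nu (nuP : nrm nu) r C F p a : expands nu r C F p ->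
  expands nu r (nu a * C) (fun y t => gev g y a * F y t) (fun i => a * p i).
Proof.
move=> [r0 C0 h]; have a0 := nrm_ge0 nuP a; split=> //; first exact: mulr_ge0.
move=> M; have [h1 h2] := h M; split.
  apply: le_trans (ler_wpM2l a0 h1); rewrite mulr_sumr; apply: ler_sum => i _.
  by rewrite mulrA ler_wpM2r ?exprn_ge0 ?(ltW r0) // (nrmM nuP).
move=> y t cy ht.
under eq_bigr => i _ do rewrite rmorphM -mulrA.
rewrite -mulr_sumr -mulrBr normrM -mulrA ler_pM //; first exact: (nrm_ev nuP).
exact: h2.
Qed.

Lemma expands_shift nu (nuP : nrm nu) r C F p : expands nu r C F p ->
  expands nu r (r * C) (fun y t => t * F y t) (series_shift p).
Proof.
move=> [r0 C0 h]; split=> //; first by rewrite mulr_ge0 // ltW.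
case=> [|M].
  rewrite big_ord0; split=> [|y t cy ht]; first by rewrite mulr_ge0 // ltW.
  have [_ /(_ y t cy ht)] := h 0%N; rewrite !big_ord0 !subr0 !expr0 !mulr1 => h2.
  have /andP[t0 tr] := ht.
  by rewrite normrM ler_pM // gtr0_norm.
have [h1 h2] := h M; split.
  rewrite big_ord_recl /= (nrm0 nuP) mul0r add0r.
  under eq_bigr => i _ do rewrite exprS mulrCA.
  by rewrite -mulr_sumr ler_wpM2l // ltW.
move=> y t cy ht; rewrite big_ord_recl /= rmorph0 mul0r add0r.
under eq_bigr => i _ do rewrite exprS mulrCA.
have /andP[t0 tr] := ht.
rewrite -mulr_sumr -mulrBr normrM gtr0_norm //.
have -> : r * C * (t / r) ^+ M.+1 = t * (C * (t / r) ^+ M).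
  by rewrite exprS; field; rewrite gt_eqF.
by rewrite ler_wpM2l ?(ltW t0) // h2.
Qed.

(** Half the radius gains a factor [2^-1] per order. Only the bound [B] on the norm sums enters: the
    error constant [C] disappears as the truncation order grows. This matters because elimination
    keeps the norm sums bounded but not the error constants. *)
Lemma expands_tail nu (nuP : nrm nu) r C F p m : expands nu r C F p ->
  (forall i, (i < m)%N -> p i = 0) ->
  forall B, (forall M, \sum_(i < M) nu (p i) * r ^+ i <= B) ->
  forall y t, cube y -> 0 < t -> t <= r / 2 -> `|F y t| <= (2^-1) ^+ m * B.
Proof.
move=> [r0 C0 h] pm B hB y t cy t0 tr2.
have tr : 0 < t <= r by rewrite t0; lra.
have tr' : 0 <= t / r <= 2^-1.
  by rewrite divr_ge0 ?(ltW t0) ?(ltW r0) //= ler_pdivrMr // mulrC.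
have trX n : (t / r) ^+ n <= (2^-1) ^+ n.
  by case/andP: tr' => ? ?; rewrite lerXn2r ?nnegrE // invr_ge0.
have hM M : `|F y t| <= (2^-1) ^+ m * B + C * (2^-1) ^+ M.
  have [_ /(_ y t cy tr) h2] := h M.
  have hs : `|\sum_(i < M) gev g y (p i) * t ^+ i| <= (2^-1) ^+ m * B.
    apply: le_trans (ler_norm_sum _ _ _) _.
    apply: le_trans (ler_wpM2l _ (hB M)); last by rewrite exprn_ge0 // invr_ge0.
    rewrite mulr_sumr; apply: ler_sum => i _.
    case: (ltnP i m) => im; first by rewrite pm // rmorph0 mul0r normr0 (nrm0 nuP) mul0r mulr0.
    rewrite normrM normrX (gtr0_norm t0) mulrCA ler_pM ?exprn_ge0 ?(ltW t0) //.
      exact: (nrm_ev nuP).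
    have -> : t ^+ i = (t / r) ^+ i * r ^+ i by rewrite -exprMn divfK // gt_eqF.
    rewrite ler_wpM2r ?exprn_ge0 ?(ltW r0) // (le_trans (trX i)) //.
    rewrite ler_wiXn2l ?invr_ge0 // invf_le1 ?ler1n //.
  have -> : F y t = \sum_(i < M) gev g y (p i) * t ^+ i + (F y t - \sum_(i < M) gev g y (p i) * t ^+ i).
    by rewrite addrC subrK.
  apply: le_trans (ler_normD _ _) _; apply: lerD => //.
  by apply: le_trans h2 _; rewrite ler_wpM2l.
exact: le_of_geometric hM.
Qed.

(** Two approximants of order above [i] differ by [O(t ^ i.+1)], hence share their coefficient of
    index [i]. The terms of [q M] of degree [M] and more add at most [C * (t / r) ^+ M], whence the
    constant [2 * C]. *)
Lemma analytic_has_series F : analytic g F -> exists p, has_series F p.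
Proof.
move=> [q hq]; exists (fun i => (q i.+1)`_i).
have E M i : (i < M)%N -> (q M)`_i = (q i.+1)`_i.
  move=> iM; apply/eqP; rewrite -subr_eq0 -coefB; apply/eqP.
  apply: (@coef_vanish _ _ _ i.+1) => //.
  apply: (@bigO_ext _ _ (fun y t => (F y t - ept y t (q i.+1)) + - (F y t - ept y t (q M)))).
    by move=> y t; rewrite rmorphB /=; ring.
  apply: bigOD; first exact: approx_bigO.
  by apply: bigON; apply: bigO_le (approx_bigO M hq).
apply: gfilt_mono (gfilt_and (gfilt_norm g) hq) => nu [nuP [r [C [r0 C0 h]]]].
exists r, (2 * C); split=> //; first by rewrite mulr_ge0.
move=> M; have [h1 h2] := h M.
pose s := maxn M (size (q M)).
have hs : pnorm nu r (q M) = \sum_(i < s) nu (q M)`_i * r ^+ i.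
  by apply: (pnormE nuP); rewrite leq_maxr.
have split_s (f : nat -> R) : \sum_(i < s) f i = \sum_(i < M) f i + \sum_(i < s | (M <= i)%N) f i.
  rewrite (bigID (fun i : 'I_s => (i < M)%N)) /=; congr (_ + _).
    by rewrite (big_ord_widen s f (leq_maxl _ _)).
  by apply: eq_bigl => i; rewrite -leqNgt.
have E' : \sum_(i < M) nu (q i.+1)`_i * r ^+ i = \sum_(i < M) nu (q M)`_i * r ^+ i.
  by apply: eq_bigr => i _; rewrite (E M).
have tail0 (x : R) : 0 <= x -> 0 <= \sum_(i < s | (M <= i)%N) nu (q M)`_i * x ^+ i.
  by move=> x0; apply: sumr_ge0 => i _; rewrite mulr_ge0 ?exprn_ge0 // (nrm_ge0 nuP).
have h3 : \sum_(i < M) nu (q M)`_i * r ^+ i + \sum_(i < s | (M <= i)%N) nu (q M)`_i * r ^+ i <= C.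
  by rewrite -(split_s (fun i => nu (q M)`_i * r ^+ i)) -hs.
split.
  by rewrite E'; have := tail0 r (ltW r0); lra.
move=> y t cy ht; have /andP[t0 tr] := ht.
have -> : \sum_(i < M) gev g y (q i.+1)`_i * t ^+ i =
    ept y t (q M) - \sum_(i < s | (M <= i)%N) gev g y (q M)`_i * t ^+ i.
  rewrite (@evpE _ _ (@gev _ _ g) _ _ _ s) ?leq_maxr // (split_s (fun i => gev g y (q M)`_i * t ^+ i)) addrK.
  by apply: eq_bigr => i _; rewrite (E M).
rewrite opprB addrCA addrC; apply: le_trans (ler_normD _ _) _.
have -> : 2 * C * (t / r) ^+ M = C * (t / r) ^+ M + C * (t / r) ^+ M by ring.
apply: lerD; first exact: h2.
apply: le_trans (ler_norm_sum _ _ _) _.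
apply: le_trans (_ : (t / r) ^+ M * \sum_(i < s | (M <= i)%N) nu (q M)`_i * r ^+ i <= _).
  rewrite mulr_sumr; apply: ler_sum => i Mi.
  rewrite normrM normrX (gtr0_norm t0) mulrCA ler_pM ?exprn_ge0 ?(ltW t0) //.
    exact: (nrm_ev nuP).
  have -> : t ^+ i = (t / r) ^+ i * r ^+ i by rewrite -exprMn divfK // gt_eqF.
  rewrite ler_wpM2r ?exprn_ge0 ?(ltW r0) // ler_wiXn2l //.
    by rewrite divr_ge0 ?(ltW t0) ?(ltW r0).
  by rewrite ler_pdivrMr // mul1r.
rewrite mulrC ler_wpM2r ?exprn_ge0 ?divr_ge0 ?(ltW t0) ?(ltW r0) //.
apply: le_trans h3; rewrite lerDr; apply: sumr_ge0 => i _.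
by rewrite mulr_ge0 ?exprn_ge0 ?(ltW r0) // (nrm_ge0 nuP).
Qed.

End Series.

(** * Noetherianity with bounds *)

Section Noetherian.
Variables (R : realType) (D : nat) (g : noeth_ring R D).
Notation A := (gA g).
Notation fn := ((nat -> R) -> R -> R).
Notation nrm nu := (is_norm (@gev _ _ g) (@gcst _ _ g) nu).
Variable G : nat -> fn.

Definition Gsum N y t : R := \sum_(k < N) `|G k y t|.

Lemma Gsum_ge0 N y t : 0 <= Gsum N y t.
Proof. by apply: sumr_ge0. Qed.

Lemma Gsum_le N N' y t : (N <= N')%N -> Gsum N y t <= Gsum N' y t.
Proof.
move=> NN; rewrite /Gsum (big_ord_widen N' (fun k => `|G k y t|) NN) big_mkcond /=.
by apply: ler_sum => i _; case: ifP.
Qed.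

Definition dominated N (F : fn) : Prop := exists C r, [/\ 0 <= C, 0 < r &
  forall y t, cube y -> 0 < t <= r -> `|F y t| <= C * Gsum N y t].

(* Domination replaces membership in the span of the [G k]: no explicit
   combination has to be recorded. *)
Definition dominated_series (p : nat -> A) : Prop :=
  exists F N, has_series F p /\ dominated N F.

Lemma dominated_seriesD p p' : dominated_series p -> dominated_series p' -> dominated_series (fun i => p i + p' i).
Proof.
move=> [F [N [h [C [r [C0 r0 hC]]]]]] [F' [N' [h' [C' [r' [C'0 r'0 hC']]]]]].
exists (fun y t => F y t + F' y t), (maxn N N'); split.
  apply: gfilt_mono (gfilt_and (gfilt_norm g) (gfilt_and h h')).
  move=> nu [nuP [[s [E e]] [s' [E' e']]]]; have [s0 _ _] := e; have [s'0 _ _] := e'.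
  have m0 : 0 < Num.min s s' by rewrite lt_min s0.
  exists (Num.min s s'), (E + E'); apply: (expandsD nuP).
    exact: expands_le nuP _ _ _ _ _ e m0 (min_lel _ _).
  exact: expands_le nuP _ _ _ _ _ e' m0 (min_ler _ _).
exists (C + C'), (Num.min r r'); split; [exact: addr_ge0|by rewrite lt_min r0|].
move=> y t cy /andP[t0]; rewrite le_min => /andP[tr tr'].
apply: le_trans (ler_normD _ _) _; rewrite mulrDl; apply: lerD.
  apply: le_trans (hC y t cy _) _; first by rewrite t0.
  by rewrite ler_wpM2l // Gsum_le // leq_maxl.
apply: le_trans (hC' y t cy _) _; first by rewrite t0.
by rewrite ler_wpM2l // Gsum_le // leq_maxr.
Qed.

Lemma dominated_seriesZ a p : dominated_series p -> dominated_series (fun i => a * p i).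
Proof.
move=> [F [N [h [C [r [C0 r0 hC]]]]]].
have [nu nuP] := gfilt_ex (gfilt_norm g).
exists (fun y t => gev g y a * F y t), N; split.
  apply: gfilt_mono (gfilt_and (gfilt_norm g) h) => mu [muP [s [E e]]].
  by exists s, (mu a * E); apply: expandsZ.
exists (nu a * C), r; split=> //; first by rewrite mulr_ge0 // (nrm_ge0 nuP).
move=> y t cy ht; rewrite normrM -mulrA ler_pM //; last exact: hC.
exact: (nrm_ev nuP).
Qed.

Lemma dominated_series_shift p : dominated_series p -> dominated_series (series_shift p).
Proof.
move=> [F [N [h [C [r [C0 r0 hC]]]]]].
exists (fun y t => t * F y t), N; split.
  apply: gfilt_mono (gfilt_and (gfilt_norm g) h) => mu [muP [s [E e]]].
  by exists s, (s * E); apply: expands_shift.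
exists (r * C), r; split=> //; first by rewrite mulr_ge0 // ltW.
move=> y t cy ht; have /andP[t0 tr] := ht.
by rewrite normrM -mulrA ler_pM // ?hC // gtr0_norm.
Qed.

Lemma dominated_series0 : dominated_series (fun _ => 0).
Proof.
exists (fun _ _ => 0), 0%N; split.
  apply: gfilt_mono (gfilt_norm g) => nu nuP; exists 1, 0; exact: expands0.
by exists 0, 1; split=> // y t _ _; rewrite normr0 mul0r.
Qed.

(** For power series the lowest-order coefficient plays the part of the leading coefficient of a
    polynomial, and [series_shift] that of multiplication by ['X]. *)
Definition lead m (c : A) : Prop :=
  exists p, [/\ dominated_series p, forall i, (i < m)%N -> p i = 0 & p m = c].

Lemma lead_is_ideal m : is_ideal (lead m).
Proof.
split.
- by exists (fun _ => 0); split=> //; apply: dominated_series0.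
- move=> a b [p [Mp p0 <-]] [q [Mq q0 <-]]; exists (fun i => p i + q i).
  by split=> //; [exact: dominated_seriesD|move=> i im; rewrite p0 // q0 // addr0].
- move=> a b [p [Mp p0 <-]]; exists (fun i => a * p i).
  by split=> //; [exact: dominated_seriesZ|move=> i im; rewrite p0 // mulr0].
Qed.

Lemma leadS m c : lead m c -> lead m.+1 c.
Proof.
move=> [p [Mp p0 <-]]; exists (series_shift p); split=> //; first exact: dominated_series_shift.
by case=> // i im; rewrite /= p0.
Qed.

(* [c] is the order-[m] leading coefficient of a series dominated by [N] of the
   [G k] whose higher order terms are small. *)
Definition cancels (nu : A -> R) r N (E E' b : R) m c : Prop :=
  exists P F C, [/\ dominated_series P, (forall i, (i < m)%N -> P i = 0) /\ P m = c,
    expands nu r C F P,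
    forall M, \sum_(i < M | (m < i)%N) nu (P i) * r ^+ i <= E * b * r ^+ m.+1 &
    forall y t, cube y -> 0 < t <= r -> `|F y t| <= E' * b * Gsum N y t].

Section Cancels.
Variables (nu : A -> R) (nuP : nrm nu) (r : R) (r0 : 0 < r) (N : nat).

Lemma cancels0 E E' b m : 0 <= E -> 0 <= E' -> 0 <= b -> cancels nu r N E E' b m 0.
Proof.
move=> E0 E'0 b0; exists (fun _ => 0), (fun _ _ => 0), 0; split=> //.
- exact: dominated_series0.
- exact: expands0.
- move=> M; rewrite big1 ?mulr_ge0 ?exprn_ge0 ?(ltW r0) // => i _.
  by rewrite (nrm0 nuP) mul0r.
- by move=> y t _ _; rewrite normr0 !mulr_ge0 // Gsum_ge0.
Qed.

Lemma cancelsD E E' b b' m c c' : cancels nu r N E E' b m c ->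
  cancels nu r N E E' b' m c' -> cancels nu r N E E' (b + b') m (c + c').
Proof.
move=> [P [F [C [MP [P0 <-] e hT hF]]]] [P' [F' [C' [MP' [P'0 <-] e' hT' hF']]]].
exists (fun i => P i + P' i), (fun y t => F y t + F' y t), (C + C'); split=> //.
- exact: dominated_seriesD.
- by split=> // i im; rewrite P0 // P'0 // addr0.
- exact: expandsD.
- move=> M; rewrite mulrDr mulrDl; apply: le_trans (lerD (hT M) (hT' M)).
  rewrite -big_split /=; apply: ler_sum => i _.
  by rewrite -mulrDl ler_wpM2r ?exprn_ge0 ?(ltW r0) // (nrmD nuP).
- move=> y t cy ht; rewrite mulrDr mulrDl.
  by apply: le_trans (ler_normD _ _) _; apply: lerD; [apply: hF|apply: hF'].
Qed.

Lemma cancelsZ E E' b m a c : cancels nu r N E E' b m c ->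
  cancels nu r N E E' (nu a * b) m (a * c).
Proof.
move=> [P [F [C [MP [P0 <-] e hT hF]]]]; have a0 := nrm_ge0 nuP a.
exists (fun i => a * P i), (fun y t => gev g y a * F y t), (nu a * C); split=> //.
- exact: dominated_seriesZ.
- by split=> // i im; rewrite P0 // mulr0.
- exact: expandsZ.
- move=> M; rewrite mulrCA -mulrA; apply: le_trans (ler_wpM2l a0 (hT M)).
  rewrite mulr_sumr; apply: ler_sum => i _.
  by rewrite mulrA ler_wpM2r ?exprn_ge0 ?(ltW r0) // (nrmM nuP).
- move=> y t cy ht; rewrite mulrCA -mulrA normrM ler_pM ?hF //.
  exact: (nrm_ev nuP).
Qed.

Lemma cancels_shift E E' b m c : cancels nu r N E E' b m c ->
  cancels nu r N E (E' * r) b m.+1 c.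
Proof.
move=> [P [F [C [MP [P0 <-] e hT hF]]]].
exists (series_shift P), (fun y t => t * F y t), (r * C); split=> //.
- exact: dominated_series_shift.
- by split=> //; case=> // i im; rewrite /= P0.
- exact: expands_shift.
- case=> [|M].
    rewrite big_ord0; have := hT 0%N; rewrite big_ord0 => h.
    by rewrite exprSr mulrA mulr_ge0 // ltW.
  rewrite big_mkcond big_ord_recl /= add0r exprSr mulrA.
  apply: le_trans (ler_wpM2r (ltW r0) (hT M)); rewrite mulr_suml [leRHS]big_mkcond /=.
  by apply: ler_sum => i _; rewrite ltnS; case: ifP => // _; rewrite exprSr mulrA.
- move=> y t cy ht; have /andP[t0 tr] := ht.
  have -> : E' * r * b * Gsum N y t = r * (E' * b * Gsum N y t) by ring.
  by rewrite normrM ler_pM // ?hF // gtr0_norm.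
Qed.

Lemma cancels_shiftn E E' b m j c : cancels nu r N E E' b m c ->
  cancels nu r N E (E' * r ^+ j) b (m + j) c.
Proof.
elim: j => [|j IH]; first by rewrite mulr1 addn0.
by move/IH/cancels_shift; rewrite addnS exprSr mulrA.
Qed.

Lemma cancels_weaken N' E1 E1' E E' b m c : (N' <= N)%N -> E1 <= E -> E1' <= E' -> 0 <= E1' -> 0 <= b ->
  cancels nu r N' E1 E1' b m c -> cancels nu r N E E' b m c.
Proof.
move=> NN EE EE' E0 b0 [P [F [C [MP P0 e hT hF]]]].
exists P, F, C; split=> //.
  move=> M; apply: le_trans (hT M) _.
  by rewrite ler_wpM2r ?exprn_ge0 ?(ltW r0) // ler_wpM2r.
move=> y t cy ht; apply: le_trans (hF y t cy ht) _.
by rewrite ler_pM ?mulr_ge0 ?Gsum_ge0 ?Gsum_le // ler_wpM2r.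
Qed.

End Cancels.

(** At radius [r] the tail beyond order [m] is at most [(r / r3) ^+ m.+1 * C3], one power of [r]
    better than the leading term. Hence [E] does not depend on [r], and [r] can later be shrunk
    until [E * r <= 2^-1]. *)
Lemma cancels_generators m (s : seq A) : (forall c, c \in s -> lead m c) ->
  exists N, gfilt (fun nu : A -> R => exists E r0, [/\ 0 <= E, 0 < r0 &
    forall r c, 0 < r <= r0 -> c \in s -> cancels nu r N E E 1 m c]).
Proof.
elim: s => [|c s IH] hs.
  by exists 0%N; apply: gfilt_mono (gfilt_norm g) => nu _; exists 0, 1.
have [|N1 h1] := IH; first by move=> d ds; apply: hs; rewrite inE ds orbT.
have [p [Mp p0 pc]] := hs c (mem_head _ _).
have [F [N2 [hp [C2 [r2 [C20 r20 hF]]]]]] := Mp.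
exists (maxn N1 N2).
apply: gfilt_mono (gfilt_and (gfilt_norm g) (gfilt_and h1 hp)).
move=> nu [nuP [[E1 [r1 [E10 r10 hs1]]] [r3 [C3 e]]]].
have [r30 C30 he] := e.
pose E2 := Num.max C2 (C3 / r3 ^+ m.+1).
have E20 : 0 <= E2 by rewrite le_max C20.
exists (Num.max E1 E2), (Num.min r1 (Num.min r2 r3)); split.
- by rewrite le_max E10.
- by rewrite !lt_min r10 r20.
move=> r d /andP[r0]; rewrite !le_min => /and3P[rr1 rr2 rr3].
rewrite inE => /orP[/eqP->|ds]; last first.
  apply: cancels_weaken (hs1 r d _ ds) => //; rewrite ?leq_maxl ?le_max ?lexx // ?r0 //.
have EE2 : E2 <= Num.max E1 E2 by rewrite le_max lexx orbT.
apply: (@cancels_weaken nu r r0 _ N2 E2 E2) => //; first exact: leq_maxr.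
exists p, F, C3; split=> //.
- exact: expands_le nuP _ _ _ _ _ e r0 rr3.
- move=> M; have [hM _] := he M; rewrite mulr1.
  apply: le_trans (_ : C3 / r3 ^+ m.+1 * r ^+ m.+1 <= _); last first.
    by rewrite ler_wpM2r ?exprn_ge0 ?(ltW r0) // le_max lexx orbT.
  have -> : C3 / r3 ^+ m.+1 * r ^+ m.+1 = (r / r3) ^+ m.+1 * C3.
    by rewrite expr_div_n; ring.
  have q0 : 0 <= r / r3 by rewrite divr_ge0 // ltW.
  apply: le_trans (ler_wpM2l (exprn_ge0 _ q0) hM); rewrite mulr_sumr big_mkcond /=.
  apply: ler_sum => i _; case: ltnP => im; last first.
    by rewrite !mulr_ge0 ?exprn_ge0 // ?(ltW r30) // (nrm_ge0 nuP).
  have -> : r ^+ i = (r / r3) ^+ i * r3 ^+ i by rewrite -exprMn divfK // gt_eqF.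
  rewrite mulrCA ler_wpM2r ?mulr_ge0 ?exprn_ge0 ?(ltW r30) ?(nrm_ge0 nuP) //.
  by rewrite ler_wiXn2l // ler_pdivrMr // mul1r.
- move=> y t cy /andP[t0 tr]; rewrite mulr1; apply: le_trans (hF y t cy _) _.
    by rewrite t0 (le_trans tr).
  by rewrite ler_wpM2r ?Gsum_ge0 // le_max lexx.
Qed.

Lemma cancels_level m : exists N, gfilt (fun nu : A -> R => exists E r0, [/\ 0 <= E, 0 < r0 &
    forall r c, 0 < r <= r0 -> lead m c -> cancels nu r N E E (nu c) m c]).
Proof.
have [s [hs hl]] := gnoeth (lead_is_ideal m).
have [N hN] := cancels_generators hs.
exists N; apply: gfilt_mono (gfilt_and (gfilt_norm g) (gfilt_and hl hN)).
move=> nu [nuP [[K [K0 hK]] [E [r0 [E0 r00 hE]]]]].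
exists (E * K), r0; split=> //; first exact: mulr_ge0.
move=> r c hr Lc; have rp : 0 < r by case/andP: hr.
have : cancels nu r N E E (K * nu c) m c.
  elim: (hK c Lc) => [b b0|p b q h hs' _ IH]; first exact: cancels0.
  apply: cancelsD => //; rewrite -[nu q]mulr1.
  by apply: (cancelsZ nuP) => //; exact: hE.
move=> [P [F [C [MP P0 e hT hF]]]]; exists P, F, C; split=> //.
  by move=> M; rewrite -(mulrA E).
by move=> y t cy ht; rewrite -(mulrA E); apply: hF.
Qed.

Lemma cancels_levels n : exists N, gfilt (fun nu : A -> R => exists E r0, [/\ 0 <= E, 0 < r0 &
    forall m r c, (m < n)%N -> 0 < r <= r0 -> lead m c -> cancels nu r N E E (nu c) m c]).
Proof.
elim: n => [|n [N1 h1]].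
  by exists 0%N; apply: gfilt_mono (gfilt_norm g) => nu _; exists 0, 1.
have [N2 h2] := cancels_level n.
exists (maxn N1 N2); apply: gfilt_mono (gfilt_and (gfilt_norm g) (gfilt_and h1 h2)).
move=> nu [nuP [[E1 [r1 [E10 r10 k1]]] [E2 [r2 [E20 r20 k2]]]]].
exists (Num.max E1 E2), (Num.min r1 r2); split; rewrite ?le_max ?E10 ?lt_min ?r10 //.
move=> m r c; rewrite ltnS leq_eqVlt => mn /andP[rp]; rewrite le_min => /andP[rr1 rr2] Lc.
have nuc := nrm_ge0 nuP c.
case/orP: mn => [/eqP mn|mn].
  rewrite mn in Lc *; apply: cancels_weaken (k2 r c _ Lc) => //.
  - exact: leq_maxr.
  - by rewrite le_max lexx orbT.
  - by rewrite le_max lexx orbT.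
  - by rewrite rp.
apply: cancels_weaken (k1 m r c mn _ Lc) => //.
- exact: leq_maxl.
- by rewrite le_max lexx.
- by rewrite le_max lexx.
- by rewrite rp.
Qed.

(* Order by order, the leading coefficient of the remainder is cancelled at a cost
   proportional to its norm. The total cost is bounded by the norm of the series, and the
   remainder at order [m] is [O(2 ^- m)] on half the radius. *)
Lemma dominated_series_uniform : exists N, forall F p, dominated_series p -> has_series F p -> dominated N F.
Proof.
have [m0 hm0] := chain_stable lead_is_ideal leadS.
have [N hN] := cancels_levels m0.+1.
exists N => F p Mp hp.
have [nu [nuP [[E [r1 [E0 r10 hE]]] [r2 [C e]]]]] :=
  gfilt_ex (gfilt_and (gfilt_norm g) (gfilt_and hN hp)).
have [r20 C0 _] := e.
(* The last bound gives [E * r <= 2^-1]: a cancellation puts back at most half of the norm it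
   removes. *)
pose r := Num.min (Num.min r1 r2) (Num.min 1 (2 * (E + 1))^-1).
have r0 : 0 < r by rewrite !lt_min r10 r20 ltr01 invr_gt0 mulr_gt0 // ltr_wpDl.
have rr1 : r <= r1 by rewrite /r !ge_min lexx.
have rr2 : r <= r2 by rewrite /r !ge_min lexx orbT.
have rl1 : r <= 1 by rewrite /r !ge_min lexx !orbT.
have rE : E * r <= 2^-1.
  apply: le_trans (_ : (E + 1) * (2 * (E + 1))^-1 <= _).
    by apply: ler_pM => //; rewrite ?(ltW r0) ?lerDl // /r !ge_min lexx !orbT.
  have E1 : E + 1 != 0 by rewrite gt_eqF // ltr_wpDl.
  by rewrite le_eqVlt; apply/orP; left; apply/eqP; field.
have {}e := expands_le nuP e r0 rr2.
(* Price per unit of norm: cancelling at order [m] costs [E * r ^+ (m - k) * nu c] with [k <= m0],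
   while the budget falls by [nu c * r ^+ m / 2]. *)
pose S := 2 * E / r ^+ m0.
have S0 : 0 <= S by rewrite divr_ge0 ?mulr_ge0 // exprn_ge0 // ltW.
(* [H], with series [f], is what remains after [m] cancellations and [b] the budget left; the part
   [F - H] already cancelled is paid for by the spent amount [C - b]. No bound on [C'] is kept. *)
pose inv m := exists f H b C', [/\ dominated_series f, (forall i, (i < m)%N -> f i = 0), expands nu r C' H f,
  (forall M, \sum_(i < M) nu (f i) * r ^+ i <= b) /\ b <= C &
  forall y t, cube y -> 0 < t <= r -> `|F y t - H y t| <= S * (C - b) * Gsum N y t].
have inv_all m : inv m.
  elim: m => [|m [f [H [b [C' [Mf f0 ef [hb bC] hH]]]]]].
    exists p, F, C, C; split=> //; first by split=> // M; have [_ _ /(_ M)[]] := e.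
    by move=> y t _ _; rewrite !subrr normr0 mulr0 mul0r.
  set c := f m; pose k := minn m m0; have km : (k <= m)%N by apply: geq_minl.
  have Lc : lead k c by apply: hm0; exists f.
  have kk : (k < m0.+1)%N by rewrite ltnS geq_minr.
  have hr : 0 < r <= r1 by rewrite r0.
  have := cancels_shiftn nuP r0 (m - k) (hE k r c kk hr Lc).
  rewrite subnKC // => -[P [Q [C1 [MP [P0 Pm] eP hT hQ]]]].
  have nuc : 0 <= nu c * r ^+ m by rewrite mulr_ge0 ?exprn_ge0 ?(ltW r0) // (nrm_ge0 nuP).
  exists (fun i => f i + (-1) * P i), (fun y t => H y t + gev g y (-1) * Q y t),
    (b - (nu c * r ^+ m) / 2), (C' + nu (-1) * C1); split.
  - by apply: dominated_seriesD => //; apply: dominated_seriesZ.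
  - move=> i; rewrite ltnS leq_eqVlt => /orP[/eqP->|im].
      by rewrite Pm mulN1r subrr.
    by rewrite f0 // P0 // mulr0 addr0.
  - by apply: (expandsD nuP) => //; apply: expandsZ.
  - split; last by lra.
    move=> M0; pose M := maxn M0 m.+1.
    apply: le_trans (_ : \sum_(i < M) nu (f i + -1 * P i) * r ^+ i <= _).
      rewrite (big_ord_widen M (fun i => nu (f i + -1 * P i) * r ^+ i)) ?leq_maxl //.
      rewrite big_mkcond /=; apply: ler_sum => i _; case: ifP => // _.
      by rewrite mulr_ge0 ?exprn_ge0 ?(ltW r0) // (nrm_ge0 nuP).
    have hm : (m < M)%N by rewrite leq_maxr.
    have h1 : \sum_(i < M) nu (f i + -1 * P i) * r ^+ i <=
        \sum_(i < M | (m < i)%N) nu (f i) * r ^+ i + \sum_(i < M | (m < i)%N) nu (P i) * r ^+ i.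
      rewrite -big_split /= big_mkcond [leRHS]big_mkcond /=; apply: ler_sum => i _.
      case: ltnP => im.
        rewrite -mulrDl ler_wpM2r ?exprn_ge0 ?(ltW r0) // mulN1r.
        by apply: le_trans (nrmD nuP _ _) _; rewrite (nrmN nuP).
      have -> : f i + -1 * P i = 0.
        move: im; rewrite leq_eqVlt => /orP[/eqP->|im]; first by rewrite Pm mulN1r subrr.
        by rewrite f0 // P0 // mulr0 addr0.
      by rewrite (nrm0 nuP) mul0r.
    have h2 : \sum_(i < M | (m < i)%N) nu (f i) * r ^+ i <= b - nu c * r ^+ m.
      rewrite lerBrDr; apply: le_trans (hb M).
      rewrite [leRHS](bigID (fun i : 'I_M => (m < i)%N)) /= lerD2l.
      rewrite (bigD1 (Ordinal hm)) ?ltnn //= lerDl; apply: sumr_ge0 => i _.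
      by rewrite mulr_ge0 ?exprn_ge0 ?(ltW r0) // (nrm_ge0 nuP).
    have h3 : E * nu c * r ^+ m.+1 <= (nu c * r ^+ m) / 2.
      have -> : E * nu c * r ^+ m.+1 = (E * r) * (nu c * r ^+ m) by rewrite exprS; ring.
      by rewrite [leRHS]mulrC ler_wpM2r.
    have := hT M; lra.
  - move=> y t cy ht; rewrite rmorphN1 mulN1r opprB addrA addrAC.
    have -> : S * (C - (b - nu c * r ^+ m / 2)) * Gsum N y t =
       S * (C - b) * Gsum N y t + S * (nu c * r ^+ m / 2) * Gsum N y t by ring.
    apply: le_trans (ler_normD _ _) _; apply: lerD; first exact: hH.
    apply: le_trans (hQ y t cy ht) _; rewrite ler_wpM2r ?Gsum_ge0 //.
    have -> : S * (nu c * r ^+ m / 2) = E * (r ^+ m / r ^+ m0) * nu c by rewrite /S; field; rewrite expf_neq0 // gt_eqF.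
    rewrite ler_wpM2r ?(nrm_ge0 nuP) // ler_wpM2l // ler_pdivlMr ?exprn_gt0 //.
    by rewrite -exprD ler_wiXn2l ?(ltW r0) // -{1}(subnK km) leq_add2l geq_minr.
exists (S * C), (r / 2); split; [exact: mulr_ge0|by rewrite divr_gt0|].
move=> y t cy /andP[t0 tr]; apply: (@le_of_geometric _ _ _ C) => m.
have [f [H [b [C' [Mf f0 ef [hb bC] hH]]]]] := inv_all m.
have tr' : 0 < t <= r by rewrite t0; lra.
have b0 : 0 <= b by have := hb 0%N; rewrite big_ord0.
have h1 := hH y t cy tr'.
have h2 := expands_tail nuP ef f0 hb cy t0 tr.
have -> : F y t = (F y t - H y t) + H y t by rewrite subrK.
apply: le_trans (ler_normD _ _) _; apply: lerD.
  apply: le_trans h1 _; rewrite ler_wpM2r ?Gsum_ge0 // ler_wpM2l //.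
  by rewrite lerBlDr lerDl.
by apply: le_trans h2 _; rewrite mulrC ler_wpM2r // exprn_ge0 // invr_ge0.
Qed.

End Noetherian.

(** * Chains of analytic functions and composition with power series *)

Section Chain.
Variables (R : realType) (D : nat) (g : noeth_ring R D).

(** [G N] is trivially dominated by the first [N.+1] functions; the uniform [N] improves this to the
    first [N]. *)
Lemma analytic_chain (G : nat -> (nat -> R) -> R -> R) : (forall k, analytic g (G k)) ->
  exists N C r, [/\ 0 <= C, 0 < r & forall y t, cube y -> 0 < t <= r ->
    `|G N y t| <= C * \sum_(k < N) `|G k y t|].
Proof.
move=> aG; have [N hN] := dominated_series_uniform g G.
have [p hp] := analytic_has_series (aG N).
have [|C [r [C0 r0 h]]] := hN (G N) p _ hp; last by exists N, C, r; split.
exists (G N), N.+1; split=> //; exists 1, 1; split=> // y t _ _.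
by rewrite mul1r /Gsum big_ord_recr /= lerDr sumr_ge0.
Qed.

Lemma gcst1 : gcst g 1 = 1.
Proof.
apply/eqP; rewrite -subr_eq0; apply/eqP; apply: gev_inj => y cy.
by rewrite rmorphB rmorph1 gev_cst subrr.
Qed.

(* A function given near 0 by a power series whose coefficients are at most 1. *)
Definition unit_series (f : R -> R) (c : nat -> R) : Prop :=
  (forall n, `|c n| <= 1) /\ forall z, `|z| <= 2^-1 -> forall M,
    `|f z - \sum_(n < M) c n * z ^+ n| <= 2 * `|z| ^+ M.

Lemma geometric_sum_le (x : R) M : 0 <= x -> x <= 2^-1 -> \sum_(n < M) x ^+ n <= 2.
Proof.
move=> x0 x1; have h : (1 - x) * \sum_(n < M) x ^+ n <= 1.
  by rewrite -opprB mulNr -subrX1 opprB lerBlDr lerDl exprn_ge0.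
have : 2^-1 * \sum_(n < M) x ^+ n <= (1 - x) * \sum_(n < M) x ^+ n.
  by rewrite ler_wpM2r ?sumr_ge0 // => [i _|]; [rewrite exprn_ge0|lra].
lra.
Qed.

(** The crude factor [(2 * B) ^+ n] absorbs the [n] of the mean value bound and keeps sums over [n]
    geometric. *)
Lemma exprB_le (a b B : R) n : 1 <= B -> `|a| <= B -> `|b| <= B ->
  `|a ^+ n - b ^+ n| <= (2 * B) ^+ n * `|a - b|.
Proof.
move=> B1 aB bB; elim: n => [|n IH]; first by rewrite !expr0 subrr normr0 mul1r.
have -> : a ^+ n.+1 - b ^+ n.+1 = a * (a ^+ n - b ^+ n) + (a - b) * b ^+ n.
  by rewrite !exprS; ring.
apply: le_trans (ler_normD _ _) _; rewrite !normrM normrX.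
have -> : (2 * B) ^+ n.+1 * `|a - b| = B * ((2 * B) ^+ n * `|a - b|) + `|a - b| * (B * (2 * B) ^+ n).
  by rewrite exprS; ring.
apply: lerD; first by apply: ler_pM.
apply: ler_wpM2l => //; apply: le_trans (_ : B ^+ n <= _).
  by apply: lerXn2r; rewrite ?nnegrE //; lra.
apply: le_trans (_ : (2 * B) ^+ n <= _).
  by apply: lerXn2r; rewrite ?nnegrE; lra.
by rewrite ler_peMl // exprn_ge0 //; lra.
Qed.

(** As [z] is [O(t)], it is [t] times an analytic function, and the approximant of order [M] is the
    partial sum of [f] at ['X * q M]. On [4 * B * s <= 1] all sums are geometric; truncating [f]
    costs 2 and perturbing its argument [2 * C]. *)
Lemma analytic_comp f c z : unit_series f c -> analytic g z -> bigO 1 z ->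
  analytic g (fun y t => f (z y t)).
Proof.
move=> [c1 hf] az z1; have [q hq] := analytic_div az z1.
exists (fun M => \sum_(n < M) (gcst g (c n))%:P * (('X : {poly gA g}) ^+ n * q M ^+ n)).
apply: gfilt_mono (gfilt_and (gfilt_norm g) hq) => nu [nuP [r [C hC]]].
have [r0 C0 _] := hC.
pose B := 2 * C + 1; have B1 : 1 <= B by rewrite /B; lra.
have B0 : 0 < B by lra.
pose s := Num.min r (4 * B)^-1.
have s0 : 0 < s by rewrite lt_min r0 invr_gt0 mulr_gt0.
have sB : 4 * B * s <= 1.
  apply: le_trans (_ : 4 * B * (4 * B)^-1 <= _).
    by rewrite ler_wpM2l ?min_ler // mulr_ge0 // ltW.
  by rewrite divff // mulf_neq0 // gt_eqF.
have hs := approx_le nuP hC s0 (min_lel _ _) (lexx _); have [_ _ h] := hs.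
exists s, (2 + 2 * C); split=> //; first by rewrite addr_ge0 // mulr_ge0.
move=> M; have [h1 h2] := h M; split.
  apply: le_trans (_ : \sum_(n < M) (s * C) ^+ n <= _).
    elim/big_ind2: _ => [|x1 x2 y1 y2 hx hy|n _]; first by rewrite (pnorm0 nu).
      by apply: le_trans (pnormD nuP (ltW s0) _ _) _; apply: lerD.
    apply: le_trans (pnormM nuP (ltW s0) _ _) _; rewrite (pnormC nuP) -exprMn.
    apply: le_trans (_ : 1 * pnorm nu s (('X * q M) ^+ n) <= _).
      rewrite ler_wpM2r ?(pnorm_ge0 nuP (ltW s0)) //.
      by apply: le_trans (nrm_cst nuP _) _.
    rewrite mul1r; elim: (nat_of_ord n) => [|k IH].
      rewrite !expr0 -polyC1 (pnormC nuP) -gcst1.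
      by apply: le_trans (nrm_cst nuP _) _; rewrite normr1.
    rewrite !exprS; apply: le_trans (pnormM nuP (ltW s0) _ _) _.
    apply: ler_pM => //; rewrite ?(pnorm_ge0 nuP (ltW s0)) //.
    by rewrite mulrC (pnormMX nuP) mulrC ler_wpM2l // ltW.
  apply: le_trans (geometric_sum_le _ _ _) _; last by lra.
    by rewrite mulr_ge0 // ltW.
  have : s * C <= s * B by rewrite ler_wpM2l ?(ltW s0) // /B; lra.
  lra.
move=> y t cy ht; have /andP[t0 ts] := ht.
have [bz bq] := approx_bound nuP hs M cy ht.
set Z := z y t / t in bz.
have zE : z y t = t * Z by rewrite /Z mulrC divfK // gt_eqF.
set e := evp _ _ _ (q M) in bq.
have tZ : `|t * Z| <= t * B.
  by rewrite normrM gtr0_norm // ler_wpM2l ?(ltW t0) // /B; lra.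
have tB : t * B <= 4^-1.
  have : t * B <= s * B by rewrite ler_wpM2r // ltW.
  lra.
have -> : evp (@gev _ _ g) y t (\sum_(n < M) (gcst g (c n))%:P * ('X ^+ n * q M ^+ n)) =
    \sum_(n < M) c n * (t * e) ^+ n.
  rewrite rmorph_sum; apply: eq_bigr => n _.
  rewrite rmorphM [evp _ _ _ _%:P]evpC gev_cst rmorphM !rmorphXn [evp _ _ _ 'X]evpX.
  by rewrite exprMn.
have -> : f (z y t) - \sum_(n < M) c n * (t * e) ^+ n =
    (f (t * Z) - \sum_(n < M) c n * (t * Z) ^+ n) +
    \sum_(n < M) c n * ((t * Z) ^+ n - (t * e) ^+ n).
  rewrite zE -addrA; congr (_ + _); under [X in _ = _ + X]eq_bigr => n _ do rewrite mulrBr.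
  by rewrite big_split /= sumrN addKr.
apply: le_trans (ler_normD _ _) _; rewrite mulrDl; apply: lerD.
  have tZ2 : `|t * Z| <= 2^-1 by apply: le_trans tZ _; lra.
  apply: le_trans (hf _ tZ2 M) _; rewrite ler_wpM2l // lerXn2r ?nnegrE ?divr_ge0 ?(ltW t0) ?(ltW s0) //.
  apply: le_trans tZ _; rewrite ler_wpM2l ?(ltW t0) //.
  by rewrite -(ler_pM2r s0) mulVf ?gt_eqF //; lra.
apply: le_trans (ler_norm_sum _ _ _) _.
apply: le_trans (_ : \sum_(n < M) (t * (2 * B)) ^+ n * `|Z - e| <= _).
  apply: ler_sum => n _; rewrite normrM -[leRHS]mul1r; apply: ler_pM => //.
  rewrite (exprMn n t Z) (exprMn n t e) (exprMn n t (2 * B)) -mulrBr normrM normrX (gtr0_norm t0).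
  rewrite -mulrA; apply: ler_wpM2l; first by rewrite exprn_ge0 // ltW.
  by apply: exprB_le => //; rewrite /B; lra.
rewrite -mulr_suml -mulrA; apply: ler_pM => //.
- by apply: sumr_ge0 => i _; rewrite exprn_ge0 // mulr_ge0 ?(ltW t0) // mulr_ge0 // ltW.
- apply: geometric_sum_le; last by lra.
  by rewrite mulr_ge0 ?(ltW t0) // mulr_ge0 // ltW.
- exact: h2.
Qed.

End Chain.

(** * Finite differences of slow sequences *)

Section Smooth.
Variable R : realType.
Notation fn := ((nat -> R) -> R -> R).

Definition fdiff (a : nat -> fn) : nat -> fn := fun s y t => a s.+1 y t - a s y t.

(* [smooth k i th a]: for [j <= k], the [j]-th difference of the sequence [a] is
   [O(t ^ (i + j))] at the indices [s >= j + th]. The delay [j] is needed because the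
   loss preceding the initial state is arbitrary. *)
Fixpoint smooth (k i th : nat) (a : nat -> fn) : Prop :=
  (forall s, (th <= s)%N -> bigO i (a s)) /\
  (if k is k'.+1 then smooth k' i.+1 th.+1 (fdiff a) else True).

Lemma smooth_le k i th k' i' th' a : (k' <= k)%N -> (i' <= i)%N -> (th <= th')%N ->
  smooth k i th a -> smooth k' i' th' a.
Proof.
elim: k k' i th i' th' a => [|k IH] [|k'] i th i' th' a //= kk ii tt [h1 h2]; split=> //.
- by move=> s hs; apply: bigO_le ii (h1 _ (leq_trans tt hs)).
- by move=> s hs; apply: bigO_le ii (h1 _ (leq_trans tt hs)).
- by move=> s hs; apply: bigO_le ii (h1 _ (leq_trans tt hs)).
- exact: IH h2.
Qed.

(** Terms that are already of order [i + k] need no cancellation in their first [k] differences.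
    This disposes of remainders of power series. *)
Lemma smooth_remainder k i th a :
  (forall s, (th <= s)%N -> bigO (i + k) (a s)) -> smooth k i th a.
Proof.
elim: k i th a => [|k IH] i th a h /=; split.
- by move=> s hs; rewrite -[i]addn0; apply: h.
- by [].
- by move=> s hs; apply: bigO_le (h s hs); apply: leq_addr.
- apply: IH => s hs; apply: bigOD; rewrite addSnnS.
    by apply: h; apply: leqW; apply: ltnW.
  by apply: bigON; apply: h; apply: ltnW.
Qed.

Lemma smooth0 k i th : smooth k i th (fun _ _ _ => 0).
Proof. by apply: smooth_remainder => s _; apply: bigO_const; left. Qed.

Lemma smooth_stationary k i th (F : fn) : bigO i F -> smooth k i th (fun _ => F).
Proof.
case: k => [|k] h; split=> //.
have -> : fdiff (fun=> F) = (fun _ _ _ => 0).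
  by apply/funext => s; apply/funext => y; apply/funext => t; rewrite /fdiff subrr.
exact: smooth0.
Qed.

Lemma smoothD k i th a b : smooth k i th a -> smooth k i th b ->
  smooth k i th (fun s y t => a s y t + b s y t).
Proof.
elim: k i th a b => [|k IH] i th a b [h1 h2] [h1' h2']; split=> //.
- by move=> s hs; apply: bigOD; auto.
- by move=> s hs; apply: bigOD; auto.
have -> : fdiff (fun s y t => a s y t + b s y t) = fun s y t => fdiff a s y t + fdiff b s y t.
  by apply/funext => s; apply/funext => y; apply/funext => t; rewrite /fdiff opprD addrACA.
exact: IH.
Qed.

Lemma smooth_shift k i th a : smooth k i th a -> smooth k i th (fun s => a s.+1).
Proof.
elim: k i th a => [|k IH] i th a [h1 h2]; split=> //.
- by move=> s hs; apply: h1; apply: leqW.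
- by move=> s hs; apply: h1; apply: leqW.
exact: (IH _ _ _ h2).
Qed.

(** The first term of [b] is arbitrary, hence one more round of delay. The sequence of preceding
    losses is of this kind. *)
Lemma smooth_back k i th a b : (forall s, b s.+1 = a s) ->
  smooth k i th a -> smooth k i th.+1 b.
Proof.
elim: k i th a b => [|k IH] i th a b ba [h1 h2]; split=> //.
- by case=> // s hs; rewrite ba; apply: h1.
- by case=> // s hs; rewrite ba; apply: h1.
by apply: IH h2 => s; rewrite /fdiff !ba.
Qed.

Lemma smoothM k i i' th a b : smooth k i th a -> smooth k i' th b ->
  smooth k (i + i') th (fun s y t => a s y t * b s y t).
Proof.
elim: k i i' th a b => [|k IH] i i' th a b ha hb.
  by have [h _] := ha; have [h' _] := hb; split=> // s hs; apply: bigOM; auto.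
have [h1 h2] := ha; have [h1' h2'] := hb; split.
  by move=> s hs; apply: bigOM; auto.
have -> : fdiff (fun s y t => a s y t * b s y t) =
    fun s y t => fdiff a s y t * b s.+1 y t + a s y t * fdiff b s y t.
  by apply/funext => s; apply/funext => y; apply/funext => t; rewrite /fdiff; ring.
apply: smoothD.
  rewrite -addSn; apply: IH h2 _; apply: smooth_shift.
  exact: smooth_le (leqnSn k) (leqnn _) (leqnSn th) hb.
rewrite -addnS; apply: IH _ h2'.
exact: smooth_le (leqnSn k) (leqnn _) (leqnSn th) ha.
Qed.

Lemma smoothZ k i th (c : R) a : smooth k i th a -> smooth k i th (fun s y t => c * a s y t).
Proof.
move=> ha; rewrite -[i]add0n; apply: smoothM ha.
by apply: smooth_stationary; apply: bigO_const; right.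
Qed.

Lemma smoothN k i th a : smooth k i th a -> smooth k i th (fun s y t => - a s y t).
Proof.
move=> /(smoothZ (-1)); congr smooth.
by apply/funext => s; apply/funext => y; apply/funext => t; rewrite mulN1r.
Qed.

Lemma smooth_sum (I : Type) (r : seq I) (P : pred I) k i th (a : I -> nat -> fn) :
  (forall j, P j -> smooth k i th (a j)) ->
  smooth k i th (fun s y t => \sum_(j <- r | P j) a j s y t).
Proof.
move=> h; elim: r => [|j r IH].
  have -> : (fun s y t => \sum_(j <- [::] | P j) a j s y t) = (fun _ _ _ => 0).
    by apply/funext => s; apply/funext => y; apply/funext => t; rewrite big_nil.
  exact: smooth0.
have -> : (fun s y t => \sum_(j <- j :: r | P j) a j s y t) =
    (fun s y t => (if P j then a j s y t else 0) + \sum_(j <- r | P j) a j s y t).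
  apply/funext => s; apply/funext => y; apply/funext => t; rewrite big_cons.
  by case: ifP; rewrite ?add0r.
by apply: smoothD => //; case Pj: (P j); [exact: h|exact: smooth0].
Qed.

Lemma smooth_prod (I : Type) (r : seq I) (P : pred I) k th (a : I -> nat -> fn) :
  (forall j, P j -> smooth k 0 th (a j)) ->
  smooth k 0 th (fun s y t => \prod_(j <- r | P j) a j s y t).
Proof.
have one : smooth k 0 th (fun _ _ _ => 1).
  by apply: smooth_stationary; apply: bigO_const; right.
move=> h; elim: r => [|j r IH].
  have -> : (fun s y t => \prod_(j <- [::] | P j) a j s y t) = (fun _ _ _ => 1).
    by apply/funext => s; apply/funext => y; apply/funext => t; rewrite big_nil.
  exact: one.
have -> : (fun s y t => \prod_(j <- j :: r | P j) a j s y t) =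
    (fun s y t => (if P j then a j s y t else 1) * \prod_(j <- r | P j) a j s y t).
  apply/funext => s; apply/funext => y; apply/funext => t; rewrite big_cons.
  by case: ifP; rewrite ?mul1r.
rewrite -[0%N]addn0; apply: smoothM => //; case Pj: (P j) => //; exact: h.
Qed.

Lemma smoothXn k th a n : smooth k 1 th a -> smooth k n th (fun s y t => a s y t ^+ n).
Proof.
move=> ha; elim: n => [|n IH].
  have -> : (fun s y t => a s y t ^+ 0) = (fun _ _ _ => 1).
    by apply/funext => s; apply/funext => y; apply/funext => t; rewrite expr0.
  by apply: smooth_stationary; apply: bigO_const; right.
have -> : (fun s y t => a s y t ^+ n.+1) = (fun s y t => a s y t * a s y t ^+ n).
  by apply/funext => s; apply/funext => y; apply/funext => t; rewrite exprS.
by rewrite -add1n; apply: smoothM.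
Qed.

(** The first [k] powers of [z] are covered by the product rule, and the rest of the series is
    [O(t ^ k.+1)]. *)
Lemma smooth_comp f c k th z : unit_series f c -> smooth k 1 th z ->
  smooth k 1 th (fun s y t => f (z s y t) - c 0%N).
Proof.
move=> [c1 hf] hz.
have -> : (fun s y t => f (z s y t) - c 0%N) = fun s y t =>
    \sum_(n < k) c n.+1 * z s y t ^+ n.+1 +
    (f (z s y t) - \sum_(n < k.+1) c n * z s y t ^+ n).
  apply/funext => s; apply/funext => y; apply/funext => t.
  rewrite [in X in _ = _ + X]big_ord_recl /= expr0 mulr1.
  by under [in X in _ = _ + X]eq_bigr => n _ do rewrite /bump /= add1n; ring.
apply: smoothD.
  apply: smooth_sum => n _; apply: smoothZ.
  apply: (@smooth_le k n.+1 th) => //; exact: smoothXn.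
apply: smooth_remainder => s hs; rewrite add1n.
have [C [r [C0 r0 h]]] : bigO 1 (z s) by case: k hz => [|k] [+ _]; apply.
exists (2 * C ^+ k.+1), (Num.min r (2 * (C + 1))^-1).
have Cp : 0 < 2 * (C + 1) by rewrite mulr_gt0 // ltr_wpDl.
split; first by rewrite mulr_ge0 // exprn_ge0.
  by rewrite lt_min r0 invr_gt0.
move=> y t cy /andP[t0]; rewrite le_min => /andP[tr tC].
have hz1 : `|z s y t| <= C * t by rewrite -[t in leRHS]expr1; apply: h => //; rewrite t0.
have tC2 : 2 * (C + 1) * t <= 1.
  by rewrite -(ler_pM2l Cp) divff ?gt_eqF // in tC.
apply: le_trans (hf _ _ _) _; first by apply: le_trans hz1 _; lra.
rewrite -mulrA ler_wpM2l // -exprMn lerXn2r ?nnegrE // mulr_ge0 // ltW //.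
Qed.

Lemma smooth_iter k i th a : smooth k i th a -> forall j s, (j <= k)%N -> (j + th <= s)%N ->
  bigO (i + j) (iter j fdiff a s).
Proof.
elim: k i th a => [|k IH] i th a [h1 h2] [|j] s // jk js; rewrite ?addn0; try exact: h1.
rewrite iterSr addnS -addSn; apply: (IH _ _ _ h2) => //.
by rewrite addnS.
Qed.

End Smooth.

(** * Elementary series *)

Lemma sum_prod_dffun (R : comNzRingType) (I : finType) (T : I -> finType)
    (F : forall i, T i -> R) :
  \sum_(a : {dffun forall i, T i}) \prod_i F i (a i) = \prod_i \sum_(c : T i) F i c.
Proof.
rewrite (reindex (@dffun_of_fprod I T)) /=; last first.
  by apply: onW_bij; exact: dffun_of_fprod_bij.
pose P := (fun i => [ffun c => F i c]) : forall i, {ffun T i -> R}.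
transitivity (\sum_(t : fprod T) \prod_(i in I) P i (t i)).
  by apply: eq_bigr => t _; apply: eq_bigr => i _; rewrite !ffunE.
rewrite big_fprod; apply: etrans (esym (bigA_distr_big_dep (fun i j => j \in tagged_with T i) (fun i => untag 0 (P i)))) _; apply: eq_bigr => i _.
by apply: etrans (esym (big_tag (fun i => P i) i)) _; apply: eq_bigr => c _; rewrite ffunE.
Qed.

Section ExpSeries.
Variable R : realType.

Lemma tail_geometric (z : R) M N : `|z| <= 2^-1 -> (M <= N)%N ->
  \sum_(M <= n < N) `|z| ^+ n <= 2 * `|z| ^+ M.
Proof.
move=> hz MN; rewrite -{1}[M]add0n big_addn big_mkord.
under eq_bigr => n _ do rewrite exprD.
by rewrite -mulr_suml ler_wpM2r ?exprn_ge0 // geometric_sum_le.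
Qed.

Lemma expR_unit_series : unit_series (@expR R) (fun n => n`!%:R^-1).
Proof.
split=> [n|z hz M].
  by rewrite normfV normr_nat invf_le1 ?ltr0n ?fact_gt0 // ler1n fact_gt0.
apply/ler_addgt0Pl => e e0.
have /cvgrPdist_le/(_ e e0) [N _ hN] := is_cvg_series_exp_coeff z.
pose K := maxn N M.
have h1 := hN K (leq_maxl _ _).
have -> : expR z - \sum_(n < M) n`!%:R^-1 * z ^+ n =
   (expR z - series (exp_coeff z) K) + \sum_(M <= k < K) k`!%:R^-1 * z ^+ k.
  rewrite exp_coeffE /series /= (big_cat_nat (n := M)) ?leq_maxr //= big_mkord.
  by rewrite opprD addrA subrK.
apply: le_trans (ler_normD _ _) _; apply: lerD; first exact: h1.
apply: le_trans _ (tail_geometric hz (leq_maxr N M)).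
apply: le_trans (ler_norm_sum _ _ _) _; apply: ler_sum => k _.
rewrite normrM normrX ler_piMl ?exprn_ge0 //.
by rewrite normfV normr_nat invf_le1 ?ltr0n ?fact_gt0 // ler1n fact_gt0.
Qed.

Lemma inv_unit_series : unit_series (fun z : R => (1 + z)^-1) (fun n => (-1) ^+ n).
Proof.
split=> [n|z hz M]; first by rewrite normrX normrN1 expr1n.
have h1 : 2^-1 <= 1 + z.
  by have := ler_norm (- z); rewrite normrN; lra.
have zp : 0 < 1 + z by apply: lt_le_trans h1; rewrite invr_gt0.
under eq_bigr => n _ do rewrite -exprMn mulN1r.
have hs : \sum_(n < M) (- z) ^+ n = (1 - (- z) ^+ M) / (1 + z).
  by rewrite -opprB subrX1; field; rewrite gt_eqF.
have -> : (1 + z)^-1 - \sum_(n < M) (- z) ^+ n = (- z) ^+ M / (1 + z).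
  by rewrite hs; ring.
rewrite normrM normrX normrN normfV.
rewrite mulrC ler_wpM2r ?exprn_ge0 // gtr0_norm //.
by rewrite -[leRHS]invrK lef_pV2 // posrE invr_gt0.
Qed.

End ExpSeries.

(** * The dynamics as an analytic map *)

Section Dynamics.
Variables (R : realType) (n : nat) (d : 'I_n -> nat).
Notation fn := ((nat -> R) -> R -> R).
Notation vecs := (vectors R d).

Definition entry : finType := {j : 'I_n & 'I_(d j)}.
(** The entries of the loss table are variables like the others, so a single ideal argument covers
    all games with the given action counts. *)
Definition slot : finType := (entry + entry + joint_action d * 'I_n)%type.
Definition slot_index (v : slot) : nat := enum_rank v.

Lemma slot_index_lt v : (slot_index v < #|slot|)%N.
Proof. exact: ltn_ord. Qed.

Definition strategy_of (y : nat -> R) : vecs :=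
  fun j a => y (slot_index (inl (inl (existT (fun j => 'I_(d j)) j a)))).
Definition previous_of (y : nat -> R) : vecs :=
  fun j a => y (slot_index (inl (inr (existT (fun j => 'I_(d j)) j a)))).
Definition table_of (y : nat -> R) : joint_action d -> 'I_n -> R :=
  fun a i => y (slot_index (inr (a, i))).

(** Indices beyond the slots receive 0, which keeps the code inside the cube. *)
Definition encode (x u : vecs) (l : joint_action d -> 'I_n -> R) (m : nat) : R :=
  if insub m is Some o then
    match enum_val (o : 'I_#|slot|) with
    | inl (inl e) => x (tag e) (tagged e)
    | inl (inr e) => u (tag e) (tagged e)
    | inr al => l al.1 al.2
    end
  else 0.

Lemma encode_slot_index x u l v : encode x u l (slot_index v) = match v with
    | inl (inl e) => x (tag e) (tagged e)
    | inl (inr e) => u (tag e) (tagged e)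
    | inr al => l al.1 al.2
    end.
Proof.
by rewrite /encode /slot_index (valK (enum_rank v)) enum_rankK.
Qed.

Lemma encode_strategy x u l : strategy_of (encode x u l) = x.
Proof.
by apply: functional_extensionality_dep => j; apply/funext => a; rewrite /strategy_of encode_slot_index.
Qed.

Lemma encode_previous x u l : previous_of (encode x u l) = u.
Proof.
by apply: functional_extensionality_dep => j; apply/funext => a; rewrite /previous_of encode_slot_index.
Qed.

Lemma encode_table x u l : table_of (encode x u l) = l.
Proof. by apply/funext => a; apply/funext => i; rewrite /table_of encode_slot_index. Qed.

Lemma encode_cube x u l : (forall j a, 0 <= x j a <= 1) -> (forall j a, 0 <= u j a <= 1) ->
  (forall a i, 0 <= l a i <= 1) -> cube (encode x u l).
Proof.
move=> hx hu hl m; rewrite /encode; case: insub => [k|]; last by rewrite lexx ler01.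
by case: (enum_val k) => [[e|e]|[a i]].
Qed.

Definition growth (eta : R) (cur prev : vecs) : vecs :=
  fun i a => expR (- (eta * (2 * cur i a - prev i a))).

Definition mean_growth (eta : R) (x cur prev : vecs) (i : 'I_n) : R :=
  \sum_(b < d i) x i b * (growth eta cur prev b - 1).

(* The update [hedge_step] with [1] instead of the total mass of [x i]: the two agree
   on mixed strategies, and this one is analytic on the whole cube. *)
Definition analytic_step (eta : R) (x cur prev : vecs) : vecs := fun i a =>
  x i a + x i a * (growth eta cur prev a - 1 - mean_growth eta x cur prev i) *
          (1 + mean_growth eta x cur prev i)^-1.

Arguments analytic_step : clear implicits.

Lemma hedge_step_analytic eta x cur prev : (forall i, \sum_(b < d i) x i b = 1) ->
  (forall i a, 0 <= x i a) ->
  hedge_step eta x cur prev = analytic_step eta x cur prev.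
Proof.
move=> x1 x0; apply: functional_extensionality_dep => i; apply/funext => a.
have E : 1 + mean_growth eta x cur prev i = \sum_(b < d i) x i b * growth eta cur prev b.
  rewrite -(x1 i) -big_split /=; apply: eq_bigr => b _; ring.
have Z0 : 0 < \sum_(b < d i) x i b * growth eta cur prev b.
  rewrite lt_neqAle sumr_ge0 ?andbT; last by move=> b _; rewrite mulr_ge0 ?expR_ge0.
  apply/eqP => /esym/psumr_eq0P h.
  have := x1 i; rewrite big1 => [/eqP|b _]; first by rewrite eq_sym oner_eq0.
  have /eqP := h (fun b _ => mulr_ge0 (x0 i b) (expR_ge0 _)) b isT.
  by rewrite mulf_eq0 (gt_eqF (expR_gt0 _)) orbF => /eqP.
rewrite /hedge_step /analytic_step E.
have -> : growth eta cur prev a - 1 - mean_growth eta x cur prev i =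
   growth eta cur prev a - \sum_(b < d i) x i b * growth eta cur prev b.
  by rewrite -E; ring.
rewrite -/(growth eta cur prev a) -/(\sum_(b < d i) x i b * growth eta cur prev b).
by field; rewrite gt_eqF.
Qed.

Fixpoint orbit (s : nat) (y : nat -> R) (eta : R) : vecs * vecs :=
  if s is s'.+1 then
    let: (x, prev) := orbit s' y eta in
    let cur := expected_loss (table_of y) x in
    (analytic_step eta x cur prev, cur)
  else (strategy_of y, previous_of y).

Definition orbit_x i a (s : nat) : fn := fun y t => (orbit s y t).1 i a.
Definition orbit_u i a (s : nat) : fn := fun y t => (orbit s y t).2 i a.

Arguments orbit_x : clear implicits.
Arguments orbit_u : clear implicits.

Lemma orbit_uS i a s y t : orbit_u i a s.+1 y t =
  expected_loss (table_of y) (fun j b => orbit_x j b s y t) i a.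
Proof. by rewrite /orbit_u /orbit_x /=; case: (orbit s y t). Qed.

Lemma orbit_xS i a s y t : orbit_x i a s.+1 y t =
  analytic_step t (fun j b => orbit_x j b s y t) (fun j b => orbit_u j b s.+1 y t)
    (fun j b => orbit_u j b s y t) i a.
Proof. by rewrite /orbit_u /orbit_x /=; case: (orbit s y t). Qed.

(** The index [s.+1] skips the free preceding loss at index 0: every loss used here is computed from
    strategies, so the gap itself has no delay. *)
Definition gap (i : 'I_n) (a b : 'I_(d i)) (s : nat) : fn :=
  fun y t => orbit_u i a s.+1 y t - orbit_u i b s.+1 y t.

Section Analyticity.
Variable g : noeth_ring R #|slot|.

(** Both [growth - 1] and its mean are [O(t)], so the series of the exponential and of [1 / (1 + z)]
    can be substituted over the whole cube, even where [x] is not a mixed strategy. *)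
Lemma orbit_analytic s : (forall i a, analytic g (orbit_x i a s)) /\
  (forall i a, analytic g (orbit_u i a s)).
Proof.
have hl (x : forall i, 'I_(d i) -> fn) : (forall i a, analytic g (x i a)) ->
    forall i a, analytic g (fun y t => expected_loss (table_of y) (fun j b => x j b y t) i a).
  move=> hx i a; apply: analytic_sum => c _; apply: analyticM.
    exact: analytic_var (slot_index_lt _).
  by apply: analytic_prod => j _; apply: hx.
elim: s => [|s [hx hu]].
  by split=> i a; apply: analytic_var; apply: slot_index_lt.
have hu' i a : analytic g (orbit_u i a s.+1).
  apply: analytic_ext (hl _ hx i a); exists 1 => // y t _ _; by rewrite orbit_uS.
split=> // i a.
pose z j b : fn := fun y t => - (t * (2 * orbit_u j b s.+1 y t - orbit_u j b s y t)).
have hw j b : analytic g (fun y t => 2 * orbit_u j b s.+1 y t - orbit_u j b s y t).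
  by apply: analyticB => //; apply: analyticM => //; apply: analytic_const.
have hz j b : analytic g (z j b).
  by apply: analyticN; apply: analyticM; [exact: analytic_param|exact: hw].
have z1 j b : bigO 1 (z j b).
  by apply: bigON; apply: (bigOM (m := 1) (m' := 0)); [exact: bigO_param|exact: analytic_bigO0 (hw j b)].
pose e j b : fn := fun y t => expR (z j b y t) - 1.
have he j b : analytic g (e j b).
  apply: analyticB; last exact: analytic_const.
  exact: analytic_comp (expR_unit_series R) (hz j b) (z1 j b).
have e1 j b : bigO 1 (e j b).
  have := smooth_comp (expR_unit_series R) (smooth_stationary 0 0 (z1 j b)).
  rewrite fact0 invr1 => -[h _]; exact: (h 0%N).
pose m : fn := fun y t => \sum_(b < d i) orbit_x i b s y t * e i b y t.
have hm : analytic g m by apply: analytic_sum => b _; apply: analyticM.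
have m1 : bigO 1 m.
  have := @smooth_sum R _ (index_enum 'I_(d i)) xpredT 0 1 0 (fun b (_ : nat) y t => orbit_x i b s y t * e i b y t).
  case=> [b _|h _]; last exact: (h 0%N).
  apply: smooth_stationary; apply: (bigOM (m := 0) (m' := 1)) => //.
  exact: analytic_bigO0 (hx i b).
have hi : analytic g (fun y t => (1 + m y t)^-1).
  exact: analytic_comp (inv_unit_series R) hm m1.
have : analytic g (fun y t => orbit_x i a s y t + orbit_x i a s y t * (e i a y t - m y t) * (1 + m y t)^-1).
  by apply: analyticD => //; apply: analyticM => //; apply: analyticM => //; apply: analyticB.
by apply: analytic_ext; exists 1 => // y t _ _; rewrite orbit_xS.
Qed.

Lemma gap_analytic i a b s : analytic g (@gap i a b s).
Proof. by apply: analyticB; have [_] := orbit_analytic s.+1; apply. Qed.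

Lemma loss_smooth k th (x : forall i, 'I_(d i) -> nat -> fn) :
  (forall i a, smooth k 0 th (x i a)) ->
  forall i a, smooth k 0 th (fun s y t => expected_loss (table_of y) (fun j b => x j b s y t) i a).
Proof.
move=> hx i a; apply: smooth_sum => c _; rewrite -[0%N]addn0; apply: smoothM.
  apply: smooth_stationary; exact: analytic_bigO0 (analytic_var g (slot_index_lt (inr (c, i)))).
by apply: smooth_prod => j _; apply: hx.
Qed.

(** One round moves a strategy by [t] times a smooth function of the strategies and of two
    consecutive losses, so each difference gains one order. The preceding loss among them accounts
    for one round of delay per difference. *)
Lemma orbit_x_smooth k i a : smooth k 0 0 (orbit_x i a).
Proof.
have h0 i' a' s : bigO 0 (orbit_x i' a' s).
  by have [h _] := orbit_analytic s; apply: analytic_bigO0 (h i' a').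
elim: k i a => [|k IH] i a; split=> //.
have hcur j b : smooth k 0 0 (fun s => orbit_u j b s.+1).
  have := loss_smooth IH b; congr smooth.
  by apply/funext => s; apply/funext => y; apply/funext => t; rewrite orbit_uS.
have hcur1 j b : smooth k 0 1 (fun s => orbit_u j b s.+1) by apply: smooth_le (hcur j b).
have hprev j b : smooth k 0 1 (orbit_u j b) by apply: smooth_back (hcur j b).
have hx j b : smooth k 0 1 (orbit_x j b) by apply: smooth_le (IH j b).
pose z j b : nat -> fn := fun s y t => - (t * (2 * orbit_u j b s.+1 y t - orbit_u j b s y t)).
have hz j b : smooth k 1 1 (z j b).
  apply: smoothN; apply: (smoothM (i := 1) (i' := 0)).
    by apply: smooth_stationary; apply: bigO_param.
  by apply: smoothD; [exact: smoothZ|exact: smoothN].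
pose e j b : nat -> fn := fun s y t => expR (z j b s y t) - 1.
have he j b : smooth k 1 1 (e j b).
  by have := smooth_comp (expR_unit_series R) (hz j b); rewrite fact0 invr1.
pose m : nat -> fn := fun s y t => \sum_(b < d i) orbit_x i b s y t * e i b s y t.
have hm : smooth k 1 1 m.
  by apply: smooth_sum => b _; apply: (smoothM (i := 0) (i' := 1)).
have hi : smooth k 0 1 (fun s y t => (1 + m s y t)^-1).
  have -> : (fun s y t => (1 + m s y t)^-1) = (fun s y t => ((1 + m s y t)^-1 - 1) + 1).
    by apply/funext => s; apply/funext => y; apply/funext => t; rewrite subrK.
  apply: smoothD; last by apply: smooth_stationary; apply: bigO_const; right.
  by have := smooth_comp (inv_unit_series R) hm; rewrite expr0; apply: smooth_le.
have : smooth k 1 1 (fun s y t => orbit_x i a s y t * (e i a s y t - m s y t) * (1 + m s y t)^-1).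
  apply: (smoothM (i := 1) (i' := 0)) => //; apply: (smoothM (i := 0) (i' := 1)) => //.
  by apply: smoothD => //; apply: smoothN.
congr smooth; apply/funext => s; apply/funext => y; apply/funext => t.
by rewrite /fdiff orbit_xS /analytic_step [in RHS]addrAC subrr add0r.
Qed.

Lemma gap_smooth k i a b : smooth k 0 0 (@gap i a b).
Proof.
have h c : smooth k 0 0 (fun s => orbit_u i c s.+1).
  have := loss_smooth (orbit_x_smooth k) c; congr smooth.
  by apply/funext => s; apply/funext => y; apply/funext => t; rewrite orbit_uS.
by apply: smoothD => //; apply: smoothN.
Qed.

End Analyticity.

Lemma gap_difference_bigO i a b k s : (k <= s)%N -> bigO k (iter k (@fdiff R) (@gap i a b) s).
Proof.
move=> ks; have := smooth_iter (gap_smooth (noeth_ring_ex R _) k a b) (leqnn k).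
by rewrite addn0; apply.
Qed.

(** The [k]-th difference is taken at index [k] because only from there on is it known to be
    [O(t ^ k)]: earlier ones may involve the arbitrary preceding loss. *)
Lemma gap_recurrence i a b : exists N C r, [/\ 0 <= C, 0 < r &
  forall y t, cube y -> 0 < t <= r ->
    `|iter N (@fdiff R) (@gap i a b) N y t| / t ^+ N <=
    C * \sum_(k < N) `|iter k (@fdiff R) (@gap i a b) k y t| / t ^+ k].
Proof.
have g := noeth_ring_ex R #|slot|.
have an_iter k s : analytic g (iter k (@fdiff R) (@gap i a b) s).
  elim: k s => [|k IH] s /=; first exact: gap_analytic.
  exact: analyticB (IH s.+1) (IH s).
have [|N [C [r [C0 r0 h]]]] := @analytic_chain _ _ g
    (fun k y t => iter k (@fdiff R) (@gap i a b) k y t / t ^+ k).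
  by move=> k; apply: analytic_divn => //; apply: gap_difference_bigO.
exists N, C, r; split=> // y t cy ht; have t0 : 0 < t by case/andP: ht.
have E k : `|iter k (@fdiff R) (@gap i a b) k y t / t ^+ k| =
    `|iter k (@fdiff R) (@gap i a b) k y t| / t ^+ k.
  by rewrite normrM normfV normrX (gtr0_norm t0).
by have := h y t cy ht; rewrite E; under eq_bigr => k _ do rewrite E.
Qed.

End Dynamics.

(** * Interpolation between finite differences *)

Section SlowSequences.
Variable R : realType.
Variables (N : nat) (C Cb c : R).
Hypotheses (C0 : 0 <= C) (Cb0 : 0 <= Cb) (c0 : 0 <= c).

(** To be read with [H k] the [k]-th difference of a loss gap divided by [eta ^ k] and [w] the
    product of two probabilities. The staggered indices are those of [gap_recurrence]. *)
Record slow (eta : R) (H : nat -> nat -> R) (w : nat -> R) : Prop := Slow {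
  slow_diff : forall k t, H k t.+1 = H k t + eta * H k.+1 t;
  slow_bound : forall k t, (k <= N)%N -> (k < t)%N -> `|H k t| <= Cb;
  slow_rec : forall t, (0 < t)%N -> `|H N (t + N)%N| <= C * \sum_(k < N) `|H k (t + k)%N|;
  slow_w : forall t, 0 <= w t <= 1;
  slow_dw : forall t, `|w t.+1 - w t| <= c * eta * w t }.

(** Summation starts where [slow_bound] holds for all orders up to [N]. *)
Definition energy (H : nat -> nat -> R) (w : nat -> R) T k : R :=
  \sum_(N.+1 <= t < T) w t * H k t ^+ 2.

Lemma energy_ge0 eta H w T k : slow eta H w -> 0 <= energy H w T k.
Proof.
move=> s; apply: sumr_ge0 => t _; rewrite mulr_ge0 ?sqr_ge0 //.
by have /andP[] := slow_w s t.
Qed.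

(* Discrete integration by parts in one term: [w h1 h0] telescopes. *)
Lemma interpolation_term e d (h0 h1 h2 u u' : R) : 0 < e -> 0 < d ->
  c * e <= 2^-1 -> 0 <= u -> `|u' - u| <= c * e * u ->
  u * h1 ^+ 2 <= 4 / e * (u' * (h1 + e * h2) * (h0 + e * h1) - u * h1 * h0)
    + (8 * c ^+ 2 + 8 / d) * (u * h0 ^+ 2) + (2 * d + 32 * e ^+ 2) * (u * h2 ^+ 2).
Proof.
move=> e0 d0 ce u0 hu.
have ceu : c * e * u <= u / 2 by rewrite mulrC ler_wpM2l.
have hu1 : u' - u <= c * e * u := le_trans (ler_norm _) hu.
have hu2 : u - u' <= c * e * u.
  by apply: le_trans hu; rewrite distrC; apply: ler_norm.
have u'l : u <= 2 * u' by lra.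
have u'u : u' <= 2 * u by lra.
have u'0 : 0 <= u' by lra.
have q1 : - (u' - u) * (h1 * h0) <= c * e * u * (`|h1| * `|h0|).
  apply: le_trans (ler_norm _) _; rewrite normrM normrN normrM.
  by rewrite ler_wpM2r // mulr_ge0.
have q2 : - (u' * (h2 * h0)) <= 2 * u * (`|h2| * `|h0|).
  apply: le_trans (ler_norm _) _; rewrite normrN normrM normrM (ger0_norm u'0).
  by rewrite ler_wpM2r // mulr_ge0.
have q3 : - (u' * (h2 * h1)) <= 2 * u * (`|h2| * `|h1|).
  apply: le_trans (ler_norm _) _; rewrite normrN normrM normrM (ger0_norm u'0).
  by rewrite ler_wpM2r // mulr_ge0.
have n0 := real_normK (num_real h0); have n1 := real_normK (num_real h1).
have n2 := real_normK (num_real h2).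
set a0 := `|h0| in n0 q1 q2 q3 *; set a1 := `|h1| in n1 q1 q2 q3 *.
set a2 := `|h2| in n2 q1 q2 q3 *.
have s1 : 2 * c * (a1 * a0) <= h1 ^+ 2 / 4 + 4 * c ^+ 2 * h0 ^+ 2.
  rewrite -n1 -n0; have := sqr_ge0 (a1 / 2 - 2 * c * a0); nra.
have s2 : 4 * (a2 * a0) <= d * h2 ^+ 2 + 4 / d * h0 ^+ 2.
  rewrite -n2 -n0; have : 0 <= (d * a2 - 2 * a0) ^+ 2 / d by rewrite divr_ge0 ?sqr_ge0 // ltW.
  have -> : (d * a2 - 2 * a0) ^+ 2 / d = d * a2 ^+ 2 + 4 / d * a0 ^+ 2 - 4 * (a2 * a0).
    by field; rewrite gt_eqF.
  by rewrite subr_ge0.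
have s3 : 4 * e * (a2 * a1) <= h1 ^+ 2 / 4 + 16 * e ^+ 2 * h2 ^+ 2.
  rewrite -n1 -n2; have := sqr_ge0 (a1 / 2 - 4 * e * a2); nra.
set Q := u' * (h1 + e * h2) * (h0 + e * h1) - u * h1 * h0.
have EQ : e * u' * h1 ^+ 2 = Q + - (u' - u) * (h1 * h0) + e * - (u' * (h2 * h0)) + e * e * - (u' * (h2 * h1)).
  by rewrite /Q; ring.
have P1 : e * (u * h1 ^+ 2) <= 2 * Q + e * u * (2 * c * (a1 * a0)) + e * u * (4 * (a2 * a0)) + e * u * (4 * e * (a2 * a1)).
  have h : e * u * h1 ^+ 2 <= 2 * (e * u' * h1 ^+ 2).
    have -> : 2 * (e * u' * h1 ^+ 2) = e * (2 * u') * h1 ^+ 2 by ring.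
    by rewrite ler_wpM2r ?sqr_ge0 // ler_wpM2l // ltW.
  have q2' := ler_wpM2l (ltW e0) q2.
  have q3' := ler_wpM2l (ltW (mulr_gt0 e0 e0)) q3.
  rewrite EQ in h.
  have -> : e * (u * h1 ^+ 2) = e * u * h1 ^+ 2 by ring.
  apply: le_trans h _.
  have -> : 2 * Q + e * u * (2 * c * (a1 * a0)) + e * u * (4 * (a2 * a0)) + e * u * (4 * e * (a2 * a1)) =
   2 * (Q + c * e * u * (a1 * a0) + e * (2 * u * (a2 * a0)) + e * e * (2 * u * (a2 * a1))) by ring.
  lra.
have eu0 : 0 <= e * u by rewrite mulr_ge0 // ltW.
have s1' := ler_wpM2l eu0 s1; have s2' := ler_wpM2l eu0 s2; have s3' := ler_wpM2l eu0 s3.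
have P2 : e * (u * h1 ^+ 2) <= 4 * Q + e * ((8 * c ^+ 2 + 8 / d) * (u * h0 ^+ 2) + (2 * d + 32 * e ^+ 2) * (u * h2 ^+ 2)).
  have -> : 4 * Q + e * ((8 * c ^+ 2 + 8 / d) * (u * h0 ^+ 2) + (2 * d + 32 * e ^+ 2) * (u * h2 ^+ 2)) =
    4 * Q + 2 * (e * u * (4 * c ^+ 2 * h0 ^+ 2) + e * u * (d * h2 ^+ 2 + 4 / d * h0 ^+ 2) + e * u * (16 * e ^+ 2 * h2 ^+ 2)) by ring.
  lra.
rewrite -(ler_pM2l e0); apply: le_trans P2 _; rewrite /Q.
by rewrite le_eqVlt; apply/orP; left; apply/eqP; field; rewrite (gt_eqF e0) (gt_eqF d0).
Qed.

(** A discrete Landau inequality: a derivative is controlled by its two neighbours. The telescoping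
    terms leave [4 / eta] times at most [2 * Cb ^+ 2], the origin of [b / eta]. *)
Lemma interpolation k eps : (k.+2 <= N)%N -> 0 < eps -> exists a b e0,
  [/\ 0 <= a, 0 <= b, 0 < e0 & forall eta H w T, 0 < eta <= e0 -> slow eta H w ->
    energy H w T k.+1 <= a * energy H w T k + eps * energy H w T k.+2 + b / eta].
Proof.
move=> kN ep; pose d := eps / 4; have d0 : 0 < d by rewrite divr_gt0.
exists (8 * c ^+ 2 + 8 / d), (8 * Cb ^+ 2).
(* The second bound ensures [c * e <= 2^-1]; the first and third give [32 * e ^+ 2 <= eps / 2], the
   other half of [eps] being [2 * d]. *)
exists (Num.min 1 (Num.min (2 * (c + 1))^-1 (eps / 64))).
split.
- by rewrite addr_ge0 // ?divr_ge0 ?mulr_ge0 ?sqr_ge0 // ltW.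
- by rewrite mulr_ge0 // sqr_ge0.
- by rewrite !lt_min ltr01 invr_gt0 mulr_gt0 ?divr_gt0 // ltr_wpDl.
move=> e H w T /andP[e0]; rewrite !le_min => /and3P[e1 ec ee] s.
have ce : c * e <= 2^-1.
  have cp : 0 < 2 * (c + 1) by rewrite mulr_gt0 // ltr_wpDl.
  have : 2 * (c + 1) * e <= 1 by rewrite -(ler_pM2l cp) divff ?gt_eqF // in ec.
  lra.
have e2 : 2 * d + 32 * e ^+ 2 <= eps.
  have : e ^+ 2 <= e * 1 by rewrite expr2 ler_wpM2l // ltW.
  rewrite /d; lra.
have wp t : 0 <= w t by have /andP[] := slow_w s t.
pose Q t := w t * H k.+1 t * H k t.
have term t : w t * H k.+1 t ^+ 2 <= 4 / e * (Q t.+1 - Q t)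
    + (8 * c ^+ 2 + 8 / d) * (w t * H k t ^+ 2) + eps * (w t * H k.+2 t ^+ 2).
  apply: le_trans (interpolation_term (H k t) (H k.+1 t) (H k.+2 t) e0 d0 ce (wp t) (slow_dw s t)) _.
  rewrite /Q !(slow_diff s); apply: lerD => //.
  by rewrite ler_wpM2r // mulr_ge0 ?sqr_ge0.
apply: le_trans (ler_sum _ (fun t _ => term t)) _.
rewrite !big_split /= -!mulr_sumr -!/(energy _ _ _ _).
have Qb t : (N < t)%N -> `|Q t| <= Cb ^+ 2.
  move=> Nt; rewrite /Q -mulrA normrM (ger0_norm (wp t)) -[leRHS]mul1r.
  apply: ler_pM => //; first by have /andP[] := slow_w s t.
  rewrite normrM expr2; apply: ler_pM => //; apply: (slow_bound s).
  - by apply: ltnW.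
  - by apply: leq_ltn_trans Nt; apply: ltnW.
  - by apply: ltnW; apply: ltnW.
  - by apply: leq_ltn_trans Nt; apply: ltnW; apply: ltnW.
have hQ : 4 / e * (\sum_(N.+1 <= t < T) (Q t.+1 - Q t)) <= 8 * Cb ^+ 2 / e.
  case: (leqP N.+1 T) => NT; last first.
    by rewrite big_geq 1?ltnW // mulr0 divr_ge0 ?mulr_ge0 ?sqr_ge0 // ltW.
  rewrite telescope_sumr //.
  have h1 : Q T - Q N.+1 <= 2 * Cb ^+ 2.
    apply: le_trans (ler_norm _) _; apply: le_trans (ler_normB _ _) _.
    by have := Qb T NT; have := Qb N.+1 (ltnSn N); lra.
  have -> : 8 * Cb ^+ 2 / e = 4 / e * (2 * Cb ^+ 2) by ring.
  by rewrite ler_wpM2l // divr_ge0 // ltW.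
lra.
Qed.

Definition controlled k k' eps : Prop := exists a b e0,
  [/\ 0 <= a, 0 <= b, 0 < e0 & forall eta H w T, 0 < eta <= e0 -> slow eta H w ->
    energy H w T k <= a * energy H w T 0 + eps * energy H w T k' + b / eta].

(** Interpolation bounds order [k.+1] by orders [k] and [k.+2]. The induction hypothesis at [k],
    with parameter [(2 * (a + 1))^-1], brings back at most half of the left side, which is absorbed;
    this doubles the other terms. *)
Lemma controlled_next k eps : (k < N)%N -> 0 < eps -> controlled k k.+1 eps.
Proof.
elim: k eps => [|k IH] eps kN ep.
  exists 1, 0, 1; split=> // eta H w T _ s; have := energy_ge0 T 1 s.
  by move=> h; rewrite mul0r addr0 mul1r lerDl mulr_ge0 // ltW.
have [|a [b [e0 [a0 b0 e00 h]]]] := @interpolation k (eps / 2) kN; first by rewrite divr_gt0.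
have a1 : 0 < 2 * (a + 1) by rewrite mulr_gt0 // ltr_wpDl.
have [||a' [b' [e0' [a0' b0' e00' h']]]] := IH (2 * (a + 1))^-1.
- exact: ltnW.
- by rewrite invr_gt0.
exists (2 * (a * a')), (2 * (a * b' + b)), (Num.min e0 e0'); split.
- by rewrite !mulr_ge0.
- by rewrite mulr_ge0 // addr_ge0 // mulr_ge0.
- by rewrite lt_min e00.
move=> eta H w T /andP[ep0]; rewrite le_min => /andP[el el'] s.
have h1 := h eta H w T; rewrite ep0 el in h1; have {}h1 := h1 isT s.
have h2 := h' eta H w T; rewrite ep0 el' in h2; have {}h2 := h2 isT s.
have h3 := ler_wpM2l a0 h2.
have E1 := energy_ge0 T k.+1 s.
have h4 : a * ((2 * (a + 1))^-1 * energy H w T k.+1) <= energy H w T k.+1 / 2.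
  rewrite mulrA mulrC ler_wpM2l // -(ler_pM2r a1) mulfVK ?gt_eqF //.
  lra.
set X := energy H w T k.+1 in h1 h2 h3 h4 *.
have -> : 2 * (a * b' + b) / eta = 2 * (a * (b' / eta) + b / eta) by ring.
set z := (2 * (a + 1))^-1 in h3 h4; rewrite !mulrDr in h3; lra.
Qed.

Lemma controlled_later j k eps : (k < N)%N -> (k + j.+1 <= N)%N -> 0 < eps ->
  controlled k (k + j.+1) eps.
Proof.
elim: j eps => [|j IH] eps kN kj ep.
  by rewrite addn1; apply: controlled_next.
have [|a [b [e0 [a0 b0 e00 h]]]] := IH eps kN _ ep.
  by apply: leq_trans kj; rewrite leq_add2l.
have [|a' [b' [e0' [a0' b0' e00' h']]]] := @controlled_next (k + j.+1) 1 _ ltr01.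
  by rewrite -addnS.
exists (a + eps * a'), (b + eps * b'), (Num.min e0 e0'); split.
- by rewrite addr_ge0 // mulr_ge0 // ltW.
- by rewrite addr_ge0 // mulr_ge0 // ltW.
- by rewrite lt_min e00.
move=> eta H w T /andP[ep0]; rewrite le_min => /andP[el el'] s.
have h1 := h eta H w T; rewrite ep0 el in h1; have {}h1 := h1 isT s.
have h2 := h' eta H w T; rewrite ep0 el' in h2; have {}h2 := h2 isT s.
have h3 := ler_wpM2l (ltW ep) h2; rewrite addnS.
rewrite !mulrDr mul1r in h3.
have -> : (b + eps * b') / eta = b / eta + eps * (b' / eta) by ring.
lra.
Qed.

Lemma controlled_sum m eps : (m <= N)%N -> 0 < eps -> exists a b e0,
  [/\ 0 <= a, 0 <= b, 0 < e0 & forall eta H w T, 0 < eta <= e0 -> slow eta H w ->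
    \sum_(k < m) energy H w T k <= a * energy H w T 0 + eps * energy H w T N + b / eta].
Proof.
elim: m eps => [|m IH] eps mN ep.
  exists 0, 0, 1; split=> // eta H w T _ s.
  by rewrite big_ord0 !mul0r add0r addr0 mulr_ge0 ?(energy_ge0 _ _ s) // ltW.
have ep2 : 0 < eps / 2 by rewrite divr_gt0.
have [a [b [e0 [a0 b0 e00 h]]]] := IH (eps / 2) (ltnW mN) ep2.
have [|a' [b' [e0' [a0' b0' e00' h']]]] := @controlled_later (N - m.+1) m (eps / 2) mN _ ep2.
  by rewrite addnS -addSn subnKC.
exists (a + a'), (b + b'), (Num.min e0 e0'); split; rewrite ?addr_ge0 // ?lt_min ?e00 //.
move=> eta H w T /andP[ep0]; rewrite le_min => /andP[el el'] s.
have h1 := h eta H w T; rewrite ep0 el in h1; have {}h1 := h1 isT s.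
have h2 := h' eta H w T; rewrite ep0 el' addnS -addSn subnKC // in h2; have {}h2 := h2 isT s.
rewrite big_ord_recr /=; rewrite !mulrDl; lra.
Qed.

Lemma sqr_sum_le m (f : 'I_m -> R) : (\sum_(k < m) f k) ^+ 2 <= 2 ^+ m * \sum_(k < m) f k ^+ 2.
Proof.
elim: m f => [|m IH] f; first by rewrite !big_ord0 expr0n mulr0.
rewrite !big_ord_recr /= mulrDr (exprS 2 m); set S := \sum_(k < m) f _.
have h := IH (fun k => f (widen_ord (leqnSn m) k)); rewrite -/S in h.
have h1 : 1 <= 2 ^+ m :> R by rewrite exprn_ege1 // ler1n.
have h2 : (S + f ord_max) ^+ 2 <= 2 * S ^+ 2 + 2 * f ord_max ^+ 2.
  by have := sqr_ge0 (S - f ord_max); nra.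
have h3 : f ord_max ^+ 2 <= 2 ^+ m * f ord_max ^+ 2 by rewrite ler_peMl ?sqr_ge0.
by apply: le_trans h2 _; rewrite -!mulrA; lra.
Qed.

(** The shifted range begins at [k.+1], where [phi] is already bounded, and contains at most [j]
    indices below [N.+1]. *)
Lemma sum_delayed (phi : nat -> R) B k j T : (k + j = N)%N -> 0 <= B ->
  (forall t, 0 <= phi t) -> (forall t, (k < t)%N -> phi t <= B) ->
  \sum_(N.+1 <= t < T) phi (t - j)%N <= \sum_(N.+1 <= t < T) phi t + j%:R * B.
Proof.
move=> kjN B0 phi0 phiB; case: (leqP N.+1 T) => NT; last first.
  by rewrite !big_geq 1?ltnW // add0r mulr_ge0.
rewrite -{1}kjN -addSn big_addn.
under eq_bigr => t _ do rewrite addnK.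
apply: le_trans (_ : \sum_(k.+1 <= t < T) phi t <= _).
  case: (leqP k.+1 (T - j)) => kT; last by rewrite big_geq 1?ltnW ?sumr_ge0.
  rewrite [leRHS](big_cat_nat (n := T - j)) ?leq_subr //=.
  by rewrite lerDl sumr_ge0.
rewrite (big_cat_nat (n := N.+1)) //=; last by rewrite ltnS -kjN leq_addr.
rewrite addrC lerD2l; apply: le_trans (_ : \sum_(k.+1 <= t < N.+1) B <= _).
  by apply: ler_sum_nat => t /andP[kt _]; apply: phiB.
by rewrite sumr_const_nat -kjN subSS addKn mulr_natl.
Qed.

(** One factor [2 ^+ N] comes from squaring a sum of [N] terms, the other from moving the weight
    back by at most [N] rounds, in each of which it at most doubles. The delays [N - k] give the
    additive term. *)
Lemma energy_top eta H w T : slow eta H w -> c * eta <= 1 ->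
  energy H w T N <= C ^+ 2 * (4 ^+ N) * (\sum_(k < N) energy H w T k + (N * N)%:R * Cb ^+ 2).
Proof.
move=> s ce; have wp t : 0 <= w t by have /andP[] := slow_w s t.
have w2 t : w t.+1 <= 2 * w t.
  have h : c * eta * w t <= 1 * w t by rewrite ler_wpM2r.
  by have := le_trans (ler_norm _) (slow_dw s t); lra.
have w2n j t : w (t + j)%N <= 2 ^+ j * w t.
  elim: j => [|j IH]; first by rewrite addn0 mul1r.
  rewrite addnS exprS; apply: le_trans (w2 _) _; rewrite -mulrA; lra.
have term t : (N < t)%N -> w t * H N t ^+ 2 <=
    C ^+ 2 * 4 ^+ N * \sum_(k < N) w (t - (N - k))%N * H k (t - (N - k))%N ^+ 2.
  move=> Nt; have t0 : (0 < t - N)%N by rewrite subn_gt0.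
  have := slow_rec s t0; rewrite subnK ?(ltnW Nt) // => h.
  have h2 : H N t ^+ 2 <= C ^+ 2 * (2 ^+ N * \sum_(k < N) H k (t - N + k)%N ^+ 2).
    rewrite -(real_normK (num_real (H N t))).
    apply: le_trans (_ : (C * \sum_(k < N) `|H k (t - N + k)%N|) ^+ 2 <= _).
      by rewrite lerXn2r ?nnegrE // mulr_ge0 // sumr_ge0.
    rewrite exprMn ler_wpM2l ?sqr_ge0 //; apply: le_trans (sqr_sum_le _) _.
    by under eq_bigr => k _ do rewrite real_normK ?num_real //.
  apply: le_trans (ler_wpM2l (wp t) h2) _.
  rewrite mulrCA -mulrA ler_wpM2l ?sqr_ge0 //.
  have -> : (4 : R) ^+ N = 2 ^+ N * 2 ^+ N by rewrite -exprMn -natrM.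
  rewrite mulrCA -mulrA ler_wpM2l ?exprn_ge0 // !mulr_sumr; apply: ler_sum => k _.
  have kN := ltnW (ltn_ord k).
  have -> : (t - N + k = t - (N - k))%N by rewrite subnBA // addnBAC // ltnW.
  rewrite mulrA ler_wpM2r ?sqr_ge0 //.
  have {1}-> : t = (t - (N - k) + (N - k))%N by rewrite subnK // (leq_trans (leq_subr _ _)) // ltnW.
  apply: le_trans (w2n _ _) _; rewrite ler_wpM2r //.
  by rewrite ler_weXn2l ?ler1n // leq_subr.
apply: le_trans (ler_sum_nat (fun t ht => term t (proj1 (andP ht)))) _.
rewrite -mulr_sumr ler_wpM2l ?mulr_ge0 ?sqr_ge0 ?exprn_ge0 //.
rewrite exchange_big /=.
apply: le_trans (_ : \sum_(k < N) (energy H w T k + N%:R * Cb ^+ 2) <= _); last first.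
  by rewrite big_split /= sumr_const card_ord natrM -(mulr_natl (N%:R * Cb ^+ 2)) mulrA.
apply: ler_sum => k _; have kN := ltnW (ltn_ord k).
apply: le_trans (@sum_delayed (fun t => w t * H k t ^+ 2) (Cb ^+ 2) k (N - k) T _ _ _ _) _.
- by rewrite subnKC.
- exact: sqr_ge0.
- by move=> t; rewrite mulr_ge0 ?sqr_ge0.
- move=> t kt; rewrite -[leRHS]mul1r ler_pM ?sqr_ge0 //; first by have /andP[] := slow_w s t.
  by rewrite -(real_normK (num_real _)) lerXn2r ?nnegrE // (slow_bound s).
by rewrite lerD2l ler_wpM2r ?sqr_ge0 // ler_nat leq_subr.
Qed.

End SlowSequences.

(** The loop closes: the recurrence bounds the top energy by the lower ones, and interpolation
    bounds these by the energy of order 0 plus a share [(2 * (F + 1))^-1] of the top one, small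
    enough to be absorbed. *)
Lemma slow_energy_bound (R : realType) N (C Cb c : R) : 0 <= C -> 0 <= Cb -> 0 <= c ->
  exists K b e0, [/\ 0 <= K, 0 <= b, 0 < e0 & forall eta H w T, 0 < eta <= e0 ->
    slow N C Cb c eta H w -> energy N H w T 1 <= K * energy N H w T 0 + b / eta].
Proof.
move=> C0 Cb0 c0.
pose F := C ^+ 2 * 4 ^+ N; have F0 : 0 <= F by rewrite mulr_ge0 ?sqr_ge0 ?exprn_ge0.
have F1 : 0 < 2 * (F + 1) by rewrite mulr_gt0 // ltr_wpDl.
have F1V : 0 < (2 * (F + 1))^-1 by rewrite invr_gt0.
have [a [b [e1 [a0 b0 e10 hsum]]]] := controlled_sum C Cb0 c0 (leqnn N) F1V.
pose B := 2 * F * ((N * N)%:R * Cb ^+ 2).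
have F2 : 0 <= 2 * F by apply: mulr_ge0.
have B0 : 0 <= B by apply: mulr_ge0 => //; apply: mulr_ge0 => //; exact: sqr_ge0.
have top eta H w T : 0 < eta <= Num.min e1 (c + 1)^-1 -> slow N C Cb c eta H w ->
    energy N H w T N <= 2 * F * a * energy N H w T 0 + 2 * F * (b / eta) + B.
  move=> /andP[ep]; rewrite le_min => /andP[ee ec] s.
  have ce : c * eta <= 1.
    have cp : 0 < c + 1 by rewrite ltr_wpDl.
    by rewrite -(ler_pM2l cp) divff ?gt_eqF // in ec; lra.
  have h1 := energy_top C0 Cb0 T s ce; rewrite -/F in h1.
  have h2 := hsum eta H w T; rewrite ep ee in h2; have {}h2 := ler_wpM2l F0 (h2 isT s).
  have EN := energy_ge0 T N s.
  have h3 : F * ((2 * (F + 1))^-1 * energy N H w T N) <= energy N H w T N / 2.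
    by rewrite mulrA mulrC ler_wpM2l // -(ler_pM2r F1) mulfVK ?gt_eqF //; lra.
  set z := (2 * (F + 1))^-1 in h2 h3; rewrite !mulrDr in h1 h2; rewrite /B; lra.
have e2 : 0 < Num.min e1 (c + 1)^-1 by rewrite lt_min e10 invr_gt0 ltr_wpDl.
have Be eta : 0 < eta -> eta <= 1 -> B <= B / eta.
  by move=> ep el; rewrite ler_pdivlMr // ler_piMr.
(* For [N = 0] the recurrence makes the gap vanish; for [N = 1] the top energy is the one wanted;
   otherwise order 1 lies strictly between 0 and [N]. *)
have [N0|[N1|N2]] : N = 0%N \/ N = 1%N \/ (1 < N)%N by case: (N) => [|[|m]]; auto.
- exists 0, 0, 1; split=> // eta H w T /andP[ep _] s.
  have Hz u : (0 < u)%N -> H 0%N u = 0.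
    move=> u0; apply/normr0_eq0/eqP; rewrite eq_le normr_ge0 andbT.
    by have := slow_rec s u0; rewrite N0 addn0 big_ord0 mulr0.
  rewrite !mul0r addr0 /energy big_nat big1 // => t /andP[Nt _].
  have t0 : (0 < t)%N by apply: leq_ltn_trans Nt.
  have := slow_diff s 0 t; rewrite !Hz // add0r => /esym/eqP.
  by rewrite mulf_eq0 gt_eqF //= => /eqP->; rewrite expr0n mulr0.
- exists (2 * F * a), (2 * F * b + B), (Num.min 1 (Num.min e1 (c + 1)^-1)); split.
  + exact: mulr_ge0.
  + by apply: addr_ge0 => //; apply: mulr_ge0.
  + by rewrite lt_min ltr01.
  move=> eta H w T /andP[ep]; rewrite le_min => /andP[el1 el] s.
  have h := top eta H w T; rewrite ep el in h; have {}h := h isT s.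
  rewrite -[X in energy _ _ _ _ X <= _]N1 (mulrDl (2 * F * b) B) -(mulrA _ b).
  by have := Be eta ep el1; lra.
have [a' [b' [e3 [a0' b0' e30 h3]]]] : controlled N C Cb c 1 N 1.
  have E : (1 + (N - 2).+1)%N = N by rewrite add1n -addn2 subnK.
  by rewrite -[X in controlled _ _ _ _ _ X _]E; apply: controlled_later => //; rewrite E.
exists (a' + 2 * F * a), (b' + 2 * F * b + B), (Num.min (Num.min 1 e3) (Num.min e1 (c + 1)^-1)); split.
- by apply: addr_ge0 => //; apply: mulr_ge0.
- by apply: addr_ge0 => //; apply: addr_ge0 => //; apply: mulr_ge0.
- by rewrite !lt_min ltr01 e30 -lt_min.
move=> eta H w T /andP[ep]; rewrite le_min => /andP[]; rewrite le_min => /andP[el1 el3] el s.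
have h1 := top eta H w T; rewrite ep el in h1; have {}h1 := h1 isT s.
have h2 := h3 eta H w T; rewrite ep el3 mul1r in h2; have {}h2 := h2 isT s.
rewrite (mulrDl a' (2 * F * a)) (mulrDl (b' + 2 * F * b) B) (mulrDl b' (2 * F * b)) -(mulrA (2 * F) a) -(mulrA (2 * F) b).
by have := Be eta ep el1; rewrite -(mulrA (2 * F) a) in h1; lra.
Qed.

(** * Regret of one player *)

Section Regret.
Variables (R : realType) (I : finType).
Implicit Types (x v u : I -> R).

Definition mean x v : R := \sum_a x a * v a.
Definition variance x v : R := \sum_a x a * (v a - mean x v) ^+ 2.

Lemma variance_ge0 x v : (forall a, 0 <= x a) -> 0 <= variance x v.
Proof. by move=> x0; apply: sumr_ge0 => a _; rewrite mulr_ge0 ?sqr_ge0. Qed.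

(** Splits the variance into the loss gaps of pairs of actions, to which the recurrence applies. *)
Lemma variance_pairs x v : \sum_a x a = 1 ->
  variance x v = 2^-1 * \sum_a \sum_b x a * x b * (v a - v b) ^+ 2.
Proof.
move=> x1; set m2 := \sum_a x a * v a ^+ 2.
have -> : variance x v = m2 - mean x v ^+ 2.
  rewrite /variance.
  have E a : x a * (v a - mean x v) ^+ 2 =
    x a * v a ^+ 2 + (- (2 * mean x v)) * (x a * v a) + mean x v ^+ 2 * x a by ring.
  under eq_bigr => a _ do rewrite E.
  rewrite !big_split /= -!mulr_sumr x1 -/m2 -/(mean x v); ring.
have -> : \sum_a \sum_b x a * x b * (v a - v b) ^+ 2 =
    \sum_a (x a * v a ^+ 2 + (- (2 * mean x v)) * (x a * v a) + m2 * x a).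
  apply: eq_bigr => a _.
  have E b : x a * x b * (v a - v b) ^+ 2 =
    (x a * v a ^+ 2) * x b + (- (2 * (x a * v a))) * (x b * v b) + x a * (x b * v b ^+ 2) by ring.
  under eq_bigr => b _ do rewrite E.
  rewrite !big_split /= -!mulr_sumr x1 -/m2 -/(mean x v); ring.
by rewrite !big_split /= -!mulr_sumr x1 -/m2 -/(mean x v); field.
Qed.

Lemma mean_centered x v : \sum_a x a = 1 -> \sum_a x a * (v a - mean x v) = 0.
Proof.
move=> x1; under eq_bigr => a _ do rewrite mulrBr.
by rewrite big_split /= sumrN -mulr_suml x1 mul1r subrr.
Qed.

Lemma mean_itv x v lo hi : (forall a, 0 <= x a) -> \sum_a x a = 1 ->
  (forall a, lo <= v a <= hi) -> lo <= mean x v <= hi.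
Proof.
move=> x0 x1 hv; rewrite -[lo]mul1r -[hi]mul1r -x1 !mulr_suml.
by apply/andP; split; apply: ler_sum => a _; rewrite ler_wpM2l //; case/andP: (hv a).
Qed.

Lemma expR_upper (y : R) : `|y| <= 2^-1 -> expR y <= 1 + y + 2 * y ^+ 2.
Proof.
move=> hy; have [_ /(_ y hy 2%N)] := expR_unit_series R.
rewrite !big_ord_recr big_ord0 /= add0r expr0 expr1 (_ : 0`! = 1%N) // (_ : 1`! = 1%N) //.
rewrite invr1 !mul1r real_normK ?num_real // => h.
by have := le_trans (ler_norm _) h; lra.
Qed.

Lemma expR_lower (y : R) : `|y| <= 8^-1 -> 1 + y + y ^+ 2 / 4 <= expR y.
Proof.
move=> hy; have hy2 : `|y| <= 2^-1 by apply: le_trans hy _; lra.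
have [_ /(_ y hy2 3%N)] := expR_unit_series R.
rewrite !big_ord_recr big_ord0 /= add0r expr0 expr1 (_ : 0`! = 1%N) // (_ : 1`! = 1%N) //.
rewrite (_ : 2`! = 2%N) // invr1 !mul1r (exprS `|y|) real_normK ?num_real // => h.
have h2 : 2 * (`|y| * y ^+ 2) <= y ^+ 2 / 4.
  have : `|y| * y ^+ 2 <= 8^-1 * y ^+ 2 by rewrite ler_wpM2r ?sqr_ge0.
  lra.
have : - (expR y - (1 + y + 2^-1 * y ^+ 2)) <= 2 * (`|y| * y ^+ 2).
  by apply: le_trans h; rewrite -normrN; apply: ler_norm.
lra.
Qed.

Lemma ln_lower (w : R) : 0 <= w -> w <= 1 -> w / 2 <= ln (1 + w).
Proof.
move=> w0 w1; rewrite -[leLHS]expRK ler_ln ?posrE ?expR_gt0 ?ltr_pwDl //.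
have hw : `|w / 2| <= 2^-1 by rewrite ger0_norm ?divr_ge0 //; lra.
apply: le_trans (expR_upper hw) _.
have : w ^+ 2 <= w by rewrite expr2 ler_piMr.
rewrite expr_div_n; lra.
Qed.

Lemma mgf_shift x v (s : R) : \sum_a x a = 1 ->
  \sum_a x a * expR (s * v a) =
  expR (s * mean x v) * \sum_a x a * expR (s * (v a - mean x v)).
Proof.
move=> x1; rewrite mulr_sumr; apply: eq_bigr => a _.
by rewrite mulrCA -expRD; congr (_ * expR _); ring.
Qed.

Lemma mgf_gt0 x v : (forall a, 0 < x a) -> \sum_a x a = 1 -> 0 < \sum_a x a * expR (v a).
Proof.
move=> x0 x1; have [a _|I0] := pickP (fun _ : I => true).
  rewrite (bigD1 a) //= ltr_pwDl ?mulr_gt0 ?expR_gt0 // sumr_ge0 // => b _.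
  by rewrite mulr_ge0 ?expR_ge0 // ltW.
by move: x1; rewrite big1 => [/eqP|b _]; [rewrite eq_sym oner_eq0|have := I0 b].
Qed.

(** After centring, the linear term of the exponential averages to 0 and the quadratic one to a
    multiple of the variance. *)
Lemma log_mgf_upper x v (s : R) : (forall a, 0 < x a) -> \sum_a x a = 1 ->
  (forall a, -1 <= v a <= 1) -> `|s| <= 16^-1 ->
  ln (\sum_a x a * expR (s * v a)) <= s * mean x v + 2 * s ^+ 2 * variance x v.
Proof.
move=> x0 x1 hv hs; have x0' a : 0 <= x a by apply: ltW.
have hm := mean_itv x0' x1 hv.
have hy a : `|s * (v a - mean x v)| <= 8^-1.
  have : `|v a - mean x v| <= 2 by rewrite ler_norml; have := hv a; lra.
  move=> h; rewrite normrM; apply: le_trans (ler_pM _ _ hs h) _ => //; lra.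
rewrite mgf_shift // lnM ?posrE ?expR_gt0 ?mgf_gt0 // expRK lerD2l.
have -> : 2 * s ^+ 2 * variance x v = \sum_a x a * (2 * (s * (v a - mean x v)) ^+ 2).
  by rewrite /variance mulr_sumr; apply: eq_bigr => a _; ring.
set W := \sum_a x a * (2 * _).
have W0 : 0 <= W by apply: sumr_ge0 => a _; rewrite mulr_ge0 // mulr_ge0 // sqr_ge0.
have h : \sum_a x a * expR (s * (v a - mean x v)) <= 1 + W.
  have -> : 1 + W = \sum_a x a * (1 + s * (v a - mean x v) + 2 * (s * (v a - mean x v)) ^+ 2).
    under eq_bigr => a _ do rewrite mulrDr (mulrDr _ 1) mulr1 (mulrCA (x a) s).
    by rewrite !big_split /= -mulr_sumr mean_centered // mulr0 addr0 x1.
  apply: ler_sum => a _; rewrite ler_wpM2l // expR_upper //.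
  by apply: le_trans (hy a) _; lra.
apply: le_trans (_ : ln (1 + W) <= _); last by apply: le_ln1Dx; lra.
by rewrite ler_ln ?posrE ?mgf_gt0 //; lra.
Qed.

Lemma log_mgf_lower x u (s : R) : (forall a, 0 < x a) -> \sum_a x a = 1 ->
  (forall a, 0 <= u a <= 1) -> `|s| <= 16^-1 ->
  s * mean x u + s ^+ 2 / 8 * variance x u <= ln (\sum_a x a * expR (s * u a)).
Proof.
move=> x0 x1 hv hs; have x0' a : 0 <= x a by apply: ltW.
have hm := mean_itv x0' x1 hv.
have hd a : `|u a - mean x u| <= 1 by rewrite ler_norml; have := hv a; lra.
have hy a : `|s * (u a - mean x u)| <= 8^-1.
  rewrite normrM; apply: le_trans (ler_pM _ _ hs (hd a)) _ => //; lra.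
rewrite mgf_shift // lnM ?posrE ?expR_gt0 ?mgf_gt0 // expRK lerD2l.
set W := s ^+ 2 / 4 * variance x u.
have -> : s ^+ 2 / 8 * variance x u = W / 2 by rewrite /W; field.
have WE : W = \sum_a x a * ((s * (u a - mean x u)) ^+ 2 / 4).
  by rewrite /W /variance mulr_sumr; apply: eq_bigr => a _; ring.
have W0 : 0 <= W by rewrite mulr_ge0 ?variance_ge0 // divr_ge0 // sqr_ge0.
have W1 : W <= 1.
  rewrite WE -[leRHS]x1; apply: ler_sum => a _; rewrite -[leRHS]mulr1 ler_wpM2l //.
  have : (s * (u a - mean x u)) ^+ 2 <= 1.
    rewrite -(real_normK (num_real (s * (u a - mean x u)))) expr_le1 //.
    by apply: le_trans (hy a) _; lra.
  lra.
apply: le_trans (ln_lower W0 W1) _.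
rewrite ler_ln ?posrE ?mgf_gt0 ?ltr_pwDl //.
have -> : 1 + W = \sum_a x a * (1 + s * (u a - mean x u) + (s * (u a - mean x u)) ^+ 2 / 4).
  under eq_bigr => a _ do rewrite mulrDr (mulrDr _ 1) mulr1 (mulrCA (x a) s).
  by rewrite !big_split /= -mulr_sumr mean_centered // mulr0 addr0 x1 WE.
by apply: ler_sum => a _; rewrite ler_wpM2l // expR_lower.
Qed.

(* [X t] and [U t] are the strategy of round [t + 1] and the loss of round [t]. The
   potential is the logarithm of the weight that plain Hedge gives to [b]. *)
Lemma optimistic_hedge_regret (eta : R) (X U : nat -> I -> R) : 0 < eta -> eta <= 16^-1 ->
  (forall a, X 0%N a = #|I|%:R^-1) -> (forall a, U 0%N a = 0) ->
  (forall t a, 0 < X t a) -> (forall t, \sum_a X t a = 1) ->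
  (forall t a, 0 <= U t a <= 1) ->
  (forall t a, X t.+1 a = X t a * expR (- (eta * (2 * U t.+1 a - U t a))) /
     \sum_b X t b * expR (- (eta * (2 * U t.+1 b - U t b)))) ->
  forall T b, \sum_(t < T) mean (X t) (U t.+1) - \sum_(t < T) U t.+1 b <=
    ln #|I|%:R / eta + \sum_(t < T) (2 * eta * variance (X t) (fun a => U t.+1 a - U t a)
                                 - eta / 8 * variance (X t) (U t)).
Proof.
move=> e0 e1 X0 U0 Xp X1 U01 XS T b.
have I0 : (0 < #|I|)%N by apply/card_gt0P; exists b.
have hs : `|eta| <= 16^-1 by rewrite gtr0_norm.
(* Multiplying [X t] by [expR (eta * U t)] and dividing by [B t] undoes the optimistic term and
   gives plain Hedge; [A t / B t] is the normalizer of its next step. *)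
pose A t := \sum_a X t a * expR (- eta * (U t.+1 a - U t a)).
pose B t := \sum_a X t a * expR (eta * U t a).
have Ap t : 0 < A t by apply: mgf_gt0.
have Bp t : 0 < B t by apply: mgf_gt0.
have hA t : ln (A t) + eta * mean (X t) (fun a => U t.+1 a - U t a) <=
    2 * eta ^+ 2 * variance (X t) (fun a => U t.+1 a - U t a).
  have hv a : -1 <= U t.+1 a - U t a <= 1 by have := U01 t a; have := U01 t.+1 a; lra.
  have hs' : `|- eta| <= 16^-1 by rewrite normrN.
  have := log_mgf_upper (Xp t) (X1 t) hv hs'; rewrite sqrrN -/(A t); lra.
have hB t : eta ^+ 2 / 8 * variance (X t) (U t) <= ln (B t) - eta * mean (X t) (U t).
  by rewrite lerBrDl; apply: log_mgf_lower.
pose phi t := ln (X t b) + eta * U t b - ln (B t).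
have phiS t : phi t.+1 = phi t - eta * U t.+1 b - ln (A t) + ln (B t).
  pose Z := \sum_b X t b * expR (- (eta * (2 * U t.+1 b - U t b))).
  have Zp : 0 < Z by apply: mgf_gt0.
  have BE : B t.+1 = A t / Z.
    rewrite /B /A mulr_suml; apply: eq_bigr => a _; rewrite XS -/Z.
    have EE : expR (- eta * (U t.+1 a - U t a)) =
        expR (- (eta * (2 * U t.+1 a - U t a))) * expR (eta * U t.+1 a).
      by rewrite -expRD; congr expR; ring.
    by rewrite EE; ring.
  rewrite /phi BE XS -/Z !ln_div ?posrE ?mulr_gt0 ?expR_gt0 // lnM ?posrE ?expR_gt0 // expRK.
  by ring.
have phiT t : phi t <= 0.
  rewrite subr_le0 -[eta * U t b]expRK -lnM ?posrE ?expR_gt0 //.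
  rewrite ler_ln ?posrE ?mulr_gt0 ?expR_gt0 // /B (bigD1 b) //= lerDl sumr_ge0 // => a _.
  by rewrite mulr_ge0 ?expR_ge0 // ltW.
have phi0 : phi 0%N = - ln #|I|%:R.
  rewrite /phi /B; under eq_bigr => a _ do rewrite U0 mulr0 expR0 mulr1.
  by rewrite X1 ln1 U0 mulr0 addr0 subr0 X0 lnV ?posrE ?ltr0n.
have tel : \sum_(t < T) (ln (B t) - ln (A t)) - eta * \sum_(t < T) U t.+1 b = phi T - phi 0%N.
  elim: T => [|T IH]; first by rewrite !big_ord0 mulr0 !subrr.
  rewrite !big_ord_recr /= phiS.
  transitivity ((\sum_(t < T) (ln (B t) - ln (A t)) - eta * \sum_(t < T) U t.+1 b) +
    (ln (B T) - ln (A T) - eta * U T.+1 b)); first by ring.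
  by rewrite IH; ring.
have step t : eta * mean (X t) (U t.+1) <= (ln (B t) - ln (A t)) +
   eta * (2 * eta * variance (X t) (fun a => U t.+1 a - U t a) - eta / 8 * variance (X t) (U t)).
  have -> : mean (X t) (U t.+1) = mean (X t) (fun a => U t.+1 a - U t a) + mean (X t) (U t).
    by rewrite /mean -big_split /=; apply: eq_bigr => a _; ring.
  move: (hA t) (hB t); set m1 := mean _ _; set m2 := mean _ _; set v1 := variance _ _; set v2 := variance _ _.
  move=> h1 h2.
  have -> : eta * (2 * eta * v1 - eta / 8 * v2) = 2 * eta ^+ 2 * v1 - eta ^+ 2 / 8 * v2 by ring.
  rewrite mulrDr. lra.
rewrite -(ler_pM2l e0) !mulrDr mulrN mulrCA mulfV ?gt_eqF // mulr1.
set V := \sum_(t < T) (_ - _).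
have total : eta * \sum_(t < T) mean (X t) (U t.+1) <= \sum_(t < T) (ln (B t) - ln (A t)) + eta * V.
  by rewrite !mulr_sumr -big_split; apply: ler_sum => t _; apply: step.
have := phiT T; rewrite phi0 in tel; lra.
Qed.

End Regret.

(** * Payoffs and trajectories *)

Section Payoffs.
Variables (R : realType) (n : nat) (d : 'I_n -> nat).
Variable l : joint_action d -> 'I_n -> R.
Implicit Types x : vectors R d.

Lemma sum_opponents x (i : 'I_n) (b : 'I_(d i)) : (forall j, \sum_(c < d j) x j c = 1) ->
  \sum_(a : joint_action d | a i == b) \prod_(j < n | j != i) x j (a j) = 1.
Proof.
move=> x1.
(* The indicator of [b] in coordinate [i] makes the restricted sum a full product; comparing
   numerical values avoids transport between ['I_(d j)] and ['I_(d i)]. *)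
pose F j (c : 'I_(d j)) : R := if j == i then (nat_of_ord c == nat_of_ord b)%:R else x j c.
transitivity (\sum_(a : joint_action d) \prod_j F j (a j)).
  rewrite big_mkcond; apply: eq_bigr => a _.
  rewrite [RHS](bigD1 i) //= {1}/F eqxx val_eqE.
  under [in RHS]eq_bigr => j ji do rewrite /F (negbTE ji).
  by case: eqP; rewrite ?mul1r ?mul0r.
rewrite sum_prod_dffun big1 // => j _; rewrite /F; case: eqP => [ji|_]; last exact: x1.
have lt : (b < d j)%N by rewrite ji ltn_ord.
rewrite (bigD1 (Ordinal lt)) //= eqxx big1 ?addr0 // => c.
by rewrite -val_eqE /= => /negbTE ->.
Qed.

Lemma expected_loss_itv x : (forall a i, 0 <= l a i <= 1) ->
  (forall j c, 0 <= x j c) -> (forall j, \sum_(c < d j) x j c = 1) ->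
  forall i b, 0 <= expected_loss l x i b <= 1.
Proof.
move=> hl x0 x1 i b; have p0 a : 0 <= \prod_(j < n | j != i) x j (a j : 'I_(d j)).
  by apply: prodr_ge0.
apply/andP; split.
  by apply: sumr_ge0 => a _; rewrite mulr_ge0 //; case/andP: (hl a i).
rewrite -[leRHS](sum_opponents b x1); apply: ler_sum => a _.
by rewrite ler_piMl //; case/andP: (hl a i).
Qed.

Lemma expected_own_loss x i :
  \sum_(a : joint_action d) (\prod_j x j (a j)) * l a i =
  \sum_(b < d i) x i b * expected_loss l x i b.
Proof.
rewrite (partition_big (fun a : joint_action d => a i) xpredT) //=.
apply: eq_bigr => b _; rewrite /expected_loss mulr_sumr; apply: eq_bigr => a /eqP ab.
by rewrite (bigD1 i) //= ab -mulrA (mulrC (l a i)).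
Qed.

Lemma deviate_same (a : joint_action d) (i : 'I_n) (b : 'I_(d i)) : deviate a b i = b.
Proof. by rewrite /deviate ffunE dfwithin. Qed.

Lemma deviate_other (a : joint_action d) (i j : 'I_n) (b : 'I_(d i)) : j != i -> deviate a b j = a j.
Proof. by move=> ji; rewrite /deviate ffunE dfwithout // eq_sym. Qed.

Lemma deviate_eq (a a' : joint_action d) (i : 'I_n) : (forall j, j != i -> a j = a' j) ->
  deviate a (a' i) = a'.
Proof.
move=> h; apply/ffunP => j; have [->|ji] := eqVneq j i; first exact: deviate_same.
by rewrite deviate_other // h.
Qed.

(** Grouping the joint actions by their deviated profile leaves a free sum over player [i]'s own
    action, of total mass 1. *)
Lemma expected_deviation_loss x i (b : 'I_(d i)) : \sum_(c < d i) x i c = 1 ->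
  \sum_(a : joint_action d) (\prod_j x j (a j)) * l (deviate a b) i = expected_loss l x i b.
Proof.
move=> x1; rewrite (partition_big (fun a => deviate a b) (fun a' : joint_action d => a' i == b)) /=; last first.
  by move=> a _; rewrite deviate_same.
rewrite /expected_loss; apply: eq_bigr => a' /eqP ab.
transitivity (\sum_(a : joint_action d | deviate a b == a') x i (a i) *
   (l a' i * \prod_(j < n | j != i) x j (a' j))).
  apply: eq_bigr => a /eqP da; rewrite (bigD1 i) //= da -mulrA; congr (_ * _).
  rewrite mulrC; congr (_ * _); apply: eq_bigr => j ji.
  by rewrite -da deviate_other.
rewrite -mulr_suml.
have -> : \sum_(a : joint_action d | deviate a b == a') x i (a i) = \sum_(c < d i) x i c.
  rewrite (reindex_onto (fun c => deviate a' c) (fun a : joint_action d => a i)) /=.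
    apply: eq_big => [c|c _]; last by rewrite deviate_same.
    rewrite deviate_same eqxx andbT; apply/eqP; rewrite -ab.
    by apply: deviate_eq => j ji; rewrite deviate_other.
  move=> a /eqP da; rewrite -da; apply/ffunP => j; have [->|ji] := eqVneq j i.
    by rewrite deviate_same.
  by rewrite !deviate_other.
by rewrite x1 mul1r.
Qed.

End Payoffs.

(** * The iterates as orbits of the analytic map *)

Section Trajectory.
Variables (R : realType) (n : nat) (d : 'I_n -> nat) (hd : forall i, (0 < d i)%N).
Variable l : joint_action d -> 'I_n -> R.
Hypothesis hl : forall a i, 0 <= l a i <= 1.
Variable eta : R.
Notation st t := (hedge_state l eta t).

Lemma hedge_stateS t : st t.+1 =
  (hedge_step eta (st t).1 (expected_loss l (st t).1) (st t).2, expected_loss l (st t).1).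
Proof. by rewrite [LHS]/=; case: (st t). Qed.

Lemma hedge_normalizer_gt0 (x cur prev : vectors R d) i : (forall a, 0 < x i a) ->
  0 < \sum_(b < d i) x i b * expR (- (eta * (2 * cur i b - prev i b))).
Proof.
move=> x0; rewrite (bigD1 (Ordinal (hd i))) //= ltr_pwDl ?mulr_gt0 ?expR_gt0 //.
by apply: sumr_ge0 => b _; rewrite mulr_ge0 ?expR_ge0 // ltW.
Qed.

Lemma hedge_state_prob t : (forall i a, 0 < (st t).1 i a) /\
  (forall i, \sum_(a < d i) (st t).1 i a = 1).
Proof.
elim: t => [|t [x0 x1]].
  split=> i; first by move=> a; rewrite invr_gt0 ltr0n.
  by rewrite sumr_const card_ord -[LHS]mulr_natl mulfV // pnatr_eq0 -lt0n.
have Z0 i := hedge_normalizer_gt0 (expected_loss l (st t).1) (st t).2 (x0 i).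
rewrite hedge_stateS /=; split=> i.
  by move=> a; rewrite divr_gt0 ?mulr_gt0 ?expR_gt0.
by rewrite /hedge_step -mulr_suml mulfV // (gt_eqF (Z0 i)).
Qed.

Lemma hedge_state_le1 t i a : 0 <= (st t).1 i a <= 1.
Proof.
have [x0 x1] := hedge_state_prob t; rewrite ltW //= -(x1 i) (bigD1 a) //= lerDl.
by apply: sumr_ge0 => b _; apply: ltW.
Qed.

Lemma hedge_loss_itv t i a : 0 <= (st t).2 i a <= 1.
Proof.
case: t => [|t]; first by rewrite /= lexx ler01.
have [x0 x1] := hedge_state_prob t.
by rewrite hedge_stateS; apply: expected_loss_itv => // j c; apply: ltW.
Qed.

Definition state_code t : nat -> R := encode (st t).1 (st t).2 l.

Lemma state_code_cube t : cube (state_code t).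
Proof.
by apply: encode_cube => //; [exact: hedge_state_le1|exact: hedge_loss_itv].
Qed.

(** Any round may serve as the initial state, so estimates on orbits from the cube hold at all
    times. The iterates are mixed strategies, on which both forms of the update agree. *)
Lemma orbit_state_code t s : orbit d s (state_code t) eta = st (t + s).
Proof.
elim: s => [|s IH].
  by rewrite addn0 /= /state_code encode_strategy encode_previous; case: (st t).
have [x0 x1] := hedge_state_prob (t + s).
rewrite addnS hedge_stateS hedge_step_analytic //; last by move=> i a; apply: ltW.
by rewrite /= IH /state_code encode_table; case: (st (t + s)).
Qed.

Definition loss_gap (i : 'I_n) (a b : 'I_(d i)) (t : nat) : R := (st t).2 i a - (st t).2 i b.

Definition sdiff (f : nat -> R) : nat -> R := fun t => f t.+1 - f t.

Lemma gap_state_code i (a b : 'I_(d i)) k s t :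
  iter k (@fdiff R) (gap a b) s (state_code t) eta = iter k sdiff (loss_gap a b) (t + s).+1.
Proof.
elim: k s => [|k IH] s; last by rewrite !iterS /sdiff /fdiff !IH addnS.
by rewrite /= /gap /orbit_u !orbit_state_code addnS.
Qed.

Definition pair_weight (i : 'I_n) (a b : 'I_(d i)) (t : nat) : R := (st t).1 i a * (st t).1 i b.

Hypothesis eta0 : 0 < eta.
Hypothesis eta1 : eta <= 16^-1.

(** With losses in the unit interval the exponents lie between [- 2 * eta] and [eta], and so does
    the logarithm of the normalizer; the quotient stays within [3 * eta]. *)
Lemma hedge_ratio t i a : expR (- (3 * eta)) * (st t).1 i a <= (st t.+1).1 i a <=
  expR (3 * eta) * (st t).1 i a.
Proof.
have [x0 x1] := hedge_state_prob t.
pose e b := expR (- (eta * (2 * (st t.+1).2 i b - (st t).2 i b))).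
pose Z := \sum_(b < d i) (st t).1 i b * e b.
have E : (st t.+1).1 i a = (st t).1 i a * (e a / Z).
  by rewrite mulrA /Z /e hedge_stateS /= /hedge_step.
have eb b : expR (- (2 * eta)) <= e b <= expR eta.
  have := hedge_loss_itv t b; have := hedge_loss_itv t.+1 b.
  rewrite /e !ler_expR; set q := 2 * _ - _ => h h'.
  have [q1 q2] : -1 <= q /\ q <= 2 by rewrite /q; split; lra.
  by have := ler_wpM2l (ltW eta0) q1; have := ler_wpM2l (ltW eta0) q2; lra.
have Zb : expR (- (2 * eta)) <= Z <= expR eta.
  apply: (mean_itv (x := (st t).1 i) (v := e)) => // b; exact: ltW.
have Zp : 0 < Z by case/andP: Zb => h _; apply: lt_le_trans h; exact: expR_gt0.
rewrite E; apply/andP; split.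
  rewrite [leLHS]mulrC ler_wpM2l ?(ltW (x0 i a)) // ler_pdivlMr //; case/andP: (eb a) => h1 _; apply: le_trans h1.
  have -> : - (2 * eta) = - (3 * eta) + eta by ring.
  by rewrite expRD ler_wpM2l ?expR_ge0 //; case/andP: Zb.
rewrite [leRHS]mulrC ler_wpM2l ?(ltW (x0 i a)) // ler_pdivrMr //; case/andP: (eb a) => _ h1; apply: le_trans h1 _.
have {1}-> : eta = 3 * eta + - (2 * eta) by ring.
by rewrite expRD ler_wpM2l ?expR_ge0 //; case/andP: Zb.
Qed.

(** Two factors give [expR (6 * eta)], and [12] comes from [expR (6 * eta) <= 1 + 12 * eta] for
    [eta <= 16^-1]. *)
Lemma pair_weight_ratio i (a b : 'I_(d i)) t :
  `|pair_weight a b t.+1 - pair_weight a b t| <= 12 * eta * pair_weight a b t.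
Proof.
have [x0 _] := hedge_state_prob t; have [x0' _] := hedge_state_prob t.+1.
have w0 : 0 <= pair_weight a b t by rewrite mulr_ge0 // ltW.
have /andP[la ua] := hedge_ratio t a; have /andP[lb ub] := hedge_ratio t b.
have h6 : `|6 * eta| <= 2^-1 by rewrite ger0_norm; move: eta0 eta1; lra.
have up : pair_weight a b t.+1 <= expR (6 * eta) * pair_weight a b t.
  have -> : expR (6 * eta) * pair_weight a b t =
     (expR (3 * eta) * (st t).1 i a) * (expR (3 * eta) * (st t).1 i b).
    by rewrite mulrACA -expRD /pair_weight; congr (expR _ * _); ring.
  by apply: ler_pM => //; apply: ltW.
have lo : expR (- (6 * eta)) * pair_weight a b t <= pair_weight a b t.+1.
  have -> : expR (- (6 * eta)) * pair_weight a b t =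
     (expR (- (3 * eta)) * (st t).1 i a) * (expR (- (3 * eta)) * (st t).1 i b).
    by rewrite mulrACA -expRD /pair_weight; congr (expR _ * _); ring.
  by apply: ler_pM => //; rewrite mulr_ge0 ?expR_ge0 // ltW.
have e6 : expR (6 * eta) <= 1 + 12 * eta.
  apply: le_trans (expR_upper h6) _; have : eta * eta <= 16^-1 * eta by rewrite ler_wpM2r // ltW.
  have -> : (6 * eta) ^+ 2 = 36 * (eta * eta) by ring.
  by move: eta0; lra.
have e6' : 1 - 6 * eta <= expR (- (6 * eta)) by apply: le_trans (expR_ge1Dx _); lra.
have h1 := ler_wpM2r w0 e6; have h2 := ler_wpM2r w0 e6'.
rewrite ler_norml; apply/andP; split; nra.
Qed.

End Trajectory.

(** * Uniform constants *)

Section Assembly.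
Variables (R : realType) (n : nat) (d : 'I_n -> nat) (hd : forall i, (0 < d i)%N).
Notation table l := (forall (a : joint_action d) (i : 'I_n), 0 <= l a i <= 1).

Lemma gap_differences_bounded i (a b : 'I_(d i)) m : exists Cb r, [/\ 0 <= Cb, 0 < r &
  forall k y t, (k <= m)%N -> cube y -> 0 < t <= r ->
    `|iter k (@fdiff R) (gap a b) k y t| <= Cb * t ^+ k].
Proof.
elim: m => [|m [C1 [r1 [C10 r10 h1]]]].
  have [C [r [C0 r0 h]]] := @gap_difference_bigO R n d i a b 0 0 (leqnn 0).
  by exists C, r; split=> // k y t; rewrite leqn0 => /eqP->; apply: h.
have [C2 [r2 [C20 r20 h2]]] := @gap_difference_bigO R n d i a b m.+1 m.+1 (leqnn _).
exists (C1 + C2), (Num.min r1 r2); split; [exact: addr_ge0|by rewrite lt_min r10|].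
move=> k y t; rewrite leq_eqVlt ltnS => km cy /andP[t0]; rewrite le_min => /andP[tr1 tr2].
rewrite mulrDl; case/orP: km => [/eqP->|km].
  apply: le_trans (h2 y t cy _) _; first by rewrite t0.
  by rewrite lerDr mulr_ge0 // exprn_ge0 // ltW.
apply: le_trans (h1 k y t km cy _) _; first by rewrite t0.
by rewrite lerDl mulr_ge0 // exprn_ge0 // ltW.
Qed.

Lemma loss_gap_slow i (a b : 'I_(d i)) : exists N C Cb r, [/\ 0 <= C, 0 <= Cb, 0 < r &
  forall l : joint_action d -> 'I_n -> R, table l -> forall eta, 0 < eta -> eta <= r -> eta <= 16^-1 ->
    slow N C Cb 12 eta (fun k t => iter k (@sdiff R) (loss_gap l eta a b) t / eta ^+ k)
      (pair_weight l eta a b)].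
Proof.
have [N [C [r1 [C0 r10 h1]]]] := @gap_recurrence R n d i a b.
have [Cb [r2 [Cb0 r20 h2]]] := gap_differences_bounded a b N.
exists N, C, Cb, (Num.min r1 r2); split=> //; first by rewrite lt_min r10.
move=> l hl eta e0; rewrite le_min => /andP[er1 er2] e1.
have cp t := state_code_cube hd hl eta t.
have gp k s t := gap_state_code hd l eta a b k s t.
have norm_div k t : `|iter k (@sdiff R) (loss_gap l eta a b) t / eta ^+ k| =
    `|iter k (@sdiff R) (loss_gap l eta a b) t| / eta ^+ k.
  by rewrite normrM normfV normrX (gtr0_norm e0).
have ek k : 0 < eta ^+ k by apply: exprn_gt0.
split.
- move=> k t; set f := loss_gap l eta a b.
  have -> : iter k.+1 (@sdiff R) f t = iter k (@sdiff R) f t.+1 - iter k (@sdiff R) f t by [].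
  rewrite exprS.
  by field; rewrite (gt_eqF e0) gt_eqF.
- move=> k t kN kt; rewrite norm_div ler_pdivrMr //.
  (* Restart at the state of index [t - k.+1], from which the [k]-th difference at [t] has orbit
     index [k]; this is where [k < t] enters. *)
  have -> : t = (t - k.+1 + k).+1 by rewrite -addnS subnK.
  rewrite -gp; apply: h2 => //; by rewrite e0.
- case=> // t _; rewrite norm_div addSn -gp.
  have := h1 (state_code l eta t) eta (cp t); rewrite e0 er1 => /(_ isT) h.
  apply: le_trans h _; rewrite ler_wpM2l //; apply: ler_sum => k _.
  by rewrite norm_div addSn -gp.
- move=> t; have /andP[? ?] := hedge_state_le1 hd l eta t a.
  have /andP[? ?] := hedge_state_le1 hd l eta t b.
  by rewrite /pair_weight mulr_ge0 //= mulr_ile1.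
- by move=> t; apply: pair_weight_ratio.
Qed.

(** The first [N.+1] rounds cost at most [8 * eta] each. Beyond them the positive terms sum to at
    most [2 * eta ^ 3 * (K * S0 + B / eta)], with [S0] the energy of order 0. For
    [eta <= (16 * (K + 1))^-1] the part with [K] is at most [eta / 8 * S0], which the negative terms
    cancel. *)
Lemma pair_regret_bound i (a b : 'I_(d i)) : exists B e0, [/\ 0 <= B, 0 < e0 &
  forall l : joint_action d -> 'I_n -> R, table l -> forall eta, 0 < eta -> eta <= e0 -> eta <= 16^-1 -> forall T,
    \sum_(0 <= t < T) (2 * eta * (pair_weight l eta a b t * sdiff (loss_gap l eta a b) t ^+ 2)
       - eta / 8 * (pair_weight l eta a b t * loss_gap l eta a b t ^+ 2)) <= B * eta].
Proof.
have [N [C [Cb [r [C0 Cb0 r0 hs]]]]] := loss_gap_slow a b.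
have c0 : 0 <= 12 :> R by [].
have [K [B [e1 [K0 B0 e10 hE]]]] := @slow_energy_bound R N C Cb 12 C0 Cb0 c0.
have K1 : 0 < 16 * (K + 1) by rewrite mulr_gt0 // ltr_wpDl.
exists (8 * N.+1%:R + 2 * B), (Num.min (Num.min r e1) (16 * (K + 1))^-1); split.
- by rewrite addr_ge0 // mulr_ge0.
- by rewrite !lt_min r0 e10 invr_gt0.
move=> l hl eta e0; rewrite !le_min => /andP[/andP[er ee] eK] e16 T.
have s := hs l hl eta e0 er e16.
set w := pair_weight l eta a b in s *; set f := loss_gap l eta a b in s *.
have f1 t : `|f t| <= 1.
  have := hedge_loss_itv hd hl eta t a; have := hedge_loss_itv hd hl eta t b.
  by rewrite /f /loss_gap ler_norml; lra.
have w01 := slow_w s.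
have term t : 2 * eta * (w t * sdiff f t ^+ 2) - eta / 8 * (w t * f t ^+ 2) <= 8 * eta.
  have /andP[w0 w1] := w01 t.
  have h : sdiff f t ^+ 2 <= 4.
    rewrite -(real_normK (num_real (sdiff f t))).
    have : `|sdiff f t| <= 2.
      by apply: le_trans (ler_normB _ _) _; have := f1 t; have := f1 t.+1; lra.
    move=> h; rewrite (_ : 4 = 2 ^+ 2); last by ring.
    by rewrite lerXn2r ?nnegrE.
  have h2 : w t * sdiff f t ^+ 2 <= 4.
    by rewrite -[leRHS]mul1r ler_pM // sqr_ge0.
  have h3 : 0 <= eta / 8 * (w t * f t ^+ 2).
    by apply: mulr_ge0; [rewrite divr_ge0 // ltW|rewrite mulr_ge0 // sqr_ge0].
  have := ler_wpM2l (ltW e0) h2; lra.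
have ee1 : 0 < eta <= e1 by rewrite e0.
have big M : \sum_(N.+1 <= t < M) (2 * eta * (w t * sdiff f t ^+ 2) - eta / 8 * (w t * f t ^+ 2))
    <= 2 * B * eta.
  have := hE eta _ w M ee1 s; rewrite /energy.
  under eq_bigr => t _ do rewrite expr1 expr_div_n mulrA /=.
  under [X in _ <= K * X + _ -> _]eq_bigr => t _ do rewrite expr0 divr1 /=.
  rewrite -mulr_suml -/(sdiff f).
  rewrite sumrB -!mulr_sumr; set S1 := \sum_(_ <= _ < _) _; set S0 := \sum_(_ <= _ < _) _.
  rewrite ler_pdivrMr ?exprn_gt0 // mulrDl (_ : B / eta * eta ^+ 2 = B * eta); last first.
    by field; rewrite gt_eqF.
  move=> h; have S00 : 0 <= S0.
    by apply: sumr_ge0 => t _; rewrite mulr_ge0 ?sqr_ge0 //; case/andP: (w01 t).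
  have h1 : K * S0 * eta ^+ 2 <= eta * S0 / 16.
    have k1 : K * eta <= 16^-1.
      have := ler_wpM2l (ltW K1) eK; rewrite divff ?gt_eqF //.
      have := mulr_ge0 K0 (ltW e0); lra.
    have := ler_wpM2r (mulr_ge0 S00 (ltW e0)) k1; lra.
  have eta1 : eta <= 1 by lra.
  have h2 := ler_wpM2l (ltW e0) (le_trans h (lerD h1 (lexx _))).
  have h3 : eta * (eta * S0 / 16) <= eta * S0 / 16.
    have : 0 <= eta * S0 / 16 by rewrite divr_ge0 // mulr_ge0 // ltW.
    by move=> h3; rewrite ler_piMl.
  have h4 : eta * (B * eta) <= B * eta.
    by rewrite ler_piMl // mulr_ge0 // ltW.
  rewrite mulrDr in h2; lra.
case: (leqP N.+1 T) => NT.
  rewrite (big_cat_nat (n := N.+1)) //= (mulrDl (8 * N.+1%:R) (2 * B)); apply: lerD => //.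
  apply: le_trans (ler_sum _ (fun t _ => term t)) _.
  by rewrite sumr_const_nat subn0 -[leLHS]mulr_natl mulrA (mulrC _ 8).
apply: le_trans (ler_sum _ (fun t _ => term t)) _.
rewrite sumr_const_nat subn0 -[leLHS]mulr_natl.
have : T%:R <= N.+1%:R :> R by rewrite ler_nat ltnW.
move=> h; have := ler_wpM2r (mulr_ge0 (ler0n R 8) (ltW e0)) h.
have := mulr_ge0 B0 (ltW e0); lra.
Qed.

End Assembly.

Section UniformConstants.
Variables (R : realType) (n : nat) (d : 'I_n -> nat) (hd : forall i, (0 < d i)%N).
Notation table l := (forall (a : joint_action d) (i : 'I_n), 0 <= l a i <= 1).

(** Only finitely many triples of a player and two actions occur: their thresholds combine by
    minimum and their constants by sum, all chosen before the table [l]. *)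
Lemma external_regret_bound : exists e C : R, 0 < e /\
  forall l : joint_action d -> 'I_n -> R, table l -> forall eta, 0 < eta -> eta <= e ->
  forall i (b : 'I_(d i)) T,
    \sum_(t < T) mean ((hedge_state l eta t).1 i) ((hedge_state l eta t.+1).2 i)
      - \sum_(t < T) (hedge_state l eta t.+1).2 i b <= ln (d i)%:R / eta + C * eta.
Proof.
pose P := {i : 'I_n & ('I_(d i) * 'I_(d i))%type}.
have [p|f hf] := @boolp.choice P (R * R)%type (fun p Be => [/\ 0 <= Be.1, 0 < Be.2 &
  forall l : joint_action d -> 'I_n -> R, table l -> forall eta, 0 < eta -> eta <= Be.2 -> eta <= 16^-1 -> forall T,
    \sum_(0 <= t < T) (2 * eta * (pair_weight l eta (tagged p).1 (tagged p).2 t * sdiff (loss_gap l eta (tagged p).1 (tagged p).2) t ^+ 2)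
       - eta / 8 * (pair_weight l eta (tagged p).1 (tagged p).2 t * loss_gap l eta (tagged p).1 (tagged p).2 t ^+ 2)) <= Be.1 * eta]).
  by have [B [e0 [h1 h2 h3]]] := @pair_regret_bound R n d hd _ (tagged p).1 (tagged p).2; exists (B, e0).
exists (\big[Num.min/16^-1]_(p : P) (f p).2), (\sum_(p : P) (f p).1); split.
  elim/big_ind: _ => [|x y x0 y0|p _]; first by rewrite invr_gt0.
    by rewrite lt_min x0.
  by have [] := hf p.
move=> l hl eta e0 ee i b T.
have e16 : eta <= 16^-1 by apply: le_trans ee _; apply: bigmin_le_id.
have ef p : eta <= (f p).2 by apply: le_trans ee _; apply: bigmin_le_cond.
have pr t := hedge_state_prob hd l eta t.
have := @optimistic_hedge_regret R 'I_(d i) eta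
  (fun t => (hedge_state l eta t).1 i) (fun t => (hedge_state l eta t).2 i) e0 e16 _ _ _ _ _ _ T b.
rewrite card_ord => h; apply: le_trans (h _ _ _ _ _ _) _ => //.
- by move=> t a; have [x0 _] := pr t; apply: x0.
- by move=> t; have [_ x1] := pr t; apply: x1.
- by move=> t a; apply: hedge_loss_itv.
- by move=> t a; rewrite hedge_stateS.
rewrite lerD2l.
pose F (a c : 'I_(d i)) t := 2 * eta * (pair_weight l eta a c t * sdiff (loss_gap l eta a c) t ^+ 2)
       - eta / 8 * (pair_weight l eta a c t * loss_gap l eta a c t ^+ 2).
have E t : 2 * eta * variance ((hedge_state l eta t).1 i)
      (fun a => (hedge_state l eta t.+1).2 i a - (hedge_state l eta t).2 i a) -
    eta / 8 * variance ((hedge_state l eta t).1 i) ((hedge_state l eta t).2 i) =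
    2^-1 * \sum_(a < d i) \sum_(c < d i) F a c t.
  have [_ x1] := pr t; rewrite !variance_pairs // !mulr_sumr -sumrB.
  apply: eq_bigr => a _; rewrite !mulr_sumr -sumrB; apply: eq_bigr => c _.
  by rewrite /F /pair_weight /sdiff /loss_gap; ring.
under eq_bigr => t _ do rewrite E.
rewrite -mulr_sumr exchange_big /=.
under eq_bigr => a _ do rewrite exchange_big /=.
pose mk (j : 'I_n) (q : 'I_(d j) * 'I_(d j)) : P := existT _ j q.
have hF a c : \sum_(t < T) F a c t <= (f (mk i (a, c))).1 * eta.
  have [_ _ h3] := hf (mk i (a, c)).
  by rewrite -(big_mkord xpredT (F a c)); apply: h3.
have S0 : 0 <= \sum_(p : P) (f p).1 * eta.
  by apply: sumr_ge0 => p _; have [f0 _ _] := hf p; rewrite mulr_ge0 // ltW.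
have hS : \sum_(a < d i) \sum_(c < d i) \sum_(t < T) F a c t <= \sum_(p : P) (f p).1 * eta.
  apply: le_trans (_ : \sum_(a < d i) \sum_(c < d i) (f (mk i (a, c))).1 * eta <= _).
    by apply: ler_sum => a _; apply: ler_sum => c _; apply: hF.
  rewrite pair_big /=.
  have -> : \sum_(p : P) (f p).1 * eta =
      \sum_(j < n) \sum_(q : 'I_(d j) * 'I_(d j)) (f (mk j q)).1 * eta.
    rewrite (sig_big_dep _ (fun _ _ => true) (fun j q => (f (mk j q)).1 * eta)) /=.
    by apply: eq_bigr => -[j q].
  rewrite (bigD1 i) //=; apply: ler_wpDr.
    apply: sumr_ge0 => j _; apply: sumr_ge0 => q _.
    by have [f0 _ _] := hf (mk j q); rewrite mulr_ge0 // ltW.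
  by apply: ler_sum => -[a c].
rewrite mulr_suml; lra.
Qed.

Lemma average_playE (l : joint_action d -> 'I_n -> R) eta T (v : joint_action d -> R) :
  \sum_(a : joint_action d) average_play l eta T a * v a =
  T%:R^-1 * \sum_(t < T) \sum_(a : joint_action d) (\prod_j (hedge_state l eta t).1 j (a j)) * v a.
Proof.
rewrite exchange_big mulr_sumr; apply: eq_bigr => a _ /=.
by rewrite /average_play big_add1 big_mkord -mulr_suml mulrA.
Qed.

End UniformConstants.

Theorem corollary4p2 (R : realType) (n : nat) (d : 'I_n -> nat)
    (hn : (0 < n)%N) (hd : forall i : 'I_n, (0 < d i)%N) :
  exists eta_star C_star : R,
    0 < eta_star /\
    forall l : joint_action d -> 'I_n -> R,
      (forall (a : joint_action d) (i : 'I_n), 0 <= l a i <= 1) ->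
      forall eta : R, 0 < eta -> eta <= eta_star ->
        (forall (i : 'I_n) (T : nat), (1 <= T)%N ->
           regret l hd eta i T <= ln (d i)%:R / eta + C_star * eta) /\
        (forall T : nat, (1 <= T)%N ->
           cce_gap l hn hd (average_play l eta T) <=
           T%:R^-1 *
           fin_max (Ordinal hn)
             (fun i : 'I_n => ln (d i)%:R / eta + C_star * eta)).
Proof.
have [e [C [e0 h]]] := @external_regret_bound R n d hd.
exists e, C; split=> // l hl eta eta0 etae; have {}h := h l hl eta eta0 etae.
split=> [i T _|T T1].
  rewrite /regret big_add1 /= big_mkord lerBlDr -lerBlDl /fin_min.
  have key b : \sum_(t < T) \sum_(a < d i) hedge_strategy l eta t.+1 i a * hedge_loss l eta t.+1 i a
     - (ln (d i)%:R / eta + C * eta) <= \sum_(1 <= t < T.+1) hedge_loss l eta t i b.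
    by rewrite big_add1 /= big_mkord lerBlDr -lerBlDl; apply: h.
  by apply: le_bigmin => [|b _]; apply: key.
have T0 : 0 <= (T%:R^-1 : R) by rewrite invr_ge0.
have key i (b : 'I_(d i)) : \sum_(a : joint_action d) average_play l eta T a * (l a i - l (deviate a b) i) <=
    T%:R^-1 * fin_max (Ordinal hn) (fun i => ln (d i)%:R / eta + C * eta).
  (* In each round play is a product distribution, so the average gain from deviating to [b] is the
     regret against [b] divided by [T]. *)
  have -> : \sum_(a : joint_action d) average_play l eta T a * (l a i - l (deviate a b) i) =
    T%:R^-1 * (\sum_(t < T) mean ((hedge_state l eta t).1 i) ((hedge_state l eta t.+1).2 i)
      - \sum_(t < T) (hedge_state l eta t.+1).2 i b).
    rewrite average_playE -sumrB; congr (_ * _); apply: eq_bigr => t _.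
    have [_ x1] := hedge_state_prob hd l eta t.
    under eq_bigr => a _ do rewrite mulrBr.
    by rewrite sumrB expected_own_loss expected_deviation_loss // hedge_stateS.
  rewrite ler_wpM2l //; apply: le_trans (h i b T) _.
  by rewrite /fin_max; apply: le_bigmax_cond.
rewrite /cce_gap {1}/fin_max; apply: bigmax_le => [|i _]; rewrite /fin_max; apply: bigmax_le => //.
Qed.
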